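(* Let $d\geqslant 3$ be an integer and let $C_d\subset\mathbb{P}^2$ be a reduced plane curve of degree $d$ over $\mathbb{C}$. Then: (1) if $\mathrm{lct}(\mathbb{P}^2,C_d)<\frac{5}{2d}$, then $C_d$ is GIT-unstable; (2) if $\mathrm{lct}(\mathbb{P}^2,C_d)\leqslant\frac{5}{2d}$, then $C_d$ is not GIT-stable; (3) if $\mathrm{lct}(\mathbb{P}^2,C_d)=\frac{5}{2d}$, then $C_d$ is GIT-semistable if and only if $C_d$ is an even Płoski curve.
   Context: All varieties are projective and defined over $\mathbb{C}$. The curve $C_d$ may be reducible. For a point $P\in C_d$, $\mathrm{lct}_P(\mathbb{P}^2,C_d)=\sup\{\lambda\in\mathbb{Q}\mid \text{the log pair }(\mathbb{P}^2,\lambda C_d)\text{ is log canonical at }P\}$, and $\mathrm{lct}(\mathbb{P}^2,C_d)$ is the smallest value of $\mathrm{lct}_P(\mathbb{P}^2,C_d)$ as $P$ runs through all points of $C_d$. The curve $C_d$ is identified with a point of the projective space $|\mathcal{O}_{\mathbb{P}^2}(d)|$ parameterizing all (not necessarily reduced) plane curves of degree $d$; GIT-stable, GIT-semistable and GIT-unstable (meaning not GIT-semistable) refer to the natural action of $\mathrm{PGL}_3(\mathbb{C})$ on $|\mathcal{O}_{\mathbb{P}^2}(d)|$. $C_d$ is an even Płoski curve if $d$ is even, $C_d$ has $\frac d2\geqslant 2$ irreducible components that are smooth conics passing through a common point $P$, and all irreducible components of $C_d$ intersect each other pairwise at $P$ with multiplicity $4$. *)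

(* Defs.v *)
From HB Require Import structures.
From mathcomp Require Import all_boot all_order all_algebra.
From mathcomp Require Import complex.
From mathcomp Require Import mpoly.
From mathcomp Require Import boolp classical_sets reals.

Set Implicit Arguments.
Unset Strict Implicit.
Unset Printing Implicit Defensive.

Import Order.TTheory GRing.Theory Num.Theory.
Local Open Scope ring_scope.

(* A plane curve of degree d is given by a nonzero form F of degree d in       *)
(* K[X_0, X_1, X_2], determined up to a nonzero scalar; a point of P^2 is      *)
(* given by a nonzero row vector.                                              *)

Section PlaneCurves.
Context {K : fieldType}.

(* The scheme F = 0 is reduced: no factor is repeated. *)
Definition reduced (F : {mpoly K[3]}) : Prop :=
  F != 0 /\ forall G H : {mpoly K[3]}, F = G ^+ 2 * H -> G \is a GRing.unit.

Definition smooth_curve (F : {mpoly K[3]}) : Prop :=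
  forall P : 'rV[K]_3, P != 0 -> F.@[P 0] = 0 ->
  exists i : 'I_3, (F^`M(i)).@[P 0] != 0.

(* Equation of the curve F in the affine chart X_i <> 0, translated so that P  *)
(* is the origin: X_i is replaced by the constant P_i, and the two other       *)
(* variables by P_k plus an affine coordinate.  Meant for P_i <> 0.            *)
Definition chart_eq (i : 'I_3) (P : 'rV[K]_3) (F : {mpoly K[3]}) :
    {mpoly K[2]} :=
  F \mPo [tuple (P 0 k)%:MP + oapp (fun j : 'I_2 => 'X_j) 0 (unlift i k)
         | k < 3].

(* Regular maps A^2 -> A^2. *)
Definition plane_map := (2.-tuple {mpoly K[2]})%type.

Definition idmap2 : plane_map := [tuple 'X_i | i < 2].

Definition comp_map (phi eta : plane_map) : plane_map :=
  [tuple tnth phi i \mPo eta | i < 2].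

Definition map_pair (p q : {mpoly K[2]}) : plane_map := [tuple p; q].

Local Notation x := ('X_ord0 : {mpoly K[2]}).
Local Notation y := ('X_ord_max : {mpoly K[2]}).

(* inf_near_chart phi: A^2 -> A^2 is obtained by successively blowing up the   *)
(* origin, taking one of the two affine charts (x, xy) and (xy, y) of the      *)
(* blow-up, and translating a point of the exceptional curve to the origin.    *)
(* Its origin is thus an arbitrary point infinitely near to the origin of the  *)
(* target; every point lying over it on a smooth surface with a birational     *)
(* projective morphism to the plane is obtained in this way.                   *)
Inductive inf_near_chart : plane_map -> Prop :=
| inf_near_id : inf_near_chart idmap2
| inf_near_finite phi (c : K) : inf_near_chart phi ->
    inf_near_chart (comp_map phi (map_pair x (x * (y + c%:MP))))
| inf_near_infinity phi : inf_near_chart phi ->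
    inf_near_chart (comp_map phi (map_pair (x * y) y)).

(* The composite of phi with the blow-up of the origin, in the chart where the *)
(* exceptional curve E is x = 0.                                               *)
Definition blowup_chart (phi : plane_map) : plane_map :=
  comp_map phi (map_pair x (x * y)).

(* Order of vanishing along the line x = 0 (0 for the zero polynomial). *)
Definition ordE (p : {mpoly K[2]}) : nat :=
  \big[minn/msize p]_(m <- msupp p) m ord0.

Definition jacobian_det (phi : plane_map) : {mpoly K[2]} :=
  \det (\matrix_(i < 2, j < 2) (tnth phi i)^`M(j)).

(* The discrepancy a(E, A^2, lam * {f = 0}) of the curve E = {x = 0} in a      *)
(* birational chart psi, that is, the coefficient of E in                      *)
(* K_Y - psi^*(K_{A^2} + lam * {f = 0}).                                       *)
Definition discrepancy (psi : plane_map) (f : {mpoly K[2]}) (lam : rat) : rat :=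
  (ordE (jacobian_det psi))%:R - lam * (ordE (f \mPo psi))%:R.

(* Log canonicity of (A^2, lam * {f = 0}) at the origin.  The first clause     *)
(* bounds the discrepancies of all exceptional curves over the origin; the     *)
(* second one says that curves through the origin have coefficient at most 1.  *)
Definition log_canonical_origin (f : {mpoly K[2]}) (lam : rat) : Prop :=
  (forall phi, inf_near_chart phi -> -1 <= discrepancy (blowup_chart phi) f lam)
  /\ (forall (g h : {mpoly K[2]}) (k : nat),
        g.@[fun=> 0] = 0 -> f = g ^+ k * h -> lam * k%:R <= 1).

(* (P^2, lam * {F = 0}) is log canonical at P. *)
Definition log_canonical_at (P : 'rV[K]_3) (F : {mpoly K[3]}) (lam : rat) :
    Prop :=
  forall i : 'I_3, P 0 i != 0 -> log_canonical_origin (chart_eq i P F) lam.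

(* h belongs to the ideal generated by f and g in the local ring of A^2 at 0. *)
Definition in_local_ideal (f g h : {mpoly K[2]}) : Prop :=
  exists u a b : {mpoly K[2]}, u.@[fun=> 0] != 0 /\ u * h = a * f + b * g.

(* dim_K O/(f, g) = n, for O the local ring of A^2 at 0: some b_1, ..., b_n    *)
(* form a K-basis, i.e. every fraction h / u in O is congruent to a unique     *)
(* combination of them.  The b_i can be taken polynomial, as K[x, y] maps onto *)
(* O/(f, g) when the latter is finite-dimensional.                             *)
Definition local_intersection (f g : {mpoly K[2]}) (n : nat) : Prop :=
  exists b : 'I_n -> {mpoly K[2]},
  forall h u : {mpoly K[2]}, u.@[fun=> 0] != 0 ->
  exists! c : 'rV[K]_n,
    in_local_ideal f g (h - u * \sum_(i < n) c 0 i *: b i).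

Definition intersection_multiplicity (P : 'rV[K]_3) (F G : {mpoly K[3]})
    (n : nat) : Prop :=
  forall i : 'I_3, P 0 i != 0 ->
  local_intersection (chart_eq i P F) (chart_eq i P G) n.

(* The smooth conics Q_0, ..., Q_(m-1), with m = d/2, are all the irreducible  *)
(* components of F, since F is their product up to a scalar.                   *)
Definition even_Ploski (d : nat) (F : {mpoly K[3]}) : Prop :=
  ~~ odd d /\ (2 <= d./2)%N /\
  exists (P : 'rV[K]_3) (Q : 'I_(d./2) -> {mpoly K[3]}) (c : K),
  [/\ P != 0,
      forall i, [/\ Q i \is 2.-homog, smooth_curve (Q i) & (Q i).@[P 0] = 0],
      c != 0 /\ F = c *: \prod_(i < d./2) Q i
    & forall i j, i != j -> intersection_multiplicity P (Q i) (Q j) 4].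

(* The form F(A X); GL_3 acts through PGL_3 on forms up to scalars. *)
Definition subst_mx (A : 'M[K]_3) (F : {mpoly K[3]}) : {mpoly K[3]} :=
  F \mPo [tuple \sum_(j < 3) A i j *: 'X_j | i < 3].

Definition form_monomial (d : nat) := {m : 'X_{1..3 < d.+1} | mdeg m == d}.

(* The coefficients of a form of degree d, i.e. its homogeneous coordinates in *)
(* the projective space |O(d)|. *)
Definition coefs (d : nat) (F : {mpoly K[3]}) : 'I_#|{: form_monomial d}| -> K :=
  fun k => F@_(val (enum_val k)).
Arguments coefs d F _ : clear implicits.

Definition form_poly (d : nat) := {mpoly K[#|{: form_monomial d}|]}.

(* I is an SL_3-invariant homogeneous polynomial of positive degree in the     *)
(* coefficients of forms of degree d, i.e. an invariant section of a positive  *)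
(* power of the hyperplane bundle of |O(d)|.                                   *)
Definition SL3_invariant (d : nat) (I : form_poly d) : Prop :=
  (exists2 n : nat, (0 < n)%N & I \is n.-homog) /\
  forall (A : 'M[K]_3) (F : {mpoly K[3]}), \det A = 1 -> F \is d.-homog ->
    I.@[coefs d (subst_mx A F)] = I.@[coefs d F].

Definition GIT_semistable (d : nat) (F : {mpoly K[3]}) : Prop :=
  exists I : form_poly d, SL3_invariant I /\ I.@[coefs d F] != 0.

Definition GIT_unstable (d : nat) (F : {mpoly K[3]}) : Prop :=
  ~ GIT_semistable d F.

(* H and G define points of |O(d)| in the same PGL_3-orbit. *)
Definition same_orbit (G H : {mpoly K[3]}) : Prop :=
  exists (A : 'M[K]_3) (c : K), [/\ A \in unitmx, c != 0 & H = c *: subst_mx A G].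

(* H lies in the Zariski closure, in |O(d)|, of the PGL_3-orbit of G. *)
Definition in_orbit_closure (d : nat) (G H : {mpoly K[3]}) : Prop :=
  forall (n : nat) (J : form_poly d), J \is n.-homog ->
    (forall H' : {mpoly K[3]}, same_orbit G H' -> J.@[coefs d H'] = 0) ->
  J.@[coefs d H] = 0.

(* The stabilizer of F in PGL_3 is finite. *)
Definition finite_stabilizer (F : {mpoly K[3]}) : Prop :=
  exists s : seq 'M[K]_3, forall (A : 'M[K]_3) (c : K),
    A \in unitmx -> subst_mx A F = c *: F ->
  exists (B : 'M[K]_3) (a : K), B \in s /\ A = a *: B.

(* Some invariant I does not vanish at F, the orbits of PGL_3 in the open set  *)
(* I <> 0 are closed there, and the stabilizer of F is finite (Mumford's       *)
(* properly stable points).                                                    *)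
Definition GIT_stable (d : nat) (F : {mpoly K[3]}) : Prop :=
  finite_stabilizer F /\
  exists I : form_poly d,
  [/\ SL3_invariant I, I.@[coefs d F] != 0
    & forall G H : {mpoly K[3]}, G \is d.-homog -> H \is d.-homog ->
        I.@[coefs d G] != 0 -> I.@[coefs d H] != 0 ->
      in_orbit_closure d G H -> same_orbit G H].

End PlaneCurves.

Arguments coefs {K} d F _.

Section LogCanonicalThreshold.
Context {R : realType}.
Local Open Scope classical_set_scope.

Definition lct_at (P : 'rV[R[i]]_3) (F : {mpoly R[i][3]}) : R :=
  sup [set ratr lam | lam in [set lam : rat | log_canonical_at P F lam]].

(* The infimum is a minimum, as lct_at P F takes finitely many values. *)
Definition lct (F : {mpoly R[i][3]}) : R :=
  inf [set lct_at P F | P in [set P : 'rV[R[i]]_3 | P != 0 /\ F.@[P 0] = 0]].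

End LogCanonicalThreshold.

(* Main.v *)
Require Import Defs.
From mathcomp Require Import all_boot all_order all_algebra.
From mathcomp Require Import perm separable complex.
From mathcomp Require Import mpoly.
From mathcomp Require Import boolp classical_sets reals.
From mathcomp Require Import ring lra zify.

(** Let [F] be a reduced form of degree [d] and [lam = 5 / (2 d)].

    Semistability enters through the numerical criterion of Hilbert and Mumford
    ([semistable_numerically]): in all coordinates and for all weights [s], [t], some
    monomial [x ^+ i * y ^+ j] of the affine equation satisfies
    [3 * (s * i + t * j) <= d * (s + t)].  This implies that the pair of the plane and
    [lam] times the curve is log canonical, even for a slightly larger [lam] if the
    curve is not even Ploski ([semistable_log_canonical]); hence the threshold of a
    semistable curve is at least [5 / (2 d)], and larger if it is not even Ploski.

    Discrepancies are followed along chains of infinitely near points, with the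
    orders of the Jacobian determinant along the exceptional curves ([good]).  If the
    Newton polygon satisfies the bound for toric valuations and the multiplicity of
    the strict transform is at most [1 / lam], the same holds at all points above
    ([newton_mult_good]), so few types of points need attention.  The criterion gives
    the bounds at the points of order at most two that are toric in linear
    coordinates.  Above a free point of order two ([conic_stage_good]) let [S4] and
    [S5] be the sums of the multiplicities of the first four and five points.  The
    criterion gives [S4 <= 2 d], and if equality holds, then the curve has contact of
    order [2 d] with all conics of a pencil [b * c = a ^+ 2 + u * b ^+ 2], so that its
    equation is a polynomial in the two generators of the pencil and is a product
    of conics ([maximal_contact_pencil]).  Bezout's theorem for the conic through the
    five points bounds [S5] ([fifth_point]).  What remains are chains of points of
    multiplicity [2 d / 5]; the discriminant bounds their length ([tower_bound]), so
    that a small excess of [lam] does no harm.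

    In suitable coordinates, even Ploski curves are the products of distinct conics
    of the pencil: the local ring of a conic at the point is described by its
    parametrization, so fourfold intersection means contact of order four
    ([even_Ploski_pencil], [pencil_even_Ploski]).  A one-parameter subgroup of [SL_3]
    degenerates such a product to a power of a conic, which is not reduced; the
    curve is thus not stable ([pencil_not_stable]).  It is semistable because the
    power of the conic is ([pencil_semistable]): the cubic invariant that applies
    the differential operator [F(x) F(y)] to [F(x cross y)] does not vanish there. *)

Import Order.TTheory GRing.Theory Num.Theory.
Local Open Scope ring_scope.
Set Implicit Arguments.
Unset Strict Implicit.
Unset Printing Implicit Defensive.

(** * Polynomial functions *)

Section PolynomialFunctions.
Context {K : numClosedFieldType}.

Lemma poly_vanish_nz (p : {poly K}) :
  (forall x, x != 0 -> p.[x] = 0) -> p = 0.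
Proof.
move=> p0; apply/eqP; apply: contraT => pn0.
pose s : seq K := [seq n.+1%:R | n <- iota 0 (size p)].
have us : uniq s by rewrite map_inj_uniq ?iota_uniq // => i j /eqP; rewrite eqr_nat eqSS => /eqP.
have rs : all (root p) s.
  by apply/allP => _ /mapP[n _ ->]; rewrite /root p0 ?pnatr_eq0.
by have := max_poly_roots pn0 rs us; rewrite size_map size_iota ltnn.
Qed.

Lemma poly_vanish (p : {poly K}) : (forall x, p.[x] = 0) -> p = 0.
Proof. by move=> p0; apply: poly_vanish_nz => x _; exact: p0. Qed.

Lemma muni_coef n (p : {mpoly K[n.+1]}) (m : 'X_{1..n.+1}) :
  p@_m = ((muni p)`_(m ord_max))@_[multinom m (widen_ord (leqnSn n) i) | i < n].
Proof.
rewrite muniE coef_sum raddf_sum /=.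
rewrite [LHS](_ : _ = (\sum_(k <- msupp p) p@_k *: 'X_[k])@_m); last first.
  by rewrite -mpolyE.
rewrite raddf_sum /=; apply: eq_bigr => k _.
rewrite !(mcoeffZ, coefZ, coefXn, mcoeffX).
case: (eqVneq (m ord_max)) => [e|ne]; last first.
  rewrite mulr0 mcoeff0; case: eqP => [ekm|]; last by rewrite mulr0.
  by rewrite ekm eqxx in ne.
rewrite mulr1 mcoeffZ mcoeffX; congr (_ * _%:R); congr nat_of_bool.
apply/eqP/eqP => [-> //|/mnmP ekm]; apply/mnmP => i.
case: (unliftP ord_max i) => [j ->|-> //].
have -> : lift ord_max j = widen_ord (leqnSn n) j.
  by apply/val_inj; rewrite /= /bump leqNgt ltn_ord.
by have := ekm j; rewrite !mnmE.
Qed.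

Lemma meval_muni n (p : {mpoly K[n.+1]}) (v : 'I_n.+1 -> K) :
  p.@[v] = (map_poly (meval (fun i => v (widen_ord (leqnSn n) i))) (muni p)).[v ord_max].
Proof.
rewrite muniE mevalE raddf_sum horner_sum; apply: eq_bigr => m _ /=.
rewrite -!mul_polyC !rmorphM /= !map_polyC /= map_polyXn !hornerE ?hornerXn.
rewrite mevalZ mevalX big_ord_recr /= -!mulrA; congr (_ * (_ * _)).
by apply: eq_bigr => i _; rewrite mnmE.
Qed.

Lemma mpoly_vanish n (p : {mpoly K[n]}) : (forall v, p.@[v] = 0) -> p = 0.
Proof.
elim: n p => [|n IHn] p p0.
  by have := p0 (fun=> 0); rewrite (nvar0_mpolyC p) mevalC => ->; rewrite mpolyC0.
suff p'0 k : (muni p)`_k = 0 by apply/mpolyP => m; rewrite muni_coef p'0 !mcoeff0.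
apply: IHn => v.
have: map_poly (meval v) (muni p) = 0.
  apply: poly_vanish => x.
  pose w := fun i : 'I_n.+1 => oapp v x (unlift ord_max i).
  have := p0 w; rewrite meval_muni /w unlift_none /= => <-.
  congr (_.[_]); apply: eq_map_poly => q; apply: meval_eq => i.
  have -> : widen_ord (leqnSn n) i = lift ord_max i.
    by apply/val_inj; rewrite /= /bump leqNgt ltn_ord.
  by rewrite liftK.
by move/polyP/(_ k); rewrite coef_map coef0.
Qed.

Lemma mpoly_ext n (p q : {mpoly K[n]}) : (forall v, p.@[v] = q.@[v]) -> p = q.
Proof.
by move=> e; apply/eqP; rewrite -subr_eq0; apply/eqP/mpoly_vanish => v;
  rewrite mevalB e subrr.
Qed.

End PolynomialFunctions.

(** * Bivariate coefficients *)

Section Bivariate.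
Context {K : numClosedFieldType}.
Implicit Types (f g : {mpoly K[2]}) (c : K).

Local Notation x := ('X_ord0 : {mpoly K[2]}).
Local Notation y := ('X_ord_max : {mpoly K[2]}).

Definition mn2 (i j : nat) : 'X_{1..2} :=
  (U_(ord0) *+ i + U_(ord_max) *+ j)%MM.

Lemma ord2P (i : 'I_2) : i = ord0 \/ i = ord_max.
Proof. by case: i => [[|[|]]] // H; [left|right]; exact: val_inj. Qed.

Lemma mn2_0 i j : mn2 i j ord0 = i.
Proof. by rewrite mnmDE !mulmnE !mnm1E /= mul1n mul0n addn0. Qed.

Lemma mn2_1 i j : mn2 i j ord_max = j.
Proof. by rewrite mnmDE !mulmnE !mnm1E /= mul1n mul0n. Qed.

Lemma mn2E (m : 'X_{1..2}) : m = mn2 (m ord0) (m ord_max).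
Proof. by apply/mnmP => i; case: (ord2P i) => ->; rewrite (mn2_0, mn2_1). Qed.

Lemma mn2_eq i j i' j' : (mn2 i j == mn2 i' j') = (i == i') && (j == j').
Proof.
apply/eqP/andP => [e|[/eqP-> /eqP-> //]].
by have:= mn2_0 i j; have:= mn2_1 i j; rewrite e mn2_0 mn2_1 => -> ->; rewrite !eqxx.
Qed.

Lemma mdeg_mn2 i j : mdeg (mn2 i j) = (i + j)%N.
Proof. by rewrite mdegD !mdegMn !mdeg1 !mul1n. Qed.

Lemma mpolyX_mn2 i j : 'X_[mn2 i j] = x ^+ i * y ^+ j.
Proof. by rewrite mpolyXD !mpolyXn. Qed.

Definition cf f i j := f@_(mn2 i j).

Lemma cfD f g i j : cf (f + g) i j = cf f i j + cf g i j.
Proof. exact: mcoeffD. Qed.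

Lemma cfZ c f i j : cf (c *: f) i j = c * cf f i j.
Proof. exact: mcoeffZ. Qed.

Lemma cf_sum I (r : seq I) (P : pred I) (F : I -> {mpoly K[2]}) i j :
  cf (\sum_(k <- r | P k) F k) i j = \sum_(k <- r | P k) cf (F k) i j.
Proof. exact: raddf_sum. Qed.

Lemma cf_ext f g : (forall i j, cf f i j = cf g i j) -> f = g.
Proof. by move=> e; apply/mpolyP => m; rewrite (mn2E m); exact: e. Qed.

Lemma cfX i j i' j' : cf (x ^+ i * y ^+ j) i' j' = ((i == i') && (j == j'))%:R.
Proof. by rewrite /cf -mpolyX_mn2 mcoeffX mn2_eq. Qed.

Lemma cf_supp_ex f : f != 0 -> exists i j, cf f i j != 0.
Proof.
move=> fn0; exists (mlead f ord0), (mlead f ord_max).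
by rewrite /cf -mn2E mleadc_eq0.
Qed.

Lemma cf_bound f i j : cf f i j != 0 -> (i + j < msize f)%N.
Proof. by move=> h; rewrite -mdeg_mn2 msize_mdeg_lt // mcoeff_msupp. Qed.

Definition xcoef f n : {poly K} := \poly_(j < msize f) cf f n j.

Lemma coef_xcoef f n j : (xcoef f n)`_j = cf f n j.
Proof.
rewrite coef_poly; case: ltnP => // h; apply/esym/eqP.
by apply: contraTT h => /cf_bound; rewrite -ltnNge; apply: leq_ltn_trans; rewrite leq_addl.
Qed.

Lemma size_xcoef f n N : (forall j, cf f n j != 0 -> (j < N)%N) -> (size (xcoef f n) <= N)%N.
Proof.
move=> h; apply/leq_sizeP => j Nj; rewrite coef_xcoef; apply/eqP.
by apply: contraTT Nj => /h; rewrite -ltnNge.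
Qed.

Definition ypoly (q : {poly K}) : {mpoly K[2]} := (map_poly (@mpolyC 2 K) q).[y].

Lemma cf_xn_ypoly n q i j : cf (x ^+ n * ypoly q) i j = if n == i then q`_j else 0.
Proof.
rewrite /ypoly horner_coef size_map_poly mulr_sumr cf_sum.
under eq_bigr => k _ do
  rewrite coef_map /= mulrCA mul_mpolyC cfZ cfX.
case: (eqVneq n i) => [_|_]; last by rewrite big1 // => k _; rewrite mulr0.
case: (ltnP j (size q)) => [lj|gj].
  rewrite (bigD1 (Ordinal lj)) //= eqxx mulr1 big1 ?addr0 // => k kj.
  by case: eqP => [ek|]; rewrite ?mulr0 //; rewrite -val_eqE /= ek eqxx in kj.
rewrite big1 ?nth_default // => k _; case: eqP => [ek|]; rewrite ?mulr0 //.
by have := ltn_ord k; rewrite ek ltnNge gj.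
Qed.

Lemma xcoef_expand f N : (msize f <= N)%N -> f = \sum_(n < N) x ^+ n * ypoly (xcoef f n).
Proof.
move=> hN; apply: cf_ext => i j; rewrite cf_sum.
under eq_bigr => k _ do rewrite cf_xn_ypoly coef_xcoef.
case: (ltnP i N) => [li|gi].
  rewrite (bigD1 (Ordinal li)) //= eqxx big1 ?addr0 // => k ki.
  by case: eqP => // ek; rewrite -val_eqE /= ek eqxx in ki.
rewrite big1 => [|k _]; last first.
  by case: eqP => // ek; have := ltn_ord k; rewrite ek ltnNge gi.
apply/eqP; apply: contraTT gi => /cf_bound h; rewrite -ltnNge.
by apply: leq_trans hN; apply: leq_ltn_trans h; rewrite leq_addr.
Qed.

Lemma xcoef_sum (N : nat) (q : nat -> {poly K}) n :
  xcoef (\sum_(k < N) x ^+ k * ypoly (q k)) n = if (n < N)%N then q n else 0.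
Proof.
apply/polyP => j; rewrite coef_xcoef cf_sum.
under eq_bigr => k _ do rewrite cf_xn_ypoly.
case: ltnP => [li|gi].
  rewrite (bigD1 (Ordinal li)) //= eqxx big1 ?addr0 // => k ki.
  by case: eqP => // ek; rewrite -val_eqE /= ek eqxx in ki.
rewrite coef0 big1 // => k _.
by case: eqP => // ek; have := ltn_ord k; rewrite ek ltnNge gi.
Qed.

End Bivariate.

(** * Coefficients in the charts of a blow-up *)

Section Charts.
Context {K : numClosedFieldType}.
Implicit Types (f g : {mpoly K[2]}) (c : K).

Local Notation x := ('X_ord0 : {mpoly K[2]}).
Local Notation y := ('X_ord_max : {mpoly K[2]}).

Definition ev2 f (a b : K) := f.@[fun i => if i == ord0 then a else b].

Lemma ev2_ext f g : (forall a b, ev2 f a b = ev2 g a b) -> f = g.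
Proof.
move=> e; apply: mpoly_ext => v; have := e (v ord0) (v ord_max).
rewrite /ev2; congr (_ = _); apply: meval_eq => i; by case: (ord2P i) => ->.
Qed.

Lemma ev2D f g a b : ev2 (f + g) a b = ev2 f a b + ev2 g a b.
Proof. exact: mevalD. Qed.
Lemma ev2M f g a b : ev2 (f * g) a b = ev2 f a b * ev2 g a b.
Proof. exact: mevalM. Qed.
Lemma ev2Xn f n a b : ev2 (f ^+ n) a b = ev2 f a b ^+ n.
Proof. exact: rmorphXn. Qed.
Lemma ev2C c a b : ev2 c%:MP a b = c.
Proof. exact: mevalC. Qed.
Lemma ev2x a b : ev2 x a b = a.
Proof. by rewrite /ev2 mevalXU eqxx. Qed.
Lemma ev2y a b : ev2 y a b = b.
Proof. by rewrite /ev2 mevalXU. Qed.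

Lemma ev2_comp f p q a b :
  ev2 (f \mPo map_pair p q) a b = ev2 f (ev2 p a b) (ev2 q a b).
Proof.
by rewrite /ev2 comp_mpoly_meval; apply: meval_eq => i;
  case: (ord2P i) => ->; rewrite (tnth_nth 0).
Qed.

Lemma ev2_ypoly q a b : ev2 (ypoly q) a b = q.[b].
Proof.
rewrite /ypoly horner_coef size_map_poly horner_coef /ev2 raddf_sum /=.
apply: eq_bigr => i _; rewrite coef_map /= mevalM mevalC rmorphXn /=.
by rewrite mevalXU.
Qed.

Definition ev2E := (ev2_comp, ev2_ypoly, ev2D, ev2M, ev2Xn, ev2C, ev2x, ev2y).

Lemma cf_monomial_map f (p q : {mpoly K[2]}) (u v : nat -> nat -> nat) k l i0 j0 :
  (forall i j, p ^+ i * q ^+ j = x ^+ (u i j) * y ^+ (v i j)) ->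
  (forall i j, (u i j == k) && (v i j == l) = (i == i0) && (j == j0)) ->
  cf (f \mPo map_pair p q) k l = cf f i0 j0.
Proof.
move=> h hP; rewrite comp_mpolyEX cf_sum.
have o1 : lift ord0 ord0 = ord_max :> 'I_2 by exact: val_inj.
under eq_bigr => m _ do
  rewrite cfZ comp_mpolyX !big_ord_recl big_ord0 mulr1 !(tnth_nth 0) /= o1.
under eq_bigr => m _ do rewrite h cfX hP.
rewrite {1}/cf.
case: (boolP (mn2 i0 j0 \in msupp f)) => [hm|/memN_msupp_eq0 hm].
  rewrite (bigD1_seq _ hm) ?msupp_uniq //= mn2_0 mn2_1 !eqxx mulr1.
  rewrite big1 ?addr0 // => m mn.
  case: andP => [[/eqP e0 /eqP e1]|]; last by rewrite mulr0.
  by rewrite (mn2E m) e0 e1 eqxx in mn.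
rewrite hm big1 // => m _.
case: andP => [[/eqP e0 /eqP e1]|]; last by rewrite mulr0.
by rewrite (mn2E m) e0 e1 hm mul0r.
Qed.

Lemma cf_monomial_map0 f (p q : {mpoly K[2]}) (u v : nat -> nat -> nat) k l :
  (forall i j, p ^+ i * q ^+ j = x ^+ (u i j) * y ^+ (v i j)) ->
  (forall i j, (u i j == k) && (v i j == l) = false) ->
  cf (f \mPo map_pair p q) k l = 0.
Proof.
move=> h hP; rewrite comp_mpolyEX cf_sum big1 // => m _.
rewrite cfZ comp_mpolyX !big_ord_recl big_ord0 mulr1 !(tnth_nth 0) /=.
rewrite (_ : lift ord0 ord0 = ord_max :> 'I_2); last exact: val_inj.
by rewrite h cfX hP mulr0.
Qed.

Definition blow0 f := f \mPo map_pair x (x * y).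
Definition blow_oo f := f \mPo map_pair (x * y) y.
Definition shift c f := f \mPo map_pair x (y + c%:MP).

Lemma cf_blow0 f n j : cf (blow0 f) n j = if (j <= n)%N then cf f (n - j) j else 0.
Proof.
have h i k : x ^+ i * (x * y) ^+ k = x ^+ (i + k) * y ^+ k.
  by rewrite exprMn mulrA -exprD.
case: leqP => jn.
  by apply: (cf_monomial_map f h) => a b; apply/idP/idP; lia.
by apply: (cf_monomial_map0 f h) => a b; apply/negbTE; lia.
Qed.

Lemma cf_blow_oo f i n : cf (blow_oo f) i n = if (i <= n)%N then cf f i (n - i) else 0.
Proof.
have h k j : (x * y) ^+ k * y ^+ j = x ^+ k * y ^+ (k + j).
  by rewrite exprMn -mulrA -exprD.
case: leqP => jn.
  by apply: (cf_monomial_map f h) => a b; apply/idP/idP; lia.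
by apply: (cf_monomial_map0 f h) => a b; apply/negbTE; lia.
Qed.

Lemma cf_blow0_nz f i j : cf f i j != 0 -> cf (blow0 f) (i + j) j != 0.
Proof. by rewrite cf_blow0 leq_addl addnK. Qed.

Lemma cf_blow_oo_nz f i j : cf f i j != 0 -> cf (blow_oo f) i (i + j) != 0.
Proof. by rewrite cf_blow_oo leq_addr addKn. Qed.

Lemma cf_blow0_inv f n j : cf (blow0 f) n j != 0 ->
  exists2 i, n = (i + j)%N & cf f i j != 0.
Proof.
by rewrite cf_blow0; case: leqP => [h|]; rewrite ?eqxx // => h'; exists (n - j)%N => //; rewrite subnK.
Qed.

Lemma cf_blow_oo_inv f i n : cf (blow_oo f) i n != 0 ->
  exists2 j, n = (i + j)%N & cf f i j != 0.
Proof.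
by rewrite cf_blow_oo; case: leqP => [h|]; rewrite ?eqxx // => h'; exists (n - i)%N => //; rewrite subnKC.
Qed.

Lemma xcoef_shift c f n : xcoef (shift c f) n = xcoef f n \Po ('X + c%:P).
Proof.
pose N := (msize f + n.+1)%N.
have hN : (msize f <= N)%N by rewrite leq_addr.
rewrite {1}(xcoef_expand hN) /shift raddf_sum /=.
rewrite (eq_bigr (fun k : 'I_N => x ^+ k * ypoly (xcoef f k \Po ('X + c%:P)))).
  by rewrite (@xcoef_sum _ N (fun k => xcoef f k \Po ('X + c%:P))) ltn_addl.
by move=> k _; apply: ev2_ext => a b; rewrite !ev2E horner_comp !hornerE.
Qed.

Definition chart (o : option K) : plane_map :=
  if o is Some c then map_pair x (x * (y + c%:MP)) else map_pair (x * y) y.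

Definition pull o f := f \mPo chart o.

Lemma pull_Some c f : pull (Some c) f = shift c (blow0 f).
Proof. by apply: ev2_ext => a b; rewrite !ev2E. Qed.

Lemma xcoef_pull c f n :
  xcoef (pull (Some c) f) n = xcoef (blow0 f) n \Po ('X + c%:P).
Proof. by rewrite pull_Some xcoef_shift. Qed.

Lemma pull0 f : pull (Some 0) f = blow0 f.
Proof. by apply: ev2_ext => a b; rewrite !ev2E addr0. Qed.

(** After removal of the factor ['X^b], the degree bounds the multiplicity of a
    root. *)
Lemma root_multiplicity (L : {poly K}) (b N : nat) c :
  L != 0 -> (forall j, (j < b)%N -> L`_j = 0) -> (size L <= N.+1)%N ->
  c != 0 \/ b = 0%N ->
  exists2 k, (k + b <= N)%N &
    (L \Po ('X + c%:P))`_k != 0 /\ (forall k', (k' < k)%N -> (L \Po ('X + c%:P))`_k' = 0).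
Proof.
move=> Ln0 hb hN hc.
pose L' := Poly (drop b L).
have LE : L = L' * 'X^b.
  apply/polyP => j; rewrite coefMXn; case: ltnP => [/hb //|hj].
  by rewrite coef_Poly nth_drop subnKC.
have L'n0 : L' != 0 by apply: contraNneq Ln0 => L0; rewrite LE L0 mul0r.
have [k [q rq L'E]] := multiplicity_XsubC L' c; rewrite L'n0 /= in rq.
have qn0 : q != 0 by apply: contraNneq rq => ->; rewrite root0.
have sL : size L = (size q + k + b)%N.
  rewrite LE size_Mmonic ?monicXn // size_polyXn L'E size_Mmonic //.
    by rewrite size_exp_XsubC addnS /= addnS.
  by rewrite monic_exp ?monicXsubC.
have compE : L \Po ('X + c%:P) = ((q * 'X^b) \Po ('X + c%:P)) * 'X^k.
  rewrite LE L'E -mulrA (mulrC (_ ^+ k)) mulrA rmorphM /= rmorphXn /=.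
  by rewrite rmorphB /= comp_polyX comp_polyC addrK.
exists k.
  have : (0 < size q)%N by rewrite size_poly_gt0.
  by move: hN; rewrite sL; lia.
split=> [|k' lk]; last by rewrite compE coefMXn lk.
rewrite compE coefMXn ltnn subnn -horner_coef0 horner_comp !hornerE ?hornerXn.
rewrite mulf_neq0 //.
by case: hc => [cn0|->]; rewrite ?expr0 ?oner_eq0 // expf_neq0.
Qed.

Lemma supp_min f (wt : nat -> nat -> nat) : f != 0 ->
  exists i j, cf f i j != 0 /\ forall i' j', cf f i' j' != 0 -> (wt i j <= wt i' j')%N.
Proof.
move=> fn0.
pose P n := has (fun m : 'X_{1..2} => wt (m ord0) (m ord_max) == n) (msupp f).
have exP : exists n, P n.
  have [i [j h]] := cf_supp_ex fn0; exists (wt i j); apply/hasP.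
  by exists (mn2 i j); rewrite ?mcoeff_msupp // mn2_0 mn2_1.
have := ex_minnP exP; case=> n /hasP[m hm /eqP e] hmin.
exists (m ord0), (m ord_max); split; first by rewrite /cf -mn2E -mcoeff_msupp.
move=> i' j' h; rewrite e; apply: hmin; apply/hasP.
by exists (mn2 i' j'); rewrite ?mcoeff_msupp // mn2_0 mn2_1.
Qed.

End Charts.

(** * Log canonicity along towers of blow-ups *)

Section Towers.
Context {K : numClosedFieldType}.
Variable lam : rat.
Hypothesis lam_ge0 : 0 <= lam.
Implicit Types (f g : {mpoly K[2]}) (c : K).

(** Orders of the Jacobian determinant along the two axes after one more
    blow-up.  The former axis [y = 0] passes through the next point only in the
    case [c = 0]. *)
Definition nextx (o : option K) (p q : nat) : nat := if o is Some _ then (p + q).+1 else p.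
Definition nexty (o : option K) (p q : nat) : nat :=
  match o with Some c => if c == 0 then q else 0%N | None => (p + q).+1 end.

(** Discrepancy at least [-1] for the blow-up of the origin, if the Jacobian
    determinant is [x ^+ p * y ^+ q] up to a unit. *)
Definition disc_ok f (p q : nat) : Prop :=
  exists i j, cf f i j != 0 /\ lam * (i + j)%:R <= (p + q + 2)%:R.

Fixpoint good (n : nat) f (p q : nat) : Prop :=
  disc_ok f p q /\
  if n is n'.+1 then forall o, good n' (pull o f) (nextx o p q) (nexty o p q) else True.

(** The point [((p + 1) / lam, (q + 1) / lam)] lies in the Newton polyhedron of
    [f]: the toric valuations over the origin have discrepancy at least [-1]. *)
Definition newton_ok f (p q : nat) : Prop :=
  forall s t : nat, exists i j, cf f i j != 0 /\
    lam * (s * i + t * j)%:R <= (s * p.+1 + t * q.+1)%:R.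

(** The monomial part of [f] is left to [newton_ok]; the rest is harmless if its
    multiplicity is at most [1 / lam]. *)
Definition mult_ok f : Prop :=
  exists a b, (forall i j, cf f i j != 0 -> (a <= i)%N /\ (b <= j)%N) /\
  exists i j, cf f i j != 0 /\ lam * (i + j)%:R <= 1 + lam * (a + b)%:R.

Lemma lam_mono (m n : nat) : (m <= n)%N -> lam * m%:R <= lam * n%:R.
Proof. by move=> h; rewrite ler_wpM2l // ler_nat. Qed.

Lemma newton_disc f p q : newton_ok f p q -> disc_ok f p q.
Proof.
move=> /(_ 1%N 1%N) [i [j [h1 h2]]]; exists i, j; split => //.
by move: h2; rewrite !mul1n addSn addnS addn2.
Qed.

Lemma newton_neq0 f p q : newton_ok f p q -> f != 0.
Proof.
by move=> /(_ 0%N 0%N) [i [j [h _]]]; apply: contraNneq h => ->; rewrite /cf mcoeff0.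
Qed.

Lemma newton_blow0 f p q : newton_ok f p q -> newton_ok (blow0 f) (p + q).+1 q.
Proof.
move=> hf s t; have [i [j [h1 h2]]] := hf s (s + t)%N.
exists (i + j)%N, j; split; first exact: cf_blow0_nz.
rewrite (_ : (_ + _)%N = (s * i + (s + t) * j)%N); last lia.
by apply: le_trans h2 _; rewrite ler_nat; lia.
Qed.

Lemma newton_blow_oo f p q : newton_ok f p q -> newton_ok (blow_oo f) p (p + q).+1.
Proof.
move=> hf s t; have [i [j [h1 h2]]] := hf (s + t)%N t.
exists i, (i + j)%N; split; first exact: cf_blow_oo_nz.
rewrite (_ : (_ + _)%N = ((s + t) * i + t * j)%N); last lia.
by apply: le_trans h2 _; rewrite ler_nat; lia.
Qed.

Lemma mult_blow0 f : f != 0 -> mult_ok f -> mult_ok (blow0 f).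
Proof.
move=> fn0 [a [b [hab [i1 [j1 [h1 h2]]]]]].
have [i0 [j0 [h0 hmin]]] := supp_min (fun i j => i + j)%N fn0.
exists (i0 + j0)%N, b; split.
  move=> n j /cf_blow0_inv[i -> h]; split; first exact: hmin.
  by case: (hab _ _ h).
exists (i0 + j0)%N, j0; split; first exact: cf_blow0_nz.
have [ha _] := hab _ _ h0.
have := lam_mono (leq_trans (_ : (a + j0 <= i0 + j0)%N) (hmin _ _ h1)).
rewrite leq_add2r ha => /(_ isT); move: h2; rewrite !natrD !mulrDr.
lra.
Qed.

Lemma mult_blow_oo f : f != 0 -> mult_ok f -> mult_ok (blow_oo f).
Proof.
move=> fn0 [a [b [hab [i1 [j1 [h1 h2]]]]]].
have [i0 [j0 [h0 hmin]]] := supp_min (fun i j => i + j)%N fn0.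
exists a, (i0 + j0)%N; split.
  move=> i n /cf_blow_oo_inv[j -> h]; split; last exact: hmin.
  by case: (hab _ _ h).
exists i0, (i0 + j0)%N; split; first exact: cf_blow_oo_nz.
have [_ hb] := hab _ _ h0.
have := lam_mono (leq_trans (_ : (i0 + b <= i0 + j0)%N) (hmin _ _ h1)).
rewrite leq_add2l hb => /(_ isT); move: h2; rewrite !natrD !mulrDr.
lra.
Qed.

Lemma xcoef_neq0 f i j : cf f i j != 0 -> xcoef f i != 0.
Proof. by apply: contraNneq => e; rewrite -coef_xcoef e coef0. Qed.

Lemma xcoef_neq0_ex f i : xcoef f i != 0 -> exists j, cf f i j != 0.
Proof. by rewrite -lead_coef_eq0 lead_coefE coef_xcoef; exists (size (xcoef f i)).-1. Qed.

(** A translation of [y] preserves the exponent of [x]. *)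
Lemma cf_pull_supp c f n j : cf (pull (Some c) f) n j != 0 ->
  exists2 i, (i <= n)%N & exists2 l, (n = i + l)%N & cf f i l != 0.
Proof.
move=> /xcoef_neq0; rewrite xcoef_pull => h.
have: xcoef (blow0 f) n != 0 by apply: contraNneq h => ->; rewrite comp_poly0.
move=> /xcoef_neq0_ex[l] /cf_blow0_inv[i -> hi].
by exists i; rewrite ?leq_addr //; exists l.
Qed.

(** Orders at a free point of the exceptional curve: the leading coefficient
    cannot vanish there to an order exceeding its number of terms. *)
Lemma pull_free f c w i0 j0 b N :
  cf f i0 j0 != 0 -> (i0 + j0 = w)%N ->
  (forall i j, cf f i j != 0 -> (i + j = w)%N -> (b <= j <= N)%N) ->
  c != 0 \/ b = 0%N ->
  exists2 k, (k + b <= N)%N & cf (pull (Some c) f) w k != 0 /\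
    (forall k', (k' < k)%N -> cf (pull (Some c) f) w k' = 0).
Proof.
move=> h0 e0 hb hc.
have Ln0 : xcoef (blow0 f) w != 0.
  by rewrite -e0; apply: (@xcoef_neq0 _ _ j0); apply: cf_blow0_nz.
have hL j : cf (blow0 f) w j != 0 -> (b <= j <= N)%N.
  by move=> /cf_blow0_inv[i ew h]; apply: hb h _; rewrite ew.
have L1 j : (j < b)%N -> (xcoef (blow0 f) w)`_j = 0.
  move=> jb; rewrite coef_xcoef; apply/eqP; apply: contraTT jb => /hL.
  by rewrite -leqNgt => /andP[].
have L2 : (size (xcoef (blow0 f) w) <= N.+1)%N.
  by apply: size_xcoef => j /hL /andP[].
have [k hk [k1 k2]] := root_multiplicity Ln0 L1 L2 hc.
exists k => //; split=> [|k' lk]; first by rewrite -coef_xcoef xcoef_pull.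
by rewrite -coef_xcoef xcoef_pull; exact: k2.
Qed.

(** If the toric valuations are harmless and the multiplicity is small, then
    all valuations are harmless.  Both hypotheses are inherited by the points
    of the blow-up: at the two torus-fixed points this is a computation with
    Newton polyhedra; a free point [c <> 0] of the exceptional curve meets the
    strict transform with multiplicity at most that of the origin, so the
    curve may be replaced there by the corner of a rectangle. *)
Lemma newton_mult_good n f p q : newton_ok f p q -> mult_ok f -> good n f p q.
Proof.
elim: n f p q => [|n IHn] f p q hN hM; first by split=> //; apply: newton_disc.
have fn0 := newton_neq0 hN.
split=> [|o]; first exact: newton_disc.
case: o => [c|] /=; last first.
  by apply: IHn; [apply: newton_blow_oo|apply: mult_blow_oo].
have [->|cn0] := eqVneq c 0.
  by rewrite pull0; apply: IHn; [apply: newton_blow0|apply: mult_blow0].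
have [a [b [hab [i1 [j1 [h1 h2]]]]]] := hM.
have [i0 [j0 [h0 hmin]]] := supp_min (fun i j => i + j)%N fn0.
set w := (i0 + j0)%N.
have [k hk [hwk _]] : exists2 k, (k + b <= w - a)%N & cf (pull (Some c) f) w k != 0 /\
    (forall k', (k' < k)%N -> cf (pull (Some c) f) w k' = 0).
  apply: (@pull_free f c w i0 j0) => //; last by left.
  by move=> i j h e; have [ha hb] := hab _ _ h; lia.
have [ha hb] := hab _ _ h0.
have lk : lam * k%:R <= 1.
  have : (k + (a + b) <= i1 + j1)%N by have := hmin _ _ h1; rewrite -/w; lia.
  by move/lam_mono; move: h2; rewrite (natrD _ k) !mulrDr; lra.
have lw : lam * w%:R <= (p + q).+2%:R.
  have [i [j [h e]]] := newton_disc hN.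
  apply: le_trans (lam_mono (hmin _ _ h)) _; apply: le_trans e _.
  by rewrite ler_nat addn2.
apply: IHn.
  move=> s t; exists w, k; split => //.
  rewrite natrD !natrM mulrDr !(mulrCA lam) natrD !natrM mulr1.
  by apply: lerD; [rewrite ler_wpM2l|rewrite ler_piMr].
exists w, 0%N; split.
  by move=> i j /cf_pull_supp[i' _ [l -> h]]; split => //; exact: hmin.
by exists w, k; split=> //; rewrite natrD mulrDr addn0 addrC lerD2r.
Qed.

Lemma newton_box f p q i j :
  cf f i j != 0 -> lam * i%:R <= p.+1%:R -> lam * j%:R <= q.+1%:R -> newton_ok f p q.
Proof.
move=> h hi hj s t; exists i, j; split=> //.
rewrite natrD !natrM mulrDr !(mulrCA lam) natrD !natrM.
by apply: lerD; rewrite ler_wpM2l.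
Qed.

(** Two monomials on either side of the diagonal replace a corner that misses
    the rectangle by [e], provided that [e] is small. *)
Lemma newton_two f p q i j i' j' (e d1 d2 N : rat) :
  cf f i j != 0 -> cf f i' j' != 0 ->
  0 < d1 -> e * N <= d1 * d2 -> 0 <= N ->
  lam * i%:R <= p.+1%:R - d1 -> lam * j%:R <= q.+1%:R + e ->
  lam * i'%:R <= p.+1%:R + N -> lam * j'%:R <= q.+1%:R - d2 ->
  newton_ok f p q.
Proof.
move=> h h' d1p hN N0 hi hj hi' hj' s t.
have sE : 0 <= (s%:R : rat) by [].
have tE : 0 <= (t%:R : rat) by [].
case: (lerP (e * t%:R) (d1 * s%:R)) => hst.
  exists i, j; split=> //.
  rewrite natrD !natrM mulrDr !(mulrCA lam) natrD !natrM.
  have A1 := ler_wpM2l sE hi; have A2 := ler_wpM2l tE hj; nra.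
exists i', j'; split=> //.
rewrite natrD !natrM mulrDr !(mulrCA lam) natrD !natrM.
have A1 := ler_wpM2l sE hi'; have A2 := ler_wpM2l tE hj'.
have A3 : s%:R * N <= t%:R * d2.
  rewrite -(ler_pM2l d1p); have B1 := ler_wpM2l N0 (ltW hst).
  by have B2 := ler_wpM2l tE hN; nra.
nra.
Qed.

(** At the intersection of the exceptional curve with [x = 0] the multiplicity
    at most halves. *)
Lemma satellite_good n h a k p q :
  (forall i j, cf h i j != 0 -> (a <= i)%N) -> cf h a k != 0 -> lam * k%:R <= 2 ->
  newton_ok (blow_oo h) p q -> good n (blow_oo h) p q.
Proof.
move=> ha hk lk hN; apply: newton_mult_good => //.
have hn0 : h != 0 by apply: contraNneq hk => ->; rewrite /cf mcoeff0.
have [i0 [j0 [h0 hmin]]] := supp_min (fun i j => i + j)%N hn0.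
exists a, (i0 + j0)%N; split.
  by move=> i m /cf_blow_oo_inv[j -> hij]; split; [exact: ha hij|exact: hmin].
have hai := ha _ _ h0; have hm := hmin _ _ hk.
have hsum : ((i0 - a) + (a + k - (i0 + j0)) <= k)%N by lia.
have := lam_mono hsum; rewrite natrD mulrDr => hs.
case: (lerP (lam * (i0 - a)%:R) 1) => h1.
  exists i0, (i0 + j0)%N; split; first exact: cf_blow_oo_nz.
  rewrite (_ : (i0 + (i0 + j0))%N = (i0 - a) + (a + (i0 + j0)))%N; last lia.
  by rewrite natrD mulrDr; lra.
exists a, (a + k)%N; split; first exact: cf_blow_oo_nz.
rewrite (_ : (a + (a + k))%N = (a + k - (i0 + j0)) + (a + (i0 + j0)))%N; last lia.
by rewrite natrD mulrDr; lra.
Qed.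

(** At a free point the multiplicity of the strict transform is at most its
    intersection number [k] with the exceptional curve. *)
Lemma free_good n h a k p :
  (forall i j, cf h i j != 0 -> (a <= i)%N) -> cf h a k != 0 ->
  lam * a%:R <= p.+1%:R -> lam * k%:R <= 1 -> good n h p 0.
Proof.
move=> ha hk la lk; apply: newton_mult_good.
  by apply: (newton_box hk la); rewrite (_ : 1%N%:R = 1).
exists a, 0%N; split; first by move=> i j /ha.
by exists a, k; split=> //; rewrite natrD mulrDr addn0 addrC lerD2r.
Qed.

End Towers.

(** * Ternary forms *)

Section Forms.
Context {K : numClosedFieldType}.
Implicit Types (F G : {mpoly K[3]}) (A B : 'M[K]_3).

Local Notation x := ('X_ord0 : {mpoly K[2]}).
Local Notation y := ('X_ord_max : {mpoly K[2]}).

Lemma homog_scale n d (F : {mpoly K[n]}) t v :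
  F \is d.-homog -> F.@[fun i => t * v i] = t ^+ d * F.@[v].
Proof.
move=> hF; rewrite !mevalE mulr_sumr; apply: eq_big_seq => m hm.
rewrite -(dhomog_mf hF hm) /= mdegE -prodrXr mulrCA; congr (_ * _).
by rewrite -big_split; apply: eq_bigr => i _; rewrite exprMn.
Qed.

Lemma comp_scale_coef n (F : {mpoly K[n]}) t m :
  (F \mPo [tuple t *: 'X_i | i < n])@_m = t ^+ mdeg m * F@_m.
Proof.
rewrite comp_mpolyEX.
rewrite (eq_bigr (fun k : 'X_{1..n} => (t ^+ mdeg k * F@_k) *: 'X_[k])); last first.
  move=> k _; rewrite comp_mpolyX.
  under eq_bigr => i _ do rewrite tnth_mktuple exprZn.
  by rewrite scaler_prod prodrXr -mdegE -mpolyXE_id scalerA mulrC.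
rewrite raddf_sum /=.
under eq_bigr => k _ do rewrite mcoeffZ mcoeffX.
case: (boolP (m \in msupp F)) => [h|/memN_msupp_eq0 h].
  rewrite (bigD1_seq _ h) ?msupp_uniq //= eqxx mulr1 big1 ?addr0 // => k kn.
  by rewrite (negbTE kn) mulr0.
by rewrite h mulr0 big1_seq // => k /andP[_ hk]; case: eqP => [e|]; rewrite ?mulr0 // e h !mulr0 mul0r.
Qed.

(** Scaling by [2] suffices, as the powers of [2] are distinct in characteristic
    zero. *)
Lemma scale_homog n d (F : {mpoly K[n]}) :
  (forall v, F.@[fun i => 2%:R * v i] = 2%:R ^+ d * F.@[v]) -> F \is d.-homog.
Proof.
move=> h; apply/dhomogP => m hm /=.
have e : F \mPo [tuple 2%:R *: 'X_i | i < n] = 2%:R ^+ d *: F.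
  apply: mpoly_ext => v; rewrite comp_mpoly_meval mevalZ -h; apply: meval_eq => i.
  by rewrite tnth_mktuple mevalZ mevalXU.
have := comp_scale_coef F 2%:R m; rewrite e mcoeffZ => /(mulIf _).
rewrite -mcoeff_msupp => /(_ hm) /eqP; rewrite -!natrX eqr_nat => /eqP e2.
by apply/esym/(@expnI 2).
Qed.

Definition mn3 (i j k : nat) : 'X_{1..3} :=
  (U_(inord 0) *+ i + U_(inord 1) *+ j + U_(inord 2) *+ k)%MM.

Lemma ord3P (i : 'I_3) : [\/ i = inord 0, i = inord 1 | i = inord 2].
Proof.
by case: i => [[|[|[|]]]] // H; [apply: Or31|apply: Or32|apply: Or33];
  apply: val_inj; rewrite /= inordK.
Qed.

Lemma inord3_eq i j : (i < 3)%N -> (j < 3)%N -> ((inord i : 'I_3) == inord j) = (i == j).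
Proof. by move=> hi hj; rewrite -val_eqE /= !inordK. Qed.

Lemma mn3_val i j k :
  [/\ mn3 i j k (inord 0) = i, mn3 i j k (inord 1) = j & mn3 i j k (inord 2) = k].
Proof.
by split; rewrite !mnmDE !mulmnE !mnm1E !inord3_eq //= ?mul1n ?mul0n ?addn0 ?add0n.
Qed.

Lemma mn3E (m : 'X_{1..3}) : m = mn3 (m (inord 0)) (m (inord 1)) (m (inord 2)).
Proof.
apply/mnmP => i.
by have [e0 e1 e2] := mn3_val (m (inord 0)) (m (inord 1)) (m (inord 2));
  case: (ord3P i) => ->.
Qed.

Lemma mdeg_mn3 i j k : mdeg (mn3 i j k) = (i + j + k)%N.
Proof. by rewrite !mdegD !mdegMn !mdeg1 !mul1n. Qed.

Lemma big_ord3 (R : Type) (idx : R) (op : Monoid.law idx) (f : 'I_3 -> R) :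
  \big[op/idx]_i f i = op (op (f (inord 0)) (f (inord 1))) (f (inord 2)).
Proof.
rewrite !big_ord_recl big_ord0 Monoid.mulm1 Monoid.mulmA.
by congr (op (op (f _) (f _)) (f _)); apply: val_inj; rewrite /= ?inordK.
Qed.

Definition vec3 (R : nmodType) (a b c : R) : 'I_3 -> R := fun i => nth 0 [:: a; b; c] i.

Lemma vec3_val (R : nmodType) (a b c : R) :
  [/\ vec3 a b c (inord 0) = a, vec3 a b c (inord 1) = b & vec3 a b c (inord 2) = c].
Proof. by rewrite /vec3 !inordK. Qed.

Lemma vec3E (R : nmodType) (v : 'I_3 -> R) : v =1 vec3 (v (inord 0)) (v (inord 1)) (v (inord 2)).
Proof.
move=> i; have [e0 e1 e2] := vec3_val (v (inord 0)) (v (inord 1)) (v (inord 2)).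
by case: (ord3P i) => ->.
Qed.

Definition ev3 F (a b c : K) := F.@[vec3 a b c].

Lemma ev3_meval F v : F.@[v] = ev3 F (v (inord 0)) (v (inord 1)) (v (inord 2)).
Proof. by apply: meval_eq; apply: vec3E. Qed.

Lemma ev3_ext F G : (forall a b c, ev3 F a b c = ev3 G a b c) -> F = G.
Proof. by move=> e; apply: mpoly_ext => v; rewrite !ev3_meval e. Qed.

Lemma ev3D F G a b c : ev3 (F + G) a b c = ev3 F a b c + ev3 G a b c.
Proof. exact: mevalD. Qed.
Lemma ev3B F G a b c : ev3 (F - G) a b c = ev3 F a b c - ev3 G a b c.
Proof. exact: mevalB. Qed.
Lemma ev3N F a b c : ev3 (- F) a b c = - ev3 F a b c.
Proof. exact: mevalN. Qed.
Lemma ev3M F G a b c : ev3 (F * G) a b c = ev3 F a b c * ev3 G a b c.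
Proof. exact: mevalM. Qed.
Lemma ev3Z t F a b c : ev3 (t *: F) a b c = t * ev3 F a b c.
Proof. exact: mevalZ. Qed.
Lemma ev3Xn F n a b c : ev3 (F ^+ n) a b c = ev3 F a b c ^+ n.
Proof. exact: rmorphXn. Qed.
Lemma ev3_0 a b c : ev3 ('X_(inord 0)) a b c = a.
Proof. by rewrite /ev3 mevalXU; case: (vec3_val a b c). Qed.
Lemma ev3_1 a b c : ev3 ('X_(inord 1)) a b c = b.
Proof. by rewrite /ev3 mevalXU; case: (vec3_val a b c). Qed.
Lemma ev3_2 a b c : ev3 ('X_(inord 2)) a b c = c.
Proof. by rewrite /ev3 mevalXU; case: (vec3_val a b c). Qed.

Lemma ev3_prod I (r : seq I) (P : pred I) (E : I -> {mpoly K[3]}) a b c :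
  ev3 (\prod_(i <- r | P i) E i) a b c = \prod_(i <- r | P i) ev3 (E i) a b c.
Proof. exact: rmorph_prod. Qed.

Definition ev3E := (ev3D, ev3N, ev3M, ev3Z, ev3Xn, ev3_0, ev3_1, ev3_2).

Lemma ev3_scale d F t a b c : F \is d.-homog ->
  ev3 F (t * a) (t * b) (t * c) = t ^+ d * ev3 F a b c.
Proof.
move=> hF; rewrite /ev3 -(homog_scale _ _ hF); apply: meval_eq => i.
have [e0 e1 e2] := vec3_val (t * a) (t * b) (t * c).
have [e0' e1' e2'] := vec3_val a b c.
by case: (ord3P i) => ->; rewrite ?e0 ?e0' ?e1 ?e1' ?e2 ?e2'.
Qed.

Lemma ev3_homog d F :
  (forall a b c, ev3 F (2%:R * a) (2%:R * b) (2%:R * c) = 2%:R ^+ d * ev3 F a b c) ->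
  F \is d.-homog.
Proof. by move=> h; apply: scale_homog => v; rewrite !ev3_meval h. Qed.

Lemma subst_eval A F v :
  (subst_mx A F).@[v] = F.@[fun i => \sum_j A i j * v j].
Proof.
rewrite /subst_mx comp_mpoly_meval; apply: meval_eq => i.
rewrite tnth_mktuple raddf_sum; apply: eq_bigr => j _ /=.
by rewrite mevalZ mevalXU.
Qed.

Definition row_app A (i : nat) (a b c : K) :=
  A (inord i) (inord 0) * a + A (inord i) (inord 1) * b + A (inord i) (inord 2) * c.

Lemma subst_ev3 A F a b c :
  ev3 (subst_mx A F) a b c = ev3 F (row_app A 0 a b c) (row_app A 1 a b c) (row_app A 2 a b c).
Proof.
rewrite {1}/ev3 subst_eval ev3_meval; have [e0 e1 e2] := vec3_val a b c.
by rewrite !big_ord3 /= e0 e1 e2.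
Qed.

Lemma subst_mxM A B F : subst_mx A (subst_mx B F) = subst_mx (B *m A) F.
Proof.
apply: mpoly_ext => v; rewrite !subst_eval; apply: meval_eq => i.
under eq_bigr => j _ do rewrite mulr_sumr.
under [RHS]eq_bigr => j _ do rewrite mxE mulr_suml.
rewrite exchange_big /=; apply: eq_bigr => j _; apply: eq_bigr => k _.
by rewrite mulrA.
Qed.

Lemma subst_mx1 F : subst_mx 1%:M F = F.
Proof.
apply: mpoly_ext => v; rewrite subst_eval; apply: meval_eq => i.
rewrite (bigD1 i) //= mxE eqxx mul1r big1 ?addr0 // => j ji.
by rewrite mxE eq_sym (negbTE ji) mul0r.
Qed.

Lemma subst_mxK A F : A \in unitmx -> subst_mx A (subst_mx (invmx A) F) = F.
Proof. by move=> uA; rewrite subst_mxM mulVmx // subst_mx1. Qed.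

Lemma subst_mxKV A F : A \in unitmx -> subst_mx (invmx A) (subst_mx A F) = F.
Proof. by move=> uA; rewrite subst_mxM mulmxV // subst_mx1. Qed.

Lemma substM A F G : subst_mx A (F * G) = subst_mx A F * subst_mx A G.
Proof. exact: rmorphM. Qed.
Lemma substXn A F n : subst_mx A (F ^+ n) = subst_mx A F ^+ n.
Proof. exact: rmorphXn. Qed.
Lemma substZ A t F : subst_mx A (t *: F) = t *: subst_mx A F.
Proof. exact: comp_mpolyZ. Qed.
Lemma subst_prod A I (r : seq I) (P : pred I) (E : I -> {mpoly K[3]}) :
  subst_mx A (\prod_(i <- r | P i) E i) = \prod_(i <- r | P i) subst_mx A (E i).
Proof. exact: rmorph_prod. Qed.
Lemma subst0 A : subst_mx A 0 = 0.
Proof. exact: comp_mpoly0. Qed.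

Lemma subst_homog A d F : F \is d.-homog -> subst_mx A F \is d.-homog.
Proof.
move=> hF; apply: scale_homog => v; rewrite !subst_eval -(homog_scale _ _ hF).
by apply: meval_eq => i; rewrite mulr_sumr; apply: eq_bigr => j _; rewrite mulrCA.
Qed.

Lemma subst_unit A F : F \is a GRing.unit -> subst_mx A F \is a GRing.unit.
Proof. exact: rmorph_unit. Qed.

Lemma subst_reduced A F : A \in unitmx -> reduced F -> reduced (subst_mx A F).
Proof.
move=> uA [Fn0 hF]; split.
  by apply: contraNneq Fn0 => e; rewrite -(subst_mxKV F uA) e subst0.
move=> G H e; rewrite -(subst_mxK G uA); apply: subst_unit.
apply: (hF _ (subst_mx (invmx A) H)).
by rewrite -substXn -substM -e subst_mxKV.
Qed.

Definition dehom F : {mpoly K[2]} := F \mPo [tuple x; y; 1].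

Lemma ev2_dehom F a b : ev2 (dehom F) a b = ev3 F a b 1.
Proof.
rewrite /ev2 /dehom comp_mpoly_meval ev3_meval !(tnth_nth 0) !inordK //=.
by rewrite !mevalXU meval1 eqxx.
Qed.

Lemma dehomM F G : dehom (F * G) = dehom F * dehom G.
Proof. exact: rmorphM. Qed.

Lemma cf_dehom d F i j : F \is d.-homog ->
  cf (dehom F) i j = if (i + j <= d)%N then F@_(mn3 i j (d - (i + j))) else 0.
Proof.
move=> hF; rewrite /dehom comp_mpolyEX cf_sum.
under eq_bigr => m _ do
  rewrite cfZ comp_mpolyX big_ord3 !(tnth_nth 0) !inordK //= expr1n mulr1 cfX.
case: leqP => h; last first.
  rewrite big1_seq // => m /andP[_ hm]; case: andP => [[/eqP e0 /eqP e1]|]; rewrite ?mulr0 //.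
  by have := dhomog_mf hF hm; rewrite /= (mn3E m) mdeg_mn3 e0 e1; lia.
set k := (d - _)%N.
case: (boolP (mn3 i j k \in msupp F)) => [hm|/memN_msupp_eq0 hm].
  have [e0 e1 _] := mn3_val i j k.
  rewrite (bigD1_seq _ hm) ?msupp_uniq //= e0 e1 !eqxx mulr1 big1_seq ?addr0 //.
  move=> m /andP[mn hm']; case: andP => [[/eqP e0' /eqP e1']|]; rewrite ?mulr0 //.
  case/negP: mn; apply/eqP; have := dhomog_mf hF hm'; rewrite /= (mn3E m) mdeg_mn3 e0' e1'.
  by move=> ed; congr mn3; rewrite /k -ed; lia.
rewrite hm big1_seq // => m /andP[_ hm']; case: andP => [[/eqP e0' /eqP e1']|]; rewrite ?mulr0 //.
suff e : m = mn3 i j k by rewrite e hm mul0r.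
have := dhomog_mf hF hm'; rewrite /= (mn3E m) mdeg_mn3 e0' e1'.
by move=> ed; congr mn3; rewrite /k -ed; lia.
Qed.

Lemma cf_dehom_deg d F i j : F \is d.-homog -> cf (dehom F) i j != 0 -> (i + j <= d)%N.
Proof. by move=> hF; rewrite (cf_dehom _ _ hF); case: leqP => //; rewrite eqxx. Qed.

Lemma dehom_eq0 d F : F \is d.-homog -> dehom F = 0 -> F = 0.
Proof.
move=> hF e; apply/mpolyP => m; rewrite mcoeff0; apply/eqP.
apply: contraT => hm; have := dhomog_mf hF; move/(_ m); rewrite mcoeff_msupp => /(_ hm) /= em.
have := cf_dehom (m (inord 0)) (m (inord 1)) hF; rewrite e /cf mcoeff0.
have em' : (m (inord 0) + m (inord 1) + m (inord 2))%N = d by rewrite -em {4}(mn3E m) mdeg_mn3.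
rewrite -em' leq_addr addKn -mn3E => h; by rewrite -h eqxx in hm.
Qed.

End Forms.

(** * Restriction to a smooth conic *)

Section Conic.
Context {K : numClosedFieldType}.
Implicit Types (F G A B : {mpoly K[3]}).

Local Notation X0 := ('X_(inord 0) : {mpoly K[3]}).
Local Notation X1 := ('X_(inord 1) : {mpoly K[3]}).
Local Notation X2 := ('X_(inord 2) : {mpoly K[3]}).

(** Every smooth conic is projectively equivalent to this one, which is
    parametrized by [(s, s ^+ 2, 1)]. *)
Definition conic : {mpoly K[3]} := X1 * X2 - X0 ^+ 2.

Lemma ev3_conic a b c : ev3 conic a b c = b * c - a ^+ 2.
Proof. by rewrite /conic !ev3E. Qed.

Lemma conic_homog : conic \is 2.-homog.
Proof. by apply: ev3_homog => a b c; rewrite !ev3_conic; ring. Qed.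

Lemma conic_neq0 : conic != 0.
Proof.
apply/eqP => /(congr1 (fun F => ev3 F 1 0 0)).
by rewrite ev3_conic /ev3 meval0 mul0r expr1n sub0r => /eqP; rewrite oppr_eq0 oner_eq0.
Qed.

Lemma zero_not_unit F a b c : ev3 F a b c = 0 -> F \isn't a GRing.unit.
Proof.
move=> F0; apply/negP => /(rmorph_unit (meval (vec3 a b c))).
by move: F0; rewrite /ev3 /= => ->; rewrite unitr0.
Qed.

Lemma conic_not_unit : conic \isn't a GRing.unit.
Proof. by apply: (@zero_not_unit _ 0 0 0); rewrite ev3_conic; ring. Qed.

Lemma X_neq0 (n : nat) (i : 'I_n) : 'X_i != 0 :> {mpoly K[n]}.
Proof. by rewrite -msize_poly_eq0 msizeX. Qed.

(** Division by the conic as a polynomial of degree [2] in [X0]. *)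
Lemma conic_euclid F : exists G A B,
  [/\ F = conic * G + A + X0 * B,
      forall a a' b c, ev3 A a b c = ev3 A a' b c
    & forall a a' b c, ev3 B a b c = ev3 B a' b c].
Proof.
have z a b c : ev3 (0 : {mpoly K[3]}) a b c = 0 by exact: meval0.
elim/mpolyind: F => [|t m p _ _ [G [A [B [-> hA hB]]]]].
  by exists 0, 0, 0; split => [|a a' b c|a a' b c]; rewrite ?mulr0 ?addr0 // !z.
suff [G' [A' [B' [e hA' hB']]]] : exists G A B,
  [/\ t *: 'X_[m] = conic * G + A + X0 * B,
      forall a a' b c, ev3 A a b c = ev3 A a' b c
    & forall a a' b c, ev3 B a b c = ev3 B a' b c].
  exists (G' + G), (A' + A), (B' + B); split=> [|a a' b c|a a' b c].
  - by rewrite e; ring.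
  - by rewrite !ev3D (hA a a') (hA' a a').
  - by rewrite !ev3D (hB a a') (hB' a a').
rewrite (mn3E m) /mn3 !mpolyXD -!mpolyXn -!mulrA.
rewrite scalerAr; set q := t *: _.
have : forall a a' b c, ev3 q a b c = ev3 q a' b c by move=> a a' b c; rewrite !ev3E.
move: (m (inord 0)) q; clear -z.
elim/ltn_ind => -[|[|n]] IHn q hq.
- exists 0, q, 0; split => // [|a a' b c]; last by rewrite !z.
  by rewrite expr0; ring.
- exists 0, 0, q; split => // [|a a' b c]; last by rewrite !z.
  by rewrite expr1; ring.
have [] := IHn n _ (X1 * X2 * q); rewrite ?ltnS ?leqnSn //.
  by move=> a a' b c; rewrite !ev3E (hq a a').
move=> G [A [B [e hA hB]]]; exists (G - X0 ^+ n * q), A, B; split=> //.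
rewrite (_ : conic * _ + A + X0 * B = (conic * G + A + X0 * B) - conic * (X0 ^+ n * q)); last by ring.
by rewrite -e /conic !exprS; ring.
Qed.

(** The remainder [A + X0 * B] of the division by the conic vanishes on it.  Its
    values at opposite parameters show that [A] and [B] vanish separately. *)
Lemma conic_dvd d F : F \is d.-homog ->
  (forall s, ev3 F s (s ^+ 2) 1 = 0) -> exists G, F = conic * G.
Proof.
move=> hF F0; have [G [A [B [e hA hB]]]] := conic_euclid F.
have F1 s w : w != 0 -> ev3 F (s * w) (s ^+ 2) (w ^+ 2) = 0.
  move=> wn0; have := ev3_scale (w ^+ 2) (s / w) ((s / w) ^+ 2) 1 hF.
  rewrite F0 mulr0 mulr1 => <-; congr ev3; by field.
have AB s w : w != 0 -> ev3 A 0 (s ^+ 2) (w ^+ 2) + s * w * ev3 B 0 (s ^+ 2) (w ^+ 2) = 0.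
  move=> wn0; have := F1 s w wn0; rewrite e !ev3E ?ev3_conic.
  by rewrite (hA (s * w) 0) (hB (s * w) 0) => e0; rewrite -[RHS]e0; ring.
have A0 s w : w != 0 -> ev3 A 0 (s ^+ 2) (w ^+ 2) = 0.
  move=> wn0; have h1 := AB s w wn0; have := AB (- s) w wn0.
  rewrite sqrrN => h2; apply: (@mulfI _ 2%:R); first by rewrite pnatr_eq0.
  by have := congr2 +%R h1 h2; rewrite addr0 mulr0 => e0; rewrite -[RHS]e0; ring.
have B0 s w : s != 0 -> w != 0 -> ev3 B 0 (s ^+ 2) (w ^+ 2) = 0.
  move=> sn0 wn0; have := AB s w wn0; rewrite A0 // add0r => /eqP.
  by rewrite !mulf_eq0 (negbTE sn0) (negbTE wn0) => /eqP.
have AE : A = 0.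
  apply/eqP; have : A * X2 == 0.
    apply/eqP; apply: ev3_ext => a b c; rewrite !ev3E /ev3 meval0 -/(ev3 A a b c).
    have [->|cn0] := eqVneq c 0; first by rewrite mulr0.
    rewrite (hA a 0) -(sqrtCK b) -(sqrtCK c) A0 ?mul0r //.
    by rewrite sqrtC_eq0.
  by rewrite mulf_eq0 (negbTE (X_neq0 _)) orbF.
have BE : B = 0.
  apply/eqP; have : B * (X1 * X2) == 0.
    apply/eqP; apply: ev3_ext => a b c; rewrite !ev3E /ev3 meval0 -/(ev3 B a b c).
    have [->|bn0] := eqVneq b 0; first by rewrite mul0r mulr0.
    have [->|cn0] := eqVneq c 0; first by rewrite !mulr0.
    rewrite (hB a 0) -(sqrtCK b) -(sqrtCK c) B0 ?mul0r //; by rewrite sqrtC_eq0.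
  by rewrite !mulf_eq0 !(negbTE (X_neq0 _)) !orbF.
by exists G; rewrite e AE BE mulr0 !addr0.
Qed.

Lemma quotient_homog d e F G : F != 0 -> F \is d.-homog -> F * G \is (d + e).-homog ->
  G \is e.-homog.
Proof.
move=> Fn0 hF hFG; apply: ev3_homog => a b c.
pose T : {mpoly K[3]} -> {mpoly K[3]} := subst_mx (2%:R)%:M.
have TE H u v w : ev3 (T H) u v w = ev3 H (2%:R * u) (2%:R * v) (2%:R * w).
  rewrite /T subst_ev3 /row_app; congr ev3; rewrite !mxE !inord3_eq //=; ring.
have : F * T G = F * (2%:R ^+ e *: G).
  apply: ev3_ext => u v w; apply: (@mulfI _ (2%:R ^+ d)); first by rewrite expf_neq0 // pnatr_eq0.
  have h1 := ev3_scale 2%:R u v w hF; have h2 := ev3_scale 2%:R u v w hFG.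
  rewrite !ev3M in h2; rewrite !ev3M TE ev3Z mulrA -h1 h2 exprD; ring.
by move=> /(mulfI Fn0) /(congr1 (fun H => ev3 H a b c)); rewrite TE ev3Z.
Qed.

Lemma conic_dvd_homog d F : F \is d.+2.-homog ->
  (forall s, ev3 F s (s ^+ 2) 1 = 0) -> exists2 G, G \is d.-homog & F = conic * G.
Proof.
move=> hF F0; have [G e] := conic_dvd hF F0; exists G => //.
by apply: (quotient_homog conic_neq0 conic_homog); rewrite -e.
Qed.

Definition pev F (a b c : {poly K}) : {poly K} := mmap polyC (vec3 a b c) F.

Lemma horner_pev F a b c s : (pev F a b c).[s] = ev3 F a.[s] b.[s] c.[s].
Proof.
rewrite /pev /mmap horner_sum /ev3 mevalE; apply: eq_bigr => m _.
rewrite hornerCM /mmap1 horner_prod; congr (_ * _); apply: eq_bigr => i _.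
rewrite horner_exp; congr (_ ^+ _).
have [e0 e1 e2] := vec3_val a b c; have [e0' e1' e2'] := vec3_val a.[s] b.[s] c.[s].
by case: (ord3P i) => ->; rewrite ?e0 ?e1 ?e2 ?e0' ?e1' ?e2'.
Qed.

Lemma size_pev d F (a b c : {poly K}) : F \is d.-homog ->
  (size a <= 3)%N -> (size b <= 3)%N -> (size c <= 3)%N ->
  (size (pev F a b c) <= (2 * d).+1)%N.
Proof.
move=> hF sa sb sc; apply: (leq_trans (size_sum _ _ _)); apply/bigmax_leqP_seq => m hm _.
rewrite mul_polyC; apply: (leq_trans (size_scale_leq _ _)).
have [e0 e1 e2] := vec3_val a b c.
have em := dhomog_mf hF hm; rewrite /= (mn3E m) mdeg_mn3 in em.
have key (p : {poly K}) n : (size p <= 3)%N -> (size (p ^+ n) <= (2 * n).+1)%N.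
  move=> sp; apply: leq_trans (size_poly_exp_leq _ _) _; rewrite ltnS leq_mul2r.
  by rewrite -subn1 leq_subLR sp orbT.
rewrite /mmap1 big_ord3 e0 e1 e2.
have k0 := key _ (m (inord 0)) sa; have k1 := key _ (m (inord 1)) sb; have k2 := key _ (m (inord 2)) sc.
have sAB : (size (a ^+ m (inord 0) * b ^+ m (inord 1))%R <=
    (2 * (m (inord 0) + m (inord 1))).+1)%N.
  by apply: leq_trans (size_polyMleq _ _) _; lia.
apply: leq_trans (size_polyMleq _ _) _.
by rewrite -subn1 leq_subLR; apply: leq_trans (leq_add sAB k2) _; lia.
Qed.

(** The restriction of a form to the conic, as a polynomial in its parameter. *)
Definition restr F : {poly K} := pev F 'X 'X^2 1.

Lemma horner_restr F s : (restr F).[s] = ev3 F s (s ^+ 2) 1.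
Proof. by rewrite horner_pev hornerX hornerXn hornerC. Qed.

Lemma poly_ext (p q : {poly K}) : (forall s, p.[s] = q.[s]) -> p = q.
Proof.
by move=> h; apply/eqP; rewrite -subr_eq0; apply/eqP/poly_vanish => s;
  rewrite hornerD hornerN h subrr.
Qed.

Lemma restrM F G : restr (F * G) = restr F * restr G.
Proof. by apply: poly_ext => s; rewrite hornerM !horner_restr ev3M. Qed.
Lemma restrD F G : restr (F + G) = restr F + restr G.
Proof. by apply: poly_ext => s; rewrite hornerD !horner_restr ev3D. Qed.
Lemma restrB F G : restr (F - G) = restr F - restr G.
Proof. by apply: poly_ext => s; rewrite hornerD hornerN !horner_restr ev3B. Qed.
Lemma restrZ t F : restr (t *: F) = t *: restr F.
Proof. by apply: poly_ext => s; rewrite hornerZ !horner_restr ev3Z. Qed.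
Lemma restr_conic : restr conic = 0.
Proof. by apply: poly_ext => s; rewrite horner_restr ev3_conic horner0; ring. Qed.

Lemma size_restr d F : F \is d.-homog -> (size (restr F) <= (2 * d).+1)%N.
Proof. by move=> hF; apply: size_pev; rewrite ?size_polyX ?size_polyXn ?size_poly1. Qed.

Lemma restr_eq0 F : restr F = 0 -> forall s, ev3 F s (s ^+ 2) 1 = 0.
Proof. by move=> h s; rewrite -horner_restr h horner0. Qed.

Lemma reduced_restr_quotient e G : G \is e.-homog -> reduced (conic * G) -> restr G != 0.
Proof.
move=> hG [_ hr]; apply/eqP => /restr_eq0 G0.
have [G' eG] := conic_dvd hG G0.
by have := hr conic G'; rewrite eG mulrA -expr2 => /(_ erefl); rewrite (negbTE conic_not_unit).
Qed.

(** The parameter and its square are the restrictions of [X0] and [X1], so each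
    power up to ['X^(2 * k)] is the restriction of a monomial. *)
Lemma restr_surj k (N : {poly K}) : (size N <= (2 * k).+1)%N ->
  exists2 F, F \is k.-homog & restr F = N.
Proof.
move=> sN.
pose M i := X0 ^+ (odd i) * X1 ^+ i./2 * X2 ^+ (k - (odd i + i./2)).
exists (\sum_(i < (2 * k).+1) N`_i *: M i).
  apply: rpred_sum => i _; apply: rpredZ.
  have : (i < (2 * k).+1)%N by []; move: {i}(i : nat) => i hi; rewrite {}/M.
  have ek : (odd i + i./2 + (k - (odd i + i./2)))%N = k by have := odd_double_half i; lia.
  move: (k - _)%N ek => b <-.
  have hX j n : ('X_j ^+ n : {mpoly K[3]}) \is n.-homog.
    by rewrite mpolyXn dhomogX /= mdegMn mdeg1 mul1n.
  by apply: dhomogM; [apply: dhomogM|].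
apply: poly_ext => s; rewrite horner_restr (horner_coef_wide _ sN) /ev3 raddf_sum /=.
apply: eq_bigr => i _; rewrite -/(ev3 _ _ _ _) !ev3E expr1n mulr1 -exprM -exprD.
by congr (_ * _ ^+ _); have := odd_double_half i; lia.
Qed.

Lemma clear_denominators (w : {mpoly K[2]}) (p q D : {poly K}) :
  exists N (W : {poly K}), forall s, D.[s] != 0 ->
    ev2 w (p.[s] / D.[s]) (q.[s] / D.[s]) * D.[s] ^+ N = W.[s].
Proof.
elim/mpolyind: w => [|t m w _ _ [N [W hW]]].
  by exists 0%N, 0 => s _; rewrite /ev2 meval0 mul0r horner0.
pose a := m ord0; pose b := m ord_max.
exists (N + (a + b))%N, (t *: (p ^+ a * q ^+ b) * D ^+ N + W * D ^+ (a + b)) => s Dn0.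
rewrite ev2D mulrDl (mn2E m) mpolyX_mn2 -mul_mpolyC !ev2E !hornerE ?horner_exp.
rewrite /= -/a -/b -(hW _ Dn0) !exprD !exprMn !exprVn; field; by rewrite !expf_neq0.
Qed.

Lemma order_of_identity (H D W : {poly K}) (N n : nat) : D.[0] != 0 ->
  (forall s, D.[s] != 0 -> H.[s] * D.[s] ^+ N = s ^+ n * W.[s]) ->
  exists2 H', H = H' * 'X^n & H'.[0] * D.[0] ^+ N = W.[0].
Proof.
move=> D0 h.
have Dn0 : D != 0 by apply: contraNneq D0 => ->; rewrite horner0.
have e : H * D ^+ N = 'X^n * W.
  apply: (mulfI Dn0); apply: poly_ext => s; rewrite !hornerM horner_exp hornerXn.
  have [->|Ds] := eqVneq D.[s] 0; first by rewrite !mul0r.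
  by rewrite h.
have : 'X^n %| H.
  have cop : coprimep 'X^n (D ^+ N).
    rewrite coprimep_expl // coprimep_expr // coprimep_sym -['X]subr0 -polyC0.
    by rewrite coprimep_XsubC /root.
  by rewrite -(Gauss_dvdpl _ cop) e dvdp_mulr.
case/dvdpP => H' eH; exists H' => //.
have : H' * D ^+ N * 'X^n = W * 'X^n by rewrite mulrAC -eH e mulrC.
move/(mulIf _); rewrite -size_poly_eq0 size_polyXn => /(_ isT) <-.
by rewrite hornerM horner_exp.
Qed.

End Conic.

(** * Maximal contact with a pencil of conics *)

Section Pencil.
Context {K : numClosedFieldType}.
Implicit Types (F G : {mpoly K[3]}).

Local Notation X0 := ('X_(inord 0) : {mpoly K[3]}).
Local Notation X1 := ('X_(inord 1) : {mpoly K[3]}).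
Local Notation X2 := ('X_(inord 2) : {mpoly K[3]}).

(** The conics having fourfold contact with [conic] at [(0 : 0 : 1)]. *)
Definition pencil (rho : K) : {mpoly K[3]} := conic - rho *: X1 ^+ 2.

Lemma ev3_pencil rho a b c : ev3 (pencil rho) a b c = b * c - a ^+ 2 - rho * b ^+ 2.
Proof. by rewrite /pencil ev3B ev3_conic !ev3E. Qed.

Definition pencil_product (d : nat) F : Prop :=
  exists (B : 'M[K]_3) (k : K) (rho : 'I_(d./2) -> K),
  [/\ B \in unitmx, k != 0 & subst_mx B F = k *: \prod_i pencil (rho i)].

(** The curve [b c = a ^+ 2 + u * b ^+ 2] is parametrized by
    [(s, s ^+ 2, 1 + u * s ^+ 2)].  A form that vanishes to the maximal order
    [2 d] at [s = 0] on all these conics is constant on each of them, up to the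
    factor [b ^+ d]; hence it is a polynomial in the two generators of the
    pencil, and it splits because the field is algebraically closed. *)
Lemma maximal_contact_pencil d G : ~~ odd d -> G \is d.-homog -> reduced G ->
  (forall u, 'X^(2 * d) %| pev G 'X 'X^2 (1 + u *: 'X^2)) ->
  exists (k : K) (rho : 'I_(d./2) -> K), k != 0 /\ G = k *: \prod_i pencil (rho i).
Proof.
move=> dev hG [Gn0 hred] hu.
set n := d./2; have dE : d = (2 * n)%N by have := odd_double_half d; rewrite (negbTE dev); lia.
pose kap := pev G 1 1 (1 + 'X).
have kapE u : kap.[u] = ev3 G 1 1 (1 + u) by rewrite horner_pev !hornerE.
have Hs s u : ev3 G s (s ^+ 2) (1 + u * s ^+ 2) = kap.[u] * s ^+ (2 * d).
  have [q eq] := dvdpP _ _ (hu u).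
  have sP : (size (pev G 'X 'X^2 (1 + u *: 'X^2)) <= (2 * d).+1)%N.
    apply: size_pev; rewrite ?size_polyX ?size_polyXn //.
    apply: leq_trans (size_polyD _ _) _; rewrite geq_max size_poly1 /=.
    by apply: leq_trans (size_scale_leq _ _) _; rewrite size_polyXn.
  have [c qE] : exists c, q = c%:P.
    have [->|qn0] := eqVneq q 0; first by exists 0; rewrite polyC0.
    exists q`_0; apply: size1_polyC.
    by move: sP; rewrite eq size_Mmonic ?monicXn // size_polyXn addnS /= -(add1n (2 * d)) leq_add2r.
  have E t : ev3 G t (t ^+ 2) (1 + u * t ^+ 2) = c * t ^+ (2 * d).
    have := congr1 (fun p => p.[t]) eq; rewrite /= horner_pev qE hornerCM hornerXn.
    by rewrite !(hornerD, hornerZ, hornerXn, hornerX, hornerC).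
  (* The bound on the degree leaves a constant factor, computed at [t = 1]. *)
  have := E 1; rewrite !expr1n !mulr1 -kapE => ->; exact: E.
have Gab a b c : a != 0 -> b != 0 -> ev3 G a b c = b ^+ d * kap.[(b * c - a ^+ 2) / b ^+ 2].
  move=> an0 bn0.
  have := ev3_scale (a ^+ 2 / b) (b / a) ((b / a) ^+ 2) (1 + (b * c - a ^+ 2) / b ^+ 2 * (b / a) ^+ 2) hG.
  rewrite Hs.
  have -> : a ^+ 2 / b * (b / a) = a by field; rewrite ?an0 ?bn0.
  have -> : a ^+ 2 / b * (b / a) ^+ 2 = b by field; rewrite ?an0 ?bn0.
  have -> : a ^+ 2 / b * (1 + (b * c - a ^+ 2) / b ^+ 2 * (b / a) ^+ 2) = c.
    by field; rewrite ?an0 ?bn0.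
  move=> ->; rewrite mulrCA [RHS]mulrC; congr (_ * _).
  by rewrite exprM -exprMn; congr (_ ^+ d); field; rewrite ?an0 ?bn0.
have kapn0 : kap != 0.
  apply: contraNneq Gn0 => k0; apply/eqP.
  have /eqP : G * (X0 * X1) = 0.
    apply: ev3_ext => a b c; rewrite !ev3E /ev3 meval0 -/(ev3 G a b c).
    have [->|an0] := eqVneq a 0; first by rewrite mul0r mulr0.
    have [->|bn0] := eqVneq b 0; first by rewrite !mulr0.
    by rewrite Gab // k0 horner0 mulr0 mul0r.
  by rewrite !mulf_eq0 !(negbTE (X_neq0 _)) !orbF => /eqP.
have [r kapP] := closed_field_poly_normal kap.
set k := lead_coef kap in kapP; set m := size r.
have kn0 : k != 0 by rewrite lead_coef_eq0.
have kapH u : kap.[u] = k * \prod_(z <- r) (u - z).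
  rewrite {1}kapP hornerZ horner_prod; congr (_ * _).
  by apply: eq_bigr => z _; rewrite hornerXsubC.
have prodM (b Q : K) : b != 0 ->
    b ^+ (2 * m) * \prod_(z <- r) (Q / b ^+ 2 - z) = \prod_(z <- r) (Q - z * b ^+ 2).
  move=> bn0; rewrite exprM /m; elim: (r) => [|z l IH]; first by rewrite !big_nil mulr1.
  by rewrite !big_cons /= exprS -IH; field.
(* Otherwise [G] would have a pole along [X1 = 0]. *)
have mn : (m <= n)%N.
  rewrite leqNgt; apply/negP => nm.
  have e : pev G 1 'X 0 * 'X^(2 * m - d) = k *: \prod_(z <- r) (- 1 - z *: 'X^2).
    apply/eqP; rewrite -subr_eq0; apply/eqP/poly_vanish_nz => b bn0.
    rewrite hornerD hornerN hornerM horner_pev hornerX hornerXn hornerZ hornerC.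
    rewrite horner0 horner_prod.
    under eq_bigr => z _ do
      rewrite !(hornerD, hornerN, hornerZ, hornerXn, hornerC).
    rewrite Gab ?oner_eq0 // kapH mulr0 expr1n sub0r -(prodM b (-1) bn0).
    have -> : (2 * m)%N = (d + (2 * m - d))%N by lia.
    by rewrite addKn exprD; ring.
  have := congr1 (fun p => p.[0]) e; rewrite /= hornerM hornerXn hornerZ horner_prod.
  under eq_bigr => z _ do
    rewrite !(hornerD, hornerN, hornerZ, hornerXn, hornerC) expr0n /= mulr0 subr0.
  rewrite expr0n (_ : (_ - _)%N == 0%N = false) ?mulr0; last by apply/negbTE; lia.
  move/esym/eqP; rewrite mulf_eq0 (negbTE kn0) /= big_const_seq count_predT iter_mulr_1.
  by rewrite expf_eq0 oppr_eq0 oner_eq0 andbF.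
have GE : G = X1 ^+ (2 * (n - m)) * (k *: \prod_(z <- r) pencil z).
  apply: (mulIf (mulf_neq0 (X_neq0 (inord 0)) (X_neq0 (inord 1)))).
  apply: ev3_ext => a b c; rewrite !ev3M ev3_0 ev3_1.
  have [->|an0] := eqVneq a 0; first by rewrite mul0r !mulr0.
  have [->|bn0] := eqVneq b 0; first by rewrite !mulr0.
  rewrite Gab // kapH !ev3E ev3_prod; congr (_ * _).
  under [in RHS]eq_bigr => z _ do rewrite ev3_pencil.
  rewrite -(prodM b _ bn0).
  have -> : d = (2 * (n - m) + 2 * m)%N by lia.
  by rewrite exprD; ring.
(* As [n - m] would be positive, the square of [X1] would divide [G]. *)
have mE : m = n.
  apply/eqP; rewrite eqn_leq mn leqNgt; apply/negP => nm.
  have := hred X1 (X1 ^+ (2 * (n - m) - 2) * (k *: \prod_(z <- r) pencil z)).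
  rewrite mulrA -exprD subnKC -?GE; last lia.
  move=> /(_ erefl); apply/negP; apply: (@zero_not_unit _ _ 0 0 0).
  by rewrite ev3_1.
exists k, (fun i => r`_i); split => //.
by rewrite {1}GE mE subnn muln0 expr0 mul1r (big_nth 0) big_mkord -/m mE.
Qed.

(** Two equal members would form a double component. *)
Lemma reduced_pencil_inj (n : nat) (k : K) (rho : 'I_n -> K) :
  reduced (k *: \prod_i pencil (rho i)) -> injective rho.
Proof.
move=> [_ h] i j e; apply/eqP; apply: contraT => ij.
have := h (pencil (rho i)) (k *: \prod_(l | (l != i) && (l != j)) pencil (rho l)).
rewrite (bigD1 i) //= (bigD1 j) 1?eq_sym //= -e.
rewrite -scalerAr expr2 -mulrA => /(_ erefl).
by rewrite (negbTE (@zero_not_unit _ _ 0 0 0 _)) // ev3_pencil; ring.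
Qed.

End Pencil.

(** * Orders along an exceptional curve *)

Section Orders.
Context {K : numClosedFieldType}.
Implicit Types (f g h : {mpoly K[2]}) (F G : {mpoly K[3]}).

Local Notation x := ('X_ord0 : {mpoly K[2]}).
Local Notation y := ('X_ord_max : {mpoly K[2]}).

Definition xdvd f a := forall i j, cf f i j != 0 -> (a <= i)%N.

Lemma xdvdP f a : xdvd f a -> exists f', f = x ^+ a * f'.
Proof.
move=> h; pose N := msize f.
exists (\sum_(k < N) x ^+ k * ypoly (xcoef f (a + k))).
apply: cf_ext => i j.
case: (ltnP i a) => [ia|ai].
  have -> : cf f i j = 0 by apply/eqP; apply: contraTT ia => /h; rewrite -leqNgt.
  rewrite mulr_sumr cf_sum big1 // => k _; rewrite mulrA -exprD cf_xn_ypoly.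
  by case: eqP => // e; move: ia; rewrite -e; lia.
rewrite mulr_sumr cf_sum.
under eq_bigr => k _ do rewrite mulrA -exprD cf_xn_ypoly coef_xcoef.
case: (ltnP (i - a) N) => [li|gi].
  rewrite (bigD1 (Ordinal li)) //= subnKC // eqxx big1 ?addr0 // => k ki.
  by case: eqP => // ek; case/eqP: ki; apply: val_inj; rewrite /= -ek addKn.
rewrite big1 => [|k _]; last first.
  by case: eqP => // ek; have := ltn_ord k; move: gi; rewrite -ek addKn; lia.
apply/eqP; apply: contraTT gi => /cf_bound; rewrite -ltnNge /N; lia.
Qed.

Lemma cf_xmul f a i j : cf (x ^+ a * f) (a + i) j = cf f i j.
Proof.
have hN : (msize f <= msize f + i.+1)%N by rewrite leq_addr.
rewrite {1}(xcoef_expand hN) mulr_sumr cf_sum.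
under eq_bigr => k _ do rewrite mulrA -exprD cf_xn_ypoly eqn_add2l coef_xcoef.
have li : (i < msize f + i.+1)%N by rewrite ltn_addl.
rewrite (bigD1 (Ordinal li)) //= eqxx big1 ?addr0 // => k ki.
by case: eqP => // ek; case/eqP: ki; apply: val_inj.
Qed.

Lemma cf_xmul_lt f a i j : (i < a)%N -> cf (x ^+ a * f) i j = 0.
Proof.
move=> ia; have hN := leqnn (msize f).
rewrite {1}(xcoef_expand hN) mulr_sumr cf_sum big1 // => k _.
by rewrite mulrA -exprD cf_xn_ypoly; case: eqP => // e; move: ia; rewrite -e; lia.
Qed.

Lemma xdvd_xmul f a : xdvd (x ^+ a * f) a.
Proof. by move=> i j; case: ltnP => // h; rewrite cf_xmul_lt ?eqxx. Qed.

Lemma xcoef_xmul f a i : xcoef (x ^+ a * f) (a + i) = xcoef f i.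
Proof. by apply/polyP => j; rewrite !coef_xcoef cf_xmul. Qed.

Lemma horner_xcoef0 f t : (xcoef f 0).[t] = ev2 f 0 t.
Proof.
have := leq_addr 1 (msize f) => hN; rewrite [f in RHS](xcoef_expand hN).
rewrite addn1 big_ord_recl expr0 mul1r ev2D ev2_ypoly /ev2 raddf_sum /= big1 ?addr0 //.
move=> i _; rewrite -/(ev2 _ _ _) ev2M ev2Xn ev2x expr0n /= mul0r //.
Qed.

Lemma xcoef_mul f g a b : xdvd f a -> xdvd g b ->
  xdvd (f * g) (a + b) /\ xcoef (f * g) (a + b) = xcoef f a * xcoef g b.
Proof.
move=> /xdvdP[f' ->] /xdvdP[g' ->].
rewrite mulrACA -exprD; split; first exact: xdvd_xmul.
have xc0 n h : xcoef (x ^+ n * h) n = xcoef h 0 by rewrite -{2}(addn0 n) xcoef_xmul.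
rewrite !xc0.
by apply: poly_ext => t; rewrite hornerM !horner_xcoef0 ev2M.
Qed.

Lemma xdvd_weaken f a b : (b <= a)%N -> xdvd f a -> xdvd f b.
Proof. by move=> ba h i j /h; apply: leq_trans. Qed.

Lemma xdvd_ex f : f != 0 -> exists2 a, xdvd f a & xcoef f a != 0.
Proof.
move=> /(supp_min (fun i j => i)) [i [j [h hm]]].
by exists i => //; exact: xcoef_neq0 h.
Qed.

(** The order along [x = 0] is a valuation. *)
Lemma xdvd_cancel f g a b : xdvd (f * g) (a + b) -> xdvd f a -> xcoef f a != 0 -> xdvd g b.
Proof.
move=> h hf fa; have [->|gn0] := eqVneq g 0; first by move=> i j; rewrite /cf mcoeff0 eqxx.
have [c hg gc] := xdvd_ex gn0.
apply: (xdvd_weaken _ hg); rewrite leqNgt; apply/negP => cb.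
have [_ e] := xcoef_mul hf hg.
have /xcoef_neq0_ex[j /h] : xcoef (f * g) (a + c) != 0 by rewrite e mulf_neq0.
by rewrite leq_add2l leqNgt cb.
Qed.

Lemma xdvd_blow0 f w : (forall i j, cf f i j != 0 -> (w <= i + j)%N) <-> xdvd (blow0 f) w.
Proof.
split=> h i j; first by move=> /cf_blow0_inv[k -> /h].
by move=> /cf_blow0_nz /h.
Qed.

Lemma xdvd_pull c f w : xdvd (blow0 f) w -> xdvd (pull (Some c) f) w.
Proof. by move=> /xdvd_blow0 h i j /cf_pull_supp[k _ [l -> /h]]. Qed.

Lemma pullM o f g : pull o (f * g) = pull o f * pull o g.
Proof. exact: rmorphM. Qed.
Lemma blow0M f g : blow0 (f * g) = blow0 f * blow0 g.
Proof. exact: rmorphM. Qed.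

Lemma ev2_pull c f a b : ev2 (pull (Some c) f) a b = ev2 f a (a * (b + c)).
Proof. by rewrite /pull !ev2E. Qed.
Lemma ev2_blow0 f a b : ev2 (blow0 f) a b = ev2 f a (a * b).
Proof. by rewrite /blow0 !ev2E. Qed.

Lemma plane_mapE (psi : @plane_map K) : psi = map_pair (tnth psi ord0) (tnth psi ord_max).
Proof. by apply: eq_from_tnth => i; case: (ord2P i) => ->; rewrite [RHS](tnth_nth 0). Qed.

Definition arc_x (D p0 : {poly K}) s := s * p0.[s] / D.[s].

(** Away from the zeros of the common denominator [D], the chart [psi] maps
    [(xi, eta)] to the point [B (s, s ^+ 2, c)] of the plane.  Arcs are obtained with
    [xi = arc_x D p0 s]. *)
Definition maps_to (psi : @plane_map K) (B : 'M[K]_3) (D : {poly K}) s (c xi eta : K) :=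
  [/\ row_app B 0 s (s ^+ 2) c = D.[s] * ev2 (tnth psi ord0) xi eta,
      row_app B 1 s (s ^+ 2) c = D.[s] * ev2 (tnth psi ord_max) xi eta &
      row_app B 2 s (s ^+ 2) c = D.[s]].

Lemma maps_to_ev e psi B D s c xi eta G : G \is e.-homog ->
  maps_to psi B D s c xi eta ->
  ev3 (subst_mx B G) s (s ^+ 2) c = D.[s] ^+ e * ev2 (dehom G \mPo psi) xi eta.
Proof.
move=> hG [e0 e1 e2]; rewrite subst_ev3 e0 e1 e2.
rewrite -[D.[s] in X in ev3 _ _ _ X]mulr1 (ev3_scale _ _ _ _ hG); congr (_ * _).
by rewrite -ev2_dehom [psi in RHS]plane_mapE ev2_comp.
Qed.

(** The arc crosses the exceptional curve [x = 0] of [blow0 h] transversally at the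
    point [T.[0] / D.[0]], so the order along the arc is the order along that
    curve, unless the leading coefficient vanishes at the point. *)
Lemma arc_order (D p0 T H : {poly K}) (h : {mpoly K[2]}) (e S : nat) :
  D.[0] != 0 -> (forall s, D.[s] != 0 -> p0.[s] != 0) -> xdvd (blow0 h) S ->
  (forall s, D.[s] != 0 -> H.[s] =
     D.[s] ^+ e * ev2 (blow0 h) (arc_x D p0 s) (T.[s] / D.[s])) ->
  exists2 H', H = H' * 'X^S & ((xcoef (blow0 h) S).[T.[0] / D.[0]] = 0 <-> H'.[0] = 0).
Proof.
move=> D0 hp0 hS hH; have [w hw] := xdvdP hS.
have [N [W hW]] := clear_denominators w ('X * p0) T D.
have key s : D.[s] != 0 ->
    H.[s] * D.[s] ^+ (S + N) = s ^+ S * (D ^+ e * p0 ^+ S * W).[s].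
  move=> Ds; rewrite hH // !hornerM !horner_exp -hW // hornerM hornerX hw ev2M ev2Xn ev2x.
  rewrite /arc_x exprD !exprMn exprVn; field; by rewrite expf_neq0.
have [H' -> e0] := order_of_identity D0 key; exists H' => //.
rewrite hw -[S in xcoef _ S]addn0 xcoef_xmul horner_xcoef0.
have Wz : W.[0] = ev2 w 0 (T.[0] / D.[0]) * D.[0] ^+ N.
  by rewrite -hW // hornerM hornerX !mul0r.
rewrite !hornerM !horner_exp Wz in e0.
split=> [w0|H0]; apply/eqP.
  have := expf_neq0 (S + N) D0 => DN; rewrite -(mulIr_eq0 _ (mulIf DN)) e0 w0.
  by rewrite mul0r mulr0.
move/eqP: e0; rewrite H0 mul0r eq_sym !mulf_eq0 !expf_eq0 (negbTE D0) (negbTE (hp0 _ D0)).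
by rewrite !andbF !orbF /=.
Qed.

Lemma conic_arc_order e psi B D p0 T a1 a2 G S : G \is e.-homog ->
  D.[0] != 0 -> (forall s, D.[s] != 0 -> p0.[s] != 0) ->
  (forall s, D.[s] != 0 -> maps_to psi B D s 1 (arc_x D p0 s)
     (a1 * arc_x D p0 s + a2 * arc_x D p0 s ^+ 2 + arc_x D p0 s ^+ 3 * (T.[s] / D.[s]))) ->
  xdvd (blow0 (pull (Some a2) (pull (Some a1) (dehom G \mPo psi)))) S ->
  exists2 H', restr (subst_mx B G) = H' * 'X^S &
    ((xcoef (blow0 (pull (Some a2) (pull (Some a1) (dehom G \mPo psi)))) S).[T.[0] / D.[0]] = 0
     <-> H'.[0] = 0).
Proof.
move=> hG D0 hp0 harc hS; apply: (arc_order D0 hp0 hS (e := e)) => s Ds.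
rewrite horner_restr (maps_to_ev hG (harc s Ds)); congr (_ * _).
by rewrite ev2_blow0 !ev2_pull; congr ev2; ring.
Qed.

Lemma pencil_arc_order e psi B D p0 T a1 u G S : G \is e.-homog ->
  D.[0] != 0 -> (forall s, D.[s] != 0 -> p0.[s] != 0) ->
  (forall s, D.[s] != 0 -> maps_to psi B D s (1 + u * s ^+ 2) (arc_x D p0 s)
     (a1 * arc_x D p0 s + arc_x D p0 s ^+ 2 * (T.[s] / D.[s]))) ->
  xdvd (blow0 (pull (Some a1) (dehom G \mPo psi))) S ->
  'X^S %| pev (subst_mx B G) 'X 'X^2 (1 + u *: 'X^2).
Proof.
move=> hG D0 hp0 harc hS.
suff [H' -> _] : exists2 H', pev (subst_mx B G) 'X 'X^2 (1 + u *: 'X^2) = H' * 'X^S &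
    ((xcoef (blow0 (pull (Some a1) (dehom G \mPo psi))) S).[T.[0] / D.[0]] = 0
     <-> H'.[0] = 0) by rewrite dvdp_mull.
apply: (arc_order D0 hp0 hS (e := e)) => s Ds.
rewrite horner_pev !(hornerD, hornerX, hornerXn, hornerZ, hornerC).
rewrite (maps_to_ev hG (harc s Ds)); congr (_ * _).
by rewrite ev2_blow0 ev2_pull; congr ev2; ring.
Qed.

End Orders.

(** * Reducedness bounds infinitely near multiple points *)

Section Discriminant.
Context {K : numClosedFieldType}.
Implicit Types (f g h : {mpoly K[2]}).

Local Notation x := ('X_ord0 : {mpoly K[2]}).
Local Notation y := ('X_ord_max : {mpoly K[2]}).

Definition square_free f := forall g h, f = g ^+ 2 * h -> g \is a GRing.unit.

Definition xpoly (q : {poly K}) : {mpoly K[2]} := (map_poly (@mpolyC 2 K) q).[x].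

Lemma ev2_xpoly q a b : ev2 (xpoly q) a b = q.[a].
Proof.
rewrite /xpoly horner_coef size_map_poly horner_coef /ev2 raddf_sum /=.
apply: eq_bigr => i _; rewrite coef_map /= mevalM mevalC rmorphXn /=.
by rewrite mevalXU.
Qed.

Definition of_yx (P : {poly {poly K}}) : {mpoly K[2]} := \sum_(j < size P) xpoly P`_j * y ^+ j.

Lemma ev2_of_yx P a b : ev2 (of_yx P) a b = P.[b%:P].[a].
Proof.
rewrite /of_yx (horner_coef P) horner_sum /ev2 raddf_sum /=; apply: eq_bigr => j _.
by rewrite -/(ev2 _ _ _) ev2M ev2_xpoly ev2Xn ev2y hornerM -polyC_exp hornerC.
Qed.

Lemma of_yxM P Q : of_yx (P * Q) = of_yx P * of_yx Q.
Proof. by apply: ev2_ext => a b; rewrite ev2M !ev2_of_yx !hornerM. Qed.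
Lemma of_yxD P Q : of_yx (P + Q) = of_yx P + of_yx Q.
Proof. by apply: ev2_ext => a b; rewrite ev2D !ev2_of_yx !hornerD. Qed.
Lemma of_yxC q : of_yx q%:P = xpoly q.
Proof. by apply: ev2_ext => a b; rewrite ev2_of_yx ev2_xpoly hornerC. Qed.

Lemma cf_of_yx P i j : cf (of_yx P) i j = P`_j`_i.
Proof.
rewrite /of_yx cf_sum.
have e k : cf (xpoly P`_k * y ^+ k) i j = if k == j then P`_k`_i else 0.
  rewrite /xpoly horner_coef size_map_poly mulr_suml cf_sum.
  under eq_bigr => l _ do rewrite coef_map /= -mulrA mul_mpolyC cfZ cfX.
  case: (eqVneq k j) => [_|_]; last by rewrite big1 // => l _; rewrite andbF mulr0.
  case: (ltnP i (size P`_k)) => [li|gi].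
    rewrite (bigD1 (Ordinal li)) //= eqxx mulr1 big1 ?addr0 // => l li'.
    by case: eqP => [el|]; rewrite ?mulr0 //; rewrite -val_eqE /= el eqxx in li'.
  rewrite (nth_default 0 gi) big1 // => l _; case: eqP => [el|]; rewrite ?mulr0 //.
  by have := ltn_ord l; rewrite el ltnNge gi.
under eq_bigr => k _ do rewrite e.
case: (ltnP j (size P)) => [lj|gj].
  rewrite (bigD1 (Ordinal lj)) //= eqxx big1 ?addr0 // => k kj.
  by case: eqP => // ek; case/eqP: kj; apply: val_inj.
rewrite (nth_default _ gj) coef0 big1 // => k _.
by case: eqP => // ek; have := ltn_ord k; rewrite ek ltnNge gj.
Qed.

Lemma of_yx_inj P Q : of_yx P = of_yx Q -> P = Q.
Proof. by move=> e; apply/polyP => j; apply/polyP => i; rewrite -!cf_of_yx e. Qed.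

Definition to_yx f : {poly {poly K}} := \poly_(j < msize f) \poly_(i < msize f) cf f i j.

Lemma coef_to_yx f i j : (to_yx f)`_j`_i = cf f i j.
Proof.
have z : ~~ ((i < msize f) && (j < msize f))%N -> cf f i j = 0.
  by move=> h; apply/eqP; apply: contraNT h => /cf_bound h; apply/andP; split; lia.
rewrite coef_poly; case: ifP => hj; last by rewrite coef0 z // hj andbF.
by rewrite coef_poly; case: ifP => hi //; rewrite z // hi.
Qed.

Lemma to_yxK f : of_yx (to_yx f) = f.
Proof. by apply: cf_ext => i j; rewrite cf_of_yx coef_to_yx. Qed.

Lemma cf_deriv_y f i j : cf (f^`M(ord_max)) i j = cf f i j.+1 *+ j.+1.
Proof.
rewrite /cf mcoeff_mderiv mn2_1; congr (_@__ *+ _); apply/mnmP => k.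
by rewrite !mnmDE !mulmnE !mnm1E; case: (ord2P k) => -> /=; lia.
Qed.

Lemma cf_deriv_x f i j : cf (f^`M(ord0)) i j = cf f i.+1 j *+ i.+1.
Proof.
rewrite /cf mcoeff_mderiv mn2_0; congr (_@__ *+ _); apply/mnmP => k.
by rewrite !mnmDE !mulmnE !mnm1E; case: (ord2P k) => -> /=; lia.
Qed.

Lemma of_yx_deriv P : of_yx P^`() = (of_yx P)^`M(ord_max).
Proof.
by apply: cf_ext => i j; rewrite cf_deriv_y !cf_of_yx coef_deriv coefMn.
Qed.

Lemma of_yx_unit P : of_yx P \is a GRing.unit -> (size P <= 1)%N.
Proof.
move=> /andP[/eqP e _]; move: e; set c := _@_0 => e.
have : of_yx P = of_yx c%:P%:P.
  by rewrite e; apply: ev2_ext => a b; rewrite ev2C of_yxC ev2_xpoly hornerC.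
by move/of_yx_inj ->; exact: size_polyC_leq1.
Qed.

Lemma factor_theorem_coefs (P : {poly {poly K}}) a :
  map_poly (horner_eval a) P = 0 -> exists P', P = ('X - a%:P) *: P'.
Proof.
move=> h; exists (map_poly (fun q => q %/ ('X - a%:P)) P).
apply/polyP => j; rewrite coefZ coef_map_id0 ?div0p // mulrC divpK //.
rewrite dvdp_XsubCl /root; have := congr1 (fun Q : {poly K} => Q`_j) h.
by rewrite coef0 coef_map /= /horner_eval => ->.
Qed.

(** Gauss's lemma for a square factor: over an algebraically closed field, the
    content can be removed one linear factor at a time. *)
Lemma square_factor_descent (P G H : {poly {poly K}}) (c : {poly K}) : c != 0 ->
  (1 < size G)%N -> c *: P = G ^+ 2 * H -> ~ square_free (of_yx P).
Proof.
have [n] := ubnP (size c); elim: n c G H => // n IHn c G H sc cn0 sG e sf.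
have [/size1_polyC ec|c1] := leqP (size c) 1.
  move: (c`_0) ec cn0 e => k ->; rewrite polyC_eq0 => k0 e.
  have := sf (of_yx G) (of_yx (k^-1%:P *: H)).
  rewrite expr2 -!of_yxM -expr2 -scalerAr -e scalerA -polyCM mulVf // polyC1 scale1r.
  by move=> /(_ erefl) /of_yx_unit; rewrite leqNgt sG.
have [a ra] : exists a, root c a by apply/closed_rootP; rewrite eq_sym neq_ltn c1.
have := congr1 (map_poly (horner_eval a)) e.
case/factor_theorem: ra => c' ec.
have c'n0 : c' != 0 by apply: contraNneq cn0 => c0; rewrite ec c0 mul0r.
have sc' : (size c' < n)%N.
  by move: sc; rewrite ec size_Mmonic ?monicXsubC // size_XsubC addn2 /=.
have lin0 : 'X - a%:P != 0 :> {poly K} by rewrite polyXsubC_eq0.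
have cancel (A B : {poly {poly K}}) : ('X - a%:P) *: A = ('X - a%:P) *: B -> A = B.
  by rewrite -!mul_polyC; apply: mulfI; rewrite polyC_eq0.
rewrite rmorphM rmorphXn /= -mul_polyC rmorphM /= map_polyC /= {1}/horner_eval ec.
rewrite hornerM hornerXsubC subrr mulr0 polyC0 mul0r => /esym/eqP.
rewrite mulf_eq0 expf_eq0 /= => /orP[/eqP|/eqP] /factor_theorem_coefs[Q eQ].
  apply: (IHn c' Q (('X - a%:P) *: H)) sf => //.
    by rewrite -(size_scale _ lin0) -eQ.
  apply: cancel; rewrite scalerA mulrC -ec e eQ exprZn -!scalerAl -!scalerAr.
  by rewrite !scalerA expr2.
apply: (IHn c' G Q) sf => //.
by apply: cancel; rewrite scalerA mulrC -ec e eQ -!scalerAr.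
Qed.

Lemma separable_of_square_free (P : {poly {poly K}}) : (1 < size P)%N -> square_free (of_yx P) -> separable_poly P.
Proof.
move=> sP sf; apply/separable_polyP; split; last first.
  move=> u _ su; apply/eqP => /(congr1 (fun Q : {poly {poly K}} => Q`_(size u).-2)).
  rewrite coef0 coef_deriv; case sE: (size u) su => [|[|n]] //= _ /eqP.
  rewrite -mulr_natr mulf_eq0 -polyC_natr polyC_eq0 pnatr_eq0 orbF.
  have : lead_coef u != 0 by rewrite lead_coef_eq0 -size_poly_eq0 sE.
  by rewrite lead_coefE sE /= => /negbTE ->.
apply/poly_square_freeP => u su; apply/negP => /Pdiv.Idomain.dvdpP[[c Q] /= cn0 e].
have Pn0 : P != 0 by rewrite -size_poly_eq0; case: (size P) sP.
have su1 : (1 < size u)%N.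
  rewrite ltn_neqAle eq_sym su lt0n size_poly_eq0; apply/eqP => u0.
  have /eqP := e; rewrite u0 expr0n /= mulr0 -mul_polyC mulf_eq0 polyC_eq0 (negbTE Pn0) orbF.
  by rewrite (negbTE cn0).
by apply: (square_factor_descent cn0 su1 _ sf); rewrite e mulrC.
Qed.

Lemma size_det n (M : 'M[{poly K}]_n) D : (forall i j, (size (M i j) <= D.+1)%N) ->
  (size (\det M) <= (n * D).+1)%N.
Proof.
move=> h; rewrite /determinant; apply: leq_trans (size_sum _ _ _) _.
apply/bigmax_leqP => s _; rewrite mulr_sign.
suff : (size (\prod_i M i (s i))%R <= (n * D).+1)%N by case: ifP; rewrite ?size_polyN.
apply: leq_trans (size_poly_prod_leq _ _) _; rewrite (_ : #|_| = n); last by rewrite cardT size_enum_ord.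
have : (\sum_(i < n) size (M i (s i)) <= n * D.+1)%N.
  rewrite -[n in (_ <= n * _)%N]card_ord -sum_nat_const.
  by apply: leq_sum => i _; exact: h.
by rewrite mulnS leq_subLR addnS ltnS.
Qed.

(** The resultant of [f] and its derivative with respect to [y] is nonzero, as [f]
    is separable over [K(x)]; the Sylvester matrix bounds its degree.  Resultants
    need positive degrees in [y], so degrees at most one are treated apart. *)
Lemma discriminant_ideal d f : f != 0 -> square_free f -> (0 < d)%N ->
  (forall i j, cf f i j != 0 -> (i + j <= d)%N) ->
  exists (R : {poly K}) (A B : {mpoly K[2]}),
    [/\ R != 0, (size R <= (2 * d ^ 2).+1)%N & xpoly R = A * f + B * f^`M(ord_max)].
Proof.
move=> fn0 sf d0 hd; set P := to_yx f.
have fE : of_yx P = f := to_yxK f.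
have Pn0 : P != 0.
  by apply: contraNneq fn0 => P0; rewrite -fE P0; apply/eqP/cf_ext => i j; rewrite cf_of_yx !coef0 /cf mcoeff0.
have sPj j : (size (P`_j)%R <= d.+1)%N.
  apply/leq_sizeP => i di; rewrite coef_to_yx; apply/eqP.
  by apply: contraTT di => /hd; rewrite -ltnNge; lia.
have sP : (size P <= d.+1)%N.
  apply/leq_sizeP => j dj; apply/polyP => i; rewrite coef_to_yx coef0; apply/eqP.
  by apply: contraTT dj => /hd; rewrite -ltnNge; lia.
have d2 : (d.+1 <= (2 * d ^ 2).+1)%N by rewrite ltnS; nia.
have [P1|P1] := leqP (size P) 1.
  exists P`_0, 1, 0; split; rewrite ?mul1r ?mul0r ?addr0.
  - by apply: contraNneq Pn0 => P0; rewrite (size1_polyC P1) P0 polyC0.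
  - exact: leq_trans (sPj 0%N) d2.
  - by rewrite -of_yxC -size1_polyC.
have sep := separable_of_square_free P1 (_ : square_free (of_yx P)).
rewrite fE in sep; move: (sep sf); rewrite unlock => {sep} sep.
have sP' : size (P^`())%R = (size P).-1.
  have lP : lead_coef P != 0 by rewrite lead_coef_eq0.
  apply/eqP; rewrite eqn_leq; apply/andP; split; first by rewrite -ltnS prednK ?lt_size_deriv // ltnW.
  case e: (size P) P1 lP => [|[|n]] // _; rewrite lead_coefE e /= => lP.
  rewrite leqNgt; apply/negP => /leq_sizeP /(_ n (leqnn _)); rewrite coef_deriv => /eqP.
  by rewrite -mulr_natr mulf_eq0 (negbTE lP) -polyC_natr polyC_eq0 pnatr_eq0.
have sP'j j : (size ((P^`())`_j)%R <= d.+1)%N.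
  by rewrite coef_deriv -scaler_nat; apply: leq_trans (size_scale_leq _ _) (sPj _).
have [P2|P2] := leqP (size P) 2.
  have P'1 : (size (P^`())%R <= 1)%N by rewrite sP'; case: (size P) P2 => [|[|[]]].
  have P'n0 : P^`() != 0 by rewrite -size_poly_eq0 sP'; case: (size P) P1 => [|[]].
  exists (P^`())`_0, 0, 1; split; rewrite ?mul1r ?mul0r ?add0r.
  - by apply: contraNneq P'n0 => P0; rewrite (size1_polyC P'1) P0 polyC0.
  - exact: leq_trans (sP'j 0%N) d2.
  - by rewrite -of_yxC -size1_polyC // of_yx_deriv fE.
have P'1 : (1 < size (P^`())%R)%N by rewrite sP'; case: (size P) P2 => [|[|[]]].
have [[U V] /= [_ _ eUV]] := resultant_in_ideal P1 P'1.
exists (resultant P P^`()), (of_yx U), (of_yx V); split.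
- by rewrite resultant_eq0 -leqNgt; move: sep; rewrite /separable_poly /coprimep => /eqP ->.
- apply: leq_trans (size_det (D := d) _) _.
    move=> i j; rewrite Sylvester_mxE; case: split => k; rewrite -scaler_nat;
      apply: leq_trans (size_scale_leq _ _) _; [exact: sPj|exact: sP'j].
  rewrite ltnS sP'; move: sP P2; move: (size P) => m; nia.
- by rewrite -of_yxC eUV of_yxD !of_yxM of_yx_deriv fE.
Qed.

End Discriminant.

(** * Jacobians and reducedness of the affine equation *)

Section Jacobian.
Context {K : numClosedFieldType}.
Implicit Types (f g h : {mpoly K[2]}) (F G : {mpoly K[3]}).

Local Notation x := ('X_ord0 : {mpoly K[2]}).
Local Notation y := ('X_ord_max : {mpoly K[2]}).

Lemma mpoly_alg_ind n (P : {mpoly K[n]} -> Prop) :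
  (forall c, P c%:MP) -> (forall i, P 'X_i) ->
  (forall p q, P p -> P q -> P (p + q)) -> (forall p q, P p -> P q -> P (p * q)) ->
  forall p, P p.
Proof.
move=> hC hX hD hM; elim/mpolyind => [|c m p _ _ hp]; first by rewrite -mpolyC0.
apply: (hD) => //; rewrite -mul_mpolyC; apply: (hM) => //; rewrite mpolyXE_id.
elim/big_ind: _ => [||i _]; [by rewrite -mpolyC1|exact: (hM)|].
by elim: (m i) => [|k IH]; rewrite ?expr0 -?mpolyC1 // exprS; apply: (hM).
Qed.

Lemma deriv_X n (i j : 'I_n) : ('X_i : {mpoly K[n]})^`M(j) = (i == j)%:R.
Proof.
rewrite mderivX mnm1E; case: eqP => [->|_]; last by rewrite scale0r.
rewrite scale1r (_ : (U_(j) - U_(j))%MM = 0%MM) ?mpolyX0 //.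
by apply/mnmP => k; rewrite mnmBE mnm0E subnn.
Qed.

Lemma chain_rule n k (p : {mpoly K[n]}) (t : n.-tuple {mpoly K[k]}) j :
  (p \mPo t)^`M(j) = \sum_(i < n) (p^`M(i) \mPo t) * (tnth t i)^`M(j).
Proof.
elim/mpoly_alg_ind: p => [c|l|p q hp hq|p q hp hq].
- rewrite comp_mpolyC mderivC big1 // => i _.
  by rewrite mderivC comp_mpoly0 mul0r.
- rewrite comp_mpolyXU -tnth_nth (bigD1 l) //= big1 => [|i il].
    by rewrite deriv_X eqxx comp_mpoly1 mul1r addr0.
  by rewrite deriv_X eq_sym (negbTE il) comp_mpoly0 mul0r.
- rewrite comp_mpolyD mderivD hp hq -big_split; apply: eq_bigr => i _ /=.
  by rewrite mderivD comp_mpolyD mulrDl.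
- rewrite rmorphM /= mderivM hp hq mulr_suml mulr_sumr -big_split.
  apply: eq_bigr => i _ /=; rewrite mderivM rmorphD !rmorphM /=; ring.
Qed.

Lemma big_ord2 (R : Type) (idx : R) (op : Monoid.law idx) (F : 'I_2 -> R) :
  \big[op/idx]_i F i = op (F ord0) (F ord_max).
Proof.
rewrite !big_ord_recl big_ord0 Monoid.mulm1.
by congr (op (F _) (F _)); apply: val_inj.
Qed.

Lemma jacobianE (phi : plane_map) : jacobian_det phi =
  (tnth phi ord0)^`M(ord0) * (tnth phi ord_max)^`M(ord_max)
  - (tnth phi ord0)^`M(ord_max) * (tnth phi ord_max)^`M(ord0) :> {mpoly K[2]}.
Proof.
rewrite /jacobian_det (expand_det_row _ ord0) big_ord2 /=.
rewrite /cofactor !det_mx11 !mxE /= expr0 mul1r expr1 mulN1r mulrN.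
have e1 : lift (ord0 : 'I_2) 0 = ord_max by apply: val_inj.
have e2 : lift (ord_max : 'I_2) 0 = ord0 by apply: val_inj.
by rewrite e1 e2.
Qed.

Lemma tnth_comp_map (phi eta : plane_map) i : tnth (comp_map phi eta) i = tnth phi i \mPo eta :> {mpoly K[2]}.
Proof. by rewrite tnth_mktuple. Qed.

Lemma comp_comp_map f (phi eta : plane_map) : f \mPo comp_map phi eta = (f \mPo phi) \mPo eta.
Proof.
apply: mpoly_ext => v; rewrite !comp_mpoly_meval; apply: meval_eq => i.
by rewrite tnth_comp_map comp_mpoly_meval.
Qed.

Lemma jacobian_comp (phi eta : plane_map) :
  jacobian_det (comp_map phi eta) = (jacobian_det phi \mPo eta) * jacobian_det eta :> {mpoly K[2]}.
Proof.
rewrite !jacobianE !tnth_comp_map !chain_rule !big_ord2 /= rmorphB !rmorphM /=; ring.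
Qed.

Lemma jacobian_finite c : jacobian_det (chart (Some c)) = x :> {mpoly K[2]}.
Proof.
rewrite jacobianE /chart !(tnth_nth 0) /= !mderivM !mderivD !mderivC !deriv_X /=.
by rewrite !(mulr0, mul0r, addr0, mulr1, mul1r, add0r, subr0).
Qed.

Lemma jacobian_infinity : jacobian_det (chart None) = y :> {mpoly K[2]}.
Proof.
rewrite jacobianE /chart !(tnth_nth 0) /= !mderivM !deriv_X /=.
by rewrite !(mulr0, mul0r, addr0, mulr1, mul1r, add0r, subr0).
Qed.

Lemma xdvd_deriv_y h a : xdvd h a -> xdvd (h^`M(ord_max)) a.
Proof.
move=> ha i j; rewrite cf_deriv_y => hij; apply: (ha i j.+1).
by apply: contraNneq hij => ->; rewrite mul0rn.
Qed.

Lemma xdvd_deriv_x h a : xdvd h a -> xdvd (h^`M(ord0)) a.-1.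
Proof.
move=> ha i j; rewrite cf_deriv_x => hij.
have : (a <= i.+1)%N by apply: (ha _ j); apply: contraNneq hij => ->; rewrite mul0rn.
by case: a {ha}.
Qed.

Lemma xdvdM f g a b : xdvd f a -> xdvd g b -> xdvd (f * g) (a + b).
Proof. by move=> hf hg; case: (xcoef_mul hf hg). Qed.

Lemma xdvdMl f g b : xdvd g b -> xdvd (f * g) b.
Proof. by move=> hg; rewrite -[b]add0n; apply: xdvdM => // i j. Qed.

Lemma xdvdD f g a : xdvd f a -> xdvd g a -> xdvd (f + g) a.
Proof.
move=> hf hg i j; case: (leqP a i) => // ia; rewrite cfD.
have z h : xdvd h a -> cf h i j = 0.
  by move=> hh; apply/eqP; apply: contraTT ia => /hh; rewrite -leqNgt.
by rewrite !z // addr0 eqxx.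
Qed.

Lemma xdvdN f a : xdvd f a -> xdvd (- f) a.
Proof. by move=> hf i j; rewrite /cf mcoeffN oppr_eq0; exact: hf. Qed.

Lemma xcoef_unit u a : ev2 u 0 0 != 0 -> xcoef (x ^+ a * u) a != 0.
Proof.
move=> h; rewrite -{2}(addn0 a) xcoef_xmul; apply: contraNneq h => e.
by rewrite -horner_xcoef0 e horner0.
Qed.

Definition homogenize e g : {mpoly K[3]} :=
  \sum_(m <- msupp g) g@_m *: 'X_[mn3 (m ord0) (m ord_max) (e - (m ord0 + m ord_max))].

Lemma homogenize_homog e g : (msize g <= e.+1)%N -> homogenize e g \is e.-homog.
Proof.
move=> he; rewrite /homogenize big_seq; apply: rpred_sum => m hm; apply: rpredZ.
rewrite dhomogX /= mdeg_mn3 subnKC // -ltnS; apply: leq_trans he.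
by have := msize_mdeg_lt hm; rewrite mdegE big_ord2.
Qed.

Lemma dehom_homogenize e g : dehom (homogenize e g) = g.
Proof.
rewrite /dehom /homogenize raddf_sum /= [RHS]mpolyE; apply: eq_bigr => m _.
rewrite comp_mpolyZ comp_mpolyX big_ord3 !(tnth_nth 0) !inordK //= expr1n mulr1.
have [-> -> _] := mn3_val (m ord0) (m ord_max) (e - (m ord0 + m ord_max)).
by rewrite -mpolyX_mn2 -mn2E.
Qed.

Lemma msize_dehom d F : F \is d.-homog -> (msize (dehom F) <= d.+1)%N.
Proof.
move=> hF; rewrite msizeE; apply/bigmax_leqP_seq => m hm _; rewrite ltnS (mn2E m) mdeg_mn2.
by apply: (cf_dehom_deg hF); rewrite /cf -mn2E -mcoeff_msupp.
Qed.

Lemma dehom_inj d F G : F \is d.-homog -> G \is d.-homog -> dehom F = dehom G -> F = G.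
Proof.
move=> hF hG e; apply/eqP; rewrite -subr_eq0; apply/eqP/(@dehom_eq0 _ d).
  by apply: rpredB.
by rewrite /dehom comp_mpolyB -/(dehom F) -/(dehom G) e subrr.
Qed.

(** A square factor of the affine equation can be homogenized. *)
Lemma reduced_square_free d F : F \is d.-homog -> reduced F -> square_free (dehom F).
Proof.
move=> hF [Fn0 hr] g h e.
have fn0 : dehom F != 0 by apply: contraNneq Fn0 => f0; rewrite (dehom_eq0 hF f0).
have gn0 : g != 0 by apply: contraNneq fn0 => g0; rewrite e g0 expr0n mul0r.
have hn0 : h != 0 by apply: contraNneq fn0 => h0; rewrite e h0 mulr0.
set a := (msize g).-1; set b := (msize h).-1.
have sg : msize g = a.+1 by exact: mpolySpred.
have sh : msize h = b.+1 by exact: mpolySpred.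
have sz : (2 * a + b <= d)%N.
  have := msize_dehom hF; rewrite e expr2 !msizeM ?mulf_neq0 // sg sh; lia.
have hg := homogenize_homog (_ : (msize g <= a.+1)%N); rewrite sg leqnn in hg.
have hh := homogenize_homog (_ : (msize h <= b.+1)%N); rewrite sh leqnn in hh.
pose H := homogenize b h * 'X_(inord 2) ^+ (d - (2 * a + b)).
have hH : H \is (d - 2 * a).-homog.
  have -> : (d - 2 * a)%N = (b + (d - (2 * a + b)))%N by lia.
  apply: dhomogM; first exact: hh.
  by rewrite mpolyXn dhomogX /= mdegMn mdeg1 mul1n.
have FE : F = homogenize a g ^+ 2 * H.
  apply: (dehom_inj hF).
    have -> : d = (a * 2 + (d - 2 * a))%N by lia.
    by apply: dhomogM => //; apply: dhomogMn; exact: hg.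
  have eX k : dehom ('X_(inord 2) ^+ k) = 1.
    by apply: ev2_ext => s t; rewrite ev2_dehom !ev3E expr1n /ev2 meval1.
  by rewrite /H expr2 !dehomM eX !dehom_homogenize e -expr2 mulr1.
by rewrite -(dehom_homogenize a g); apply: rmorph_unit; exact: hr FE.
Qed.

(** By the chain rule and Cramer's rule, the [y]-derivative of [f] also vanishes to
    high order on the exceptional curve, hence so does the discriminant.  But the
    latter is a polynomial in the first coordinate, whose order is at most [2]. *)
Lemma tower_bound d f (phi : plane_map) u v (M e : nat) :
  f != 0 -> square_free f -> (0 < d)%N -> (forall i j, cf f i j != 0 -> (i + j <= d)%N) ->
  jacobian_det phi = x ^+ M * u -> ev2 u 0 0 != 0 ->
  tnth phi ord0 = x ^+ e * v -> ev2 v 0 0 != 0 -> (0 < e <= 2)%N ->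
  xdvd (f \mPo phi) (2 * M) -> (M <= (4 * d ^ 2).+1)%N.
Proof.
move=> fn0 sf d0 hd hJ u0 hX v0 /andP[e0 e2] hf.
have [R [A [B [Rn0 sR RE]]]] := discriminant_ideal fn0 sf d0 hd.
have fy : xdvd (f^`M(ord_max) \mPo phi) M.-1.
  have cramer : (f^`M(ord_max) \mPo phi) * jacobian_det phi =
      (tnth phi ord0)^`M(ord0) * (f \mPo phi)^`M(ord_max)
      - (tnth phi ord0)^`M(ord_max) * (f \mPo phi)^`M(ord0).
    rewrite jacobianE !chain_rule !big_ord2 /=; ring.
  case: (posnP M) => [->|M0]; first by move=> i j.
  apply: (@xdvd_cancel _ (x ^+ M * u) _ M).
  - rewrite -hJ mulrC cramer; apply: xdvdD.
      by apply: xdvdMl; apply: xdvd_weaken (xdvd_deriv_y hf); lia.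
    by apply: xdvdN; apply: xdvdMl; apply: xdvd_weaken (xdvd_deriv_x hf); lia.
  - exact: xdvd_xmul.
  - exact: xcoef_unit.
have hR : xdvd (xpoly R \mPo phi) M.-1.
  rewrite RE comp_mpolyD !rmorphM /=; apply: xdvdD; apply: xdvdMl => //.
  by apply: xdvd_weaken hf; lia.
have [k [R1 r1 eR]] := multiplicity_XsubC R 0; rewrite Rn0 /= in r1.
have RE' : xpoly R \mPo phi = x ^+ (e * k) * (v ^+ k * (xpoly R1 \mPo phi)).
  apply: ev2_ext => a b.
  rewrite {1}(plane_mapE phi) ev2_comp ev2_xpoly eR subr0 hornerM hornerXn.
  rewrite hX !ev2M !ev2Xn ev2x (plane_mapE phi) ev2_comp ev2_xpoly hX ev2M ev2Xn ev2x.
  by rewrite exprMn exprM; ring.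
have w0 : ev2 (v ^+ k * (xpoly R1 \mPo phi)) 0 0 != 0.
  rewrite ev2M ev2Xn mulf_neq0 ?expf_neq0 //.
  rewrite (plane_mapE phi) ev2_comp ev2_xpoly hX ev2M ev2Xn ev2x expr0n.
  by rewrite (negbTE (_ : e != 0%N)) ?mul0r // -lt0n.
have /xcoef_neq0_ex[j] := xcoef_unit (e * k) w0.
rewrite -RE' => /hR hMk.
have kR : (k <= 2 * d ^ 2)%N.
  rewrite -ltnS; apply: leq_trans sR; rewrite eR size_Mmonic ?monic_exp ?monicXsubC //.
    rewrite size_exp_XsubC addnS /= -[X in (X < _)%N]add0n ltn_add2r size_poly_gt0.
    by apply: contraNneq r1 => ->; rewrite root0.
  by apply: contraNneq r1 => ->; rewrite root0.
have : (e * k <= 2 * (2 * d ^ 2))%N by apply: leq_mul.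
by move: hMk; lia.
Qed.

End Jacobian.

(** * The contact of the curve with conics *)

Section ConicStage.
Context {K : numClosedFieldType}.
Implicit Types (f g h : {mpoly K[2]}) (F G : {mpoly K[3]}).

Local Notation x := ('X_ord0 : {mpoly K[2]}).
Local Notation y := ('X_ord_max : {mpoly K[2]}).

(** A chart [psi] of a second infinitely near point that lies neither on the
    tangent line nor on the first exceptional curve.  Conics through this point
    and its two successors are arcs [y = a1 * x + a2 * x ^+ 2 + ...] in it. *)
Definition conic_arcs (psi : plane_map) : Prop :=
  forall a1 a2 : K, exists (B : 'M[K]_3) (D p0 T : {poly K}),
  [/\ B \in unitmx, D.[0] != 0, (forall s, D.[s] != 0 -> p0.[s] != 0),
      (forall s, D.[s] != 0 -> maps_to psi B D s 1 (arc_x D p0 s)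
         (a1 * arc_x D p0 s + a2 * arc_x D p0 s ^+ 2
          + arc_x D p0 s ^+ 3 * (T.[s] / D.[s])))
    & exists (k : K) (r : {mpoly K[2]}), k != 0 /\
      pull (Some a2) (pull (Some a1) (dehom (subst_mx (invmx B) conic) \mPo psi))
      = x ^+ 4 * (k%:MP * y + x * r)].

(** The arcs of the conics [b * c = a ^+ 2 + u * b ^+ 2], which all have fourfold
    contact at the point [s = 0], in the coordinates [B]. *)
Definition pencil_arcs (psi : plane_map) : Prop :=
  forall a1 : K, exists2 B : 'M[K]_3, B \in unitmx & forall u, exists (D p0 T : {poly K}),
  [/\ D.[0] != 0, (forall s, D.[s] != 0 -> p0.[s] != 0)
    & (forall s, D.[s] != 0 -> maps_to psi B D s (1 + u * s ^+ 2) (arc_x D p0 s)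
     (a1 * arc_x D p0 s + arc_x D p0 s ^+ 2 * (T.[s] / D.[s])))].

(** The [M]-th point of a tower of free points: the exceptional curve is [x = 0], and
    the first coordinate has order at most two along it, as [tower_bound] needs. *)
Definition tower_chart (phi : plane_map) (M : nat) : Prop :=
  exists (u v : {mpoly K[2]}) e,
  [/\ jacobian_det phi = x ^+ M * u, ev2 u 0 0 != 0, tnth phi ord0 = x ^+ e * v,
      ev2 v 0 0 != 0 & (0 < e <= 2)%N].

Lemma tower_chart_next phi M c : tower_chart phi M ->
  tower_chart (comp_map phi (chart (Some c))) M.+1.
Proof.
move=> [u [v [e [hJ u0 hX v0 he]]]].
exists (pull (Some c) u), (pull (Some c) v), e; split=> //.
- rewrite jacobian_comp jacobian_finite hJ -!/(pull _ _).
  by apply: ev2_ext => a b; rewrite !(ev2M, ev2_pull, ev2Xn, ev2x) exprSr; ring.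
- by rewrite ev2_pull mul0r.
- by rewrite tnth_comp_map hX -/(pull _ _); apply: ev2_ext => a b;
    rewrite !(ev2M, ev2_pull, ev2Xn, ev2x).
- by rewrite ev2_pull mul0r.
Qed.

Lemma good_step lam f p q : disc_ok lam f p q ->
  (forall o n, good lam n (pull o f) (nextx o p q) (nexty o p q)) ->
  forall n, good lam n f p q.
Proof. by move=> hd ho [|n]; split => //. Qed.

Lemma nexty0 (o : option K) p : nexty o p 0 = if o is Some _ then 0%N else p.+1.
Proof. by case: o => [c|] /=; [case: ifP|rewrite addn0]. Qed.

(** The multiplicity [m] of the strict transform is at most its intersection number
    [k] with the exceptional curve, and bounds its intersection number [k'] with
    the next one. *)
Lemma free_point h a k c : xdvd h a -> cf h a k != 0 ->
  exists m k', [/\ (m <= k)%N, (k' <= m)%N,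
    xdvd (blow0 h) (a + m),
    (exists i j, cf h i j != 0 /\ (i + j = a + m)%N) &
    [/\ xdvd (pull (Some c) h) (a + m), cf (pull (Some c) h) (a + m) k' != 0
     & (forall j, (j < k')%N -> cf (pull (Some c) h) (a + m) j = 0)]].
Proof.
move=> ha hk.
have hn0 : h != 0 by apply: contraNneq hk => ->; rewrite /cf mcoeff0.
have [i0 [j0 [h0 hmin]]] := supp_min (fun i j => i + j)%N hn0.
have ai := ha _ _ h0; have hm := hmin _ _ hk.
have em : (a + (i0 + j0 - a) = i0 + j0)%N by lia.
have hj i j : cf h i j != 0 -> (i + j = i0 + j0)%N -> (0 <= j <= i0 + j0 - a)%N.
  by move=> hij e; have := ha _ _ hij; lia.
have [k' hk' [h1 h2]] := pull_free h0 erefl hj (or_intror erefl : c != 0 \/ 0%N = 0%N).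
have hb : xdvd (blow0 h) (i0 + j0) by apply/xdvd_blow0.
exists (i0 + j0 - a)%N, k'; rewrite em.
split; [lia|lia|exact: hb|by exists i0, j0|].
by split; [exact: (xdvd_pull hb)|exact: h1|exact: h2].
Qed.

(* The constant [100] outweighs the length [4 * d ^ 2 + 1] of the towers of
   points of multiplicity [2 * d / 5]. *)
Variables (d : nat) (eps lam : rat).
Hypotheses (d3 : (3 <= d)%N) (eps0 : 0 <= eps) (epsd : eps * (100 * d ^ 2)%:R <= 1).
Hypothesis lamE : lam = (5 + eps) / (2 * d%:R).

Let dq : rat := d%:R.

Lemma dq3 : 3 <= dq. Proof. by rewrite ler_nat. Qed.

Lemma lam_d : lam * dq = (5 + eps) / 2.
Proof. have := dq3; rewrite lamE -/dq => h; field; lra. Qed.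

Lemma eps_dd : eps * dq * dq <= 1 / 100.
Proof. move: epsd; rewrite natrM natrX -/dq expr2; lra. Qed.

Lemma eps_d : 0 <= eps * dq <= 1 / 300.
Proof.
have h := dq3; have e := eps_dd; apply/andP; split; first by apply: mulr_ge0 => //; lra.
have : 0 <= eps * dq by apply: mulr_ge0 => //; lra.
nra.
Qed.

Lemma eps_small : eps <= 1 / 900.
Proof. have h := dq3; have /andP[e1 e2] := eps_d; nra. Qed.

Lemma lam_gt0 : 0 < lam.
Proof. have := lam_d; have := dq3; have := eps0; nra. Qed.

Lemma lam_le1 : lam <= 5 / 6 + eps / 6.
Proof. have := lam_d; have := dq3; have := eps0; have := lam_gt0; nra. Qed.

Lemma lam_eps : dq^-1 <= lam - eps.
Proof.
have h := dq3; have /andP[e1 e2] := eps_d; have l := lam_d; have e3 := eps_small; have e4 := eps0.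
rewrite -div1r ler_pdivrMr; last lra.
by rewrite mulrBl l; lra.
Qed.

Lemma inv_d : 0 < dq^-1 /\ 100 * eps <= dq^-1.
Proof.
have h := dq3; have e := eps_dd; have /andP[e1 e2] := eps_d.
have d0 : 0 < dq by lra.
split; first by rewrite invr_gt0.
by rewrite -div1r (ler_pdivlMr _ _ d0); lra.
Qed.

Lemma lam_le (a b n : nat) : (a * n <= b * d)%N ->
  a%:R * (lam * n%:R) <= b%:R * ((5 + eps) / 2).
Proof.
move=> h; rewrite -lam_d mulrCA -natrM [b%:R * _]mulrCA /dq -natrM.
by rewrite ler_pM2l ?lam_gt0 // ler_nat.
Qed.

(** Points of multiplicity [l = 2 * d / 5]: since [lam * l = 1 + eps / 5], each of
    them lowers the discrepancy by [eps / 5] only, and [tower_bound] bounds their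
    number. *)
Lemma equimultiple_tower_good f l : f != 0 -> square_free f ->
  (forall i j, cf f i j != 0 -> (i + j <= d)%N) -> (5 * l = 2 * d)%N ->
  forall n phi M k, tower_chart phi M -> xdvd (f \mPo phi) (M * l) ->
  cf (f \mPo phi) (M * l) k != 0 -> (k <= l)%N -> good lam n (f \mPo phi) M 0.
Proof.
move=> fn0 sf hd hl.
have ll : lam * l%:R = 1 + eps / 5.
  have : 5%:R * l%:R = 2%:R * dq by rewrite /dq -!natrM hl.
  move=> e; have := lam_d; have -> : (l%:R : rat) = 2 / 5 * dq by lra.
  by move=> e2; rewrite mulrCA e2; field.
elim=> [|n IHn] phi M k hphi hM hk kl; set h := f \mPo phi.
all: have [u [v [e [hJ u0 hX v0 he]]]] := hphi.
all: have Mb : (M <= (4 * d ^ 2).+1)%N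
  by apply: (tower_bound fn0 sf (ltnW (ltnW d3)) hd hJ u0 hX v0 he);
     apply: xdvd_weaken hM; rewrite mulnC leq_mul2l; apply/orP; right; lia.
all: have Meps : M%:R * eps + eps <= 1 / 5
  by (have : (M%:R : rat) <= (4 * d ^ 2).+1%:R by rewrite ler_nat);
     rewrite -addn1 natrD natrM natrX -/dq => Mr;
     (have := ler_wpM2r eps0 Mr); have := eps_dd; have := eps_small; rewrite expr2; lra.
all: have lamMl : lam * (M * l)%:R = M%:R + M%:R * eps / 5
  by rewrite natrM mulrCA ll; field.
all: have M0 : 0 <= (M%:R : rat) by [].
all: have lk : lam * k%:R <= 1 + eps / 5 by rewrite -ll lam_mono // ltW // lam_gt0.
all: have hdisc : disc_ok lam h M 0
  by exists (M * l)%N, k; split => //; rewrite addn0 natrD mulrDr lamMl natrD; lra.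
  by split.
split=> // o; rewrite nexty0; case: o => [c|] /=; last first.
  rewrite ?addn0; apply: (@satellite_good _ lam (ltW lam_gt0) n h (M * l)%N k _ _ hM hk).
    by have := eps_small; lra.
  apply: (@newton_box _ lam (blow_oo h) M M.+1 (M * l)%N (M * l + k)%N).
  - exact: cf_blow_oo_nz.
  - by rewrite lamMl -(addn1 M) natrD; move: Meps eps0; lra.
  - by rewrite natrD mulrDr lamMl -(addn2 M) natrD; move: Meps eps0 lk; lra.
have [m [k' [mk km hb _ [h1 h2 _]]]] := free_point c hM hk.
have lw : lam * (M * l + m)%:R <= (M + 0).+2%:R.
  rewrite natrD mulrDr lamMl addn0 -(addn2 M) natrD.
  have : lam * m%:R <= 1 + eps / 5 by rewrite -ll lam_mono ?(ltW lam_gt0) //; apply: leq_trans kl.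
  by move: Meps eps0; lra.
case: (ltngtP m l) => [ml|lm|ml]; last 2 first.
- by have := leq_trans mk kl; rewrite leqNgt lm.
- rewrite addn0; have e1 : (M.+1 * l = M * l + m)%N by rewrite ml mulSn addnC.
  have e2 : f \mPo comp_map phi (chart (Some c)) = pull (Some c) h by rewrite comp_comp_map.
  rewrite -e2; apply: (IHn (comp_map phi (chart (Some c))) M.+1 k').
  - exact: tower_chart_next.
  - by rewrite e2 e1; exact: h1.
  - by rewrite e2 e1; exact: h2.
  - by rewrite -ml.
apply: (@free_good _ lam (ltW lam_gt0) n _ _ k' _ h1 h2 lw).
have kl1 : (k' + 1 <= l)%N by rewrite addn1; apply: leq_ltn_trans ml.
have := lam_mono (ltW lam_gt0) kl1; rewrite natrD mulrDr mulr1 ll.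
have := lam_eps; have [i0 _] := inv_d; have := eps0; lra.
Qed.

End ConicStage.

Section ConicStageGood.
Context {K : numClosedFieldType}.
Implicit Types (f g h : {mpoly K[2]}) (F G : {mpoly K[3]}).

Local Notation x := ('X_ord0 : {mpoly K[2]}).
Local Notation y := ('X_ord_max : {mpoly K[2]}).

Lemma xord_uniq f a b : xdvd f a -> xcoef f a != 0 -> xdvd f b -> xcoef f b != 0 -> a = b.
Proof.
move=> ha /xcoef_neq0_ex[j /= hj] hb /xcoef_neq0_ex[l hl].
by apply/eqP; rewrite eqn_leq (ha _ _ hl) (hb _ _ hj).
Qed.

Lemma size_restr_order e G H' S : G \is e.-homog -> restr G = H' * 'X^S ->
  restr G != 0 -> (S <= 2 * e)%N /\ (H'.[0] = 0 -> (S < 2 * e)%N).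
Proof.
move=> hG eH rn0; have H'n0 : H' != 0 by apply: contraNneq rn0 => e0; rewrite eH e0 mul0r.
have : (size (restr G) <= (2 * e).+1)%N by exact: size_restr.
rewrite eH size_Mmonic ?monicXn // size_polyXn addnS /= => sz.
have s0 : (0 < size H')%N by rewrite size_poly_gt0.
split; first by rewrite -ltnS; apply: leq_trans sz; rewrite -[X in (X < _)%N]add0n ltn_add2r.
move=> H0; have s1 : (1 < size H')%N.
  rewrite ltnNge; apply/negP => /size1_polyC e0.
  by move: H0 H'n0; rewrite e0 hornerC => ->; rewrite polyC0 eqxx.
by rewrite -ltnS; apply: leq_trans sz; rewrite -[X in (X < _)%N]add1n ltn_add2r.
Qed.

(** When a conic [q4] through the five points is a component, the residual curve
    [g4] satisfies Bezout's bound with respect to it, and the conic contributes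
    a simple branch transversal to the last exceptional curve. *)
Lemma fifth_point_component d (q4 g4 h4 r : {mpoly K[2]}) (k t0 : K) S4 k4 m4 c k5 :
  (3 <= d)%N -> k != 0 -> q4 = x ^+ 4 * (k%:MP * y + x * r) -> h4 = q4 * g4 ->
  (xdvd (blow0 q4) 5 -> (xcoef (blow0 q4) 5).[t0] = 0) ->
  (forall S, xdvd (blow0 g4) S -> (S <= 2 * d - 4)%N /\
     ((xcoef (blow0 g4) S).[t0] = 0 -> (S < 2 * d - 4)%N)) ->
  xdvd h4 S4 -> cf h4 S4 k4 != 0 -> (m4 <= k4)%N -> (4 * k4 <= S4)%N ->
  xdvd (blow0 h4) (S4 + m4) -> (exists i j, cf h4 i j != 0 /\ (i + j = S4 + m4)%N) ->
  cf (pull (Some c) h4) (S4 + m4) k5 != 0 -> (k5 <= m4)%N ->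
  (forall j, (j < k5)%N -> cf (pull (Some c) h4) (S4 + m4) j = 0) ->
  [/\ (S4 + m4 <= (2 * d).+1)%N,
      exists i j, [/\ cf h4 i j != 0, (i + j = S4 + m4)%N & (i <= 2 * d)%N],
      (5 * k5 <= 2 * d)%N & (5 * k5 = 2 * d -> S4 + m4 = 2 * d)%N].
Proof.
move=> d3 kn0 q4E h4E hq hg hS4 hk4 mk4 kS4 hS5 [i0 [j0 [h0 e0]]] hk5 km5 hlow.
set S5 := (S4 + m4)%N in hS5 e0 hk5 hlow *.
have xc0 n h : xcoef (x ^+ n * h) n = xcoef h 0 by rewrite -{2}(addn0 n) xcoef_xmul.
have q4c : xcoef q4 4 = k *: 'X.
  rewrite q4E xc0; apply: poly_ext => t.
  by rewrite horner_xcoef0 hornerZ hornerX !(ev2D, ev2M, ev2C, ev2x, ev2y) mul0r addr0.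
have bq4E : blow0 q4 = x ^+ 5 * (k%:MP * y + blow0 r).
  by rewrite q4E; apply: ev2_ext => a b;
    rewrite !(ev2_blow0, ev2M, ev2D, ev2Xn, ev2C, ev2x, ev2y) exprSr; ring.
pose rho := ev2 r 0 0.
have bq4c : xcoef (blow0 q4) 5 = k *: 'X + rho%:P.
  rewrite bq4E xc0; apply: poly_ext => t.
  rewrite horner_xcoef0 hornerD hornerZ hornerX hornerC.
  by rewrite !(ev2D, ev2M, ev2C, ev2y) ev2_blow0 mul0r.
have q4d : xdvd q4 4 by rewrite q4E; exact: xdvd_xmul.
have bq4d : xdvd (blow0 q4) 5 by rewrite bq4E; exact: xdvd_xmul.
have h4n0 : h4 != 0 by apply: contraNneq hk4 => ->; rewrite /cf mcoeff0.
have g4n0 : g4 != 0 by apply: contraNneq h4n0 => g0; rewrite h4E g0 mulr0.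
have lin0 : k *: 'X + rho%:P != 0.
  apply/eqP => /(congr1 (fun p : {poly K} => p`_1)).
  by rewrite coefD coefZ coefX coefC coef0 mulr1 addr0 => /eqP; rewrite (negbTE kn0).
have [A4 gA gA0] := xdvd_ex g4n0.
have [hA cA] := xcoef_mul q4d gA; rewrite -h4E in hA cA.
have eS4 : S4 = (4 + A4)%N.
  apply: (xord_uniq hS4 (xcoef_neq0 hk4) hA).
  rewrite cA q4c; apply: mulf_neq0 gA0.
  by rewrite scaler_eq0 negb_or kn0 polyX_eq0.
have [i1 [j1 [g1 gmin]]] := supp_min (fun i j => i + j)%N g4n0.
set A5 := (i1 + j1)%N in gmin.
have gA5 : xdvd (blow0 g4) A5 by apply/xdvd_blow0.
have gA50 : xcoef (blow0 g4) A5 != 0 by apply: (@xcoef_neq0 _ _ _ j1); exact: cf_blow0_nz.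
have [hB cB] := xcoef_mul bq4d gA5; rewrite -blow0M -h4E in hB cB.
have cBn0 : xcoef (blow0 h4) (5 + A5) != 0.
  by rewrite cB bq4c; exact: mulf_neq0 lin0 gA50.
have l5 : xcoef (blow0 h4) S5 != 0.
  by rewrite -e0; apply: (@xcoef_neq0 _ _ _ j0); exact: cf_blow0_nz.
have eS5 : S5 = (5 + A5)%N by apply: xord_uniq hB cBn0.
rewrite -eS5 bq4c in cB; set lg := xcoef (blow0 g4) A5 in gA50 cB.
have slg : (size lg <= (A5 - A4).+1)%N.
  apply: size_xcoef => j /cf_blow0_inv[i eij hij].
  by have := gA _ _ hij; move: eij; clear; lia.
have [b1 b2] := hg _ gA5.
have hQr : (k *: 'X + rho%:P).[t0] = 0 by rewrite -bq4c; apply: hq; exact: bq4d.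
have mA : (m4 = (A5 - A4) + 1)%N.
  have : (A4 <= A5)%N by have := gA _ _ g1; rewrite /A5; clear; lia.
  by move: eS5; rewrite /S5 eS4; clear; lia.
have A45 : (4 * (A5 - A4) <= A4)%N by move: kS4 mk4 mA eS4; clear; lia.
have low j : (j < k5)%N -> (((k *: 'X + rho%:P) * lg) \Po ('X + c%:P))`_j = 0.
  by move=> /hlow; rewrite -coef_xcoef xcoef_pull cB.
have k5b : ((k * c + rho == 0) && (lg.[c] == 0)) || (k5 <= maxn 1 (A5 - A4))%N.
  case: (eqVneq (k * c + rho) 0) => [e1|ne1] /=; last first.
    rewrite leqNgt; apply/negP; rewrite gtn_max => /andP[_ lk].
    have [k' hk' [h1 h2]] := @root_multiplicity _ lg 0 (A5 - A4) c gA50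
      (fun j (hj : (j < 0)%N) => match notF hj with end) slg (or_intror erefl).
    have := low k' (leq_ltn_trans (_ : k' <= A5 - A4)%N lk); rewrite -{1}[k']addn0 => /(_ hk').
    rewrite rmorphM /= coefM big_ord_recl /= subn0 big1 => [|i _]; last first.
      rewrite h2 ?mulr0 //; have := ltn_ord i; rewrite /bump; clear; lia.
    rewrite addr0 => /eqP; rewrite mulf_eq0 (negbTE h1) orbF -horner_coef0.
    by rewrite horner_comp !hornerE (negbTE ne1).
  case: (eqVneq lg.[c] 0) => //= ne2; rewrite leqNgt; apply/negP; rewrite gtn_max => /andP[k1 _].
  have := low 1%N k1; rewrite rmorphM /= coefM !big_ord_recl big_ord0 /= addr0.
  rewrite -!horner_coef0 !horner_comp !hornerE e1 mul0r add0r.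
  have -> : ((k *: 'X + rho%:P) \Po ('X + c%:P)) = k *: 'X + (k * c + rho)%:P.
    by apply: poly_ext => t; rewrite horner_comp !(hornerD, hornerZ, hornerX, hornerC); ring.
  rewrite coefD coefZ coefX coefC /= mulr1 addr0 => /eqP.
  by rewrite mulf_eq0 (negbTE kn0) (negbTE ne2).
have final : (5 * k5 <= 2 * d)%N /\ ((5 * k5 = 2 * d)%N -> S5 = (2 * d)%N).
  case/orP: k5b => [/andP[/eqP r1 /eqP r2]|]; last first.
    by rewrite leq_max => /orP[k1|k1]; move: k1 A45 b1 d3; clear; split; lia.
  have ec : c = t0.
    apply: (mulfI kn0); apply: (addIr rho); rewrite r1; move: hQr.
    by rewrite hornerD hornerZ hornerX hornerC.
  have := b2; rewrite -/lg -ec => /(_ r2) b3.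
  by rewrite eS5; move: b3 mA km5 A45; clear; split; lia.
split.
- by rewrite eS5; move: b1 d3; clear; lia.
- exists (S5 - (size (xcoef (blow0 h4) S5)).-1)%N, (size (xcoef (blow0 h4) S5)).-1.
  have hl : cf (blow0 h4) S5 (size (xcoef (blow0 h4) S5)).-1 != 0.
    by rewrite -coef_xcoef -lead_coefE lead_coef_eq0; exact: l5.
  have sz : (0 < (size (xcoef (blow0 h4) S5)).-1)%N.
    rewrite cB (size_mul lin0 gA50).
    have -> : size (k *: 'X + rho%:P) = 2.
      rewrite size_polyDl size_scale ?size_polyX // ltnS; exact: size_polyC_leq1.
    by have : (0 < size lg)%N by rewrite size_poly_gt0.
  have [i ei hi] := cf_blow0_inv hl.
  split; [by rewrite {1}ei addnK|by rewrite subnK // {2}ei leq_addl|].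
  by move: sz; set s := (size _).-1 => sz; rewrite eS5; move: sz b1 d3; clear; lia.
- by case: final.
- by case: final.
Qed.

(** The fifth point of the tower.  If the conic through the five points is not
    a component, Bezout's theorem bounds the sum [S5] of the multiplicities by
    [2 d].  If it is one, the bound holds for the residual curve, and the conic
    contributes a simple transversal branch. *)
Lemma fifth_point d G (psi : plane_map) a1 a2 h4 S4 k4 m4 c k5 :
  (3 <= d)%N -> G \is d.-homog -> reduced G -> conic_arcs psi ->
  h4 = pull (Some a2) (pull (Some a1) (dehom G \mPo psi)) ->
  xdvd h4 S4 -> cf h4 S4 k4 != 0 -> (m4 <= k4)%N -> (4 * k4 <= S4)%N ->
  xdvd (blow0 h4) (S4 + m4) -> (exists i j, cf h4 i j != 0 /\ (i + j = S4 + m4)%N) ->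
  cf (pull (Some c) h4) (S4 + m4) k5 != 0 -> (k5 <= m4)%N ->
  (forall j, (j < k5)%N -> cf (pull (Some c) h4) (S4 + m4) j = 0) ->
  [/\ (S4 + m4 <= (2 * d).+1)%N,
      exists i j, [/\ cf h4 i j != 0, (i + j = S4 + m4)%N & (i <= 2 * d)%N],
      (5 * k5 <= 2 * d)%N & (5 * k5 = 2 * d -> S4 + m4 = 2 * d)%N].
Proof.
move=> d3 hG rG hpsi h4P hS4 hk4 mk4 kS4 hS5 [i0 [j0 [h0 e0]]] hk5 km5 hlow.
set S5 := (S4 + m4)%N in hS5 e0 hk5 hlow *.
have [B [D [p0 [T [uB D0 hp0 harc [k [r [kn0 hq4]]]]]]]] := hpsi a1 a2.
have [H' eH' _] : exists2 H', restr (subst_mx B G) = H' * 'X^S5 &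
    ((xcoef (blow0 h4) S5).[T.[0] / D.[0]] = 0 <-> H'.[0] = 0).
  by move: hS5; rewrite h4P; exact: (conic_arc_order hG D0 hp0 harc).
have hBG : subst_mx B G \is d.-homog by apply: subst_homog.
have [rz|rn0] := eqVneq (restr (subst_mx B G)) 0; last first.
  have [b1 _] := size_restr_order hBG eH' rn0.
  have m5 : (5 * k5 <= S5)%N by move: km5 mk4 kS4; rewrite /S5; clear; lia.
  split; [exact: leqW| |exact: leq_trans m5 b1|by move=> e5; apply/eqP; rewrite eqn_leq b1 -e5 m5].
  by exists i0, j0; split; [exact: h0|exact: e0|apply: leq_trans b1; rewrite -e0 leq_addr].
have [d' d'E] : exists d', d = d'.+2 by exists d.-2; move: d3; clear; lia.
rewrite d'E in hBG; have [G' hG' eG'] := conic_dvd_homog hBG (restr_eq0 rz).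
have rG' : restr G' != 0.
  by apply: (reduced_restr_quotient hG'); rewrite -eG'; apply: subst_reduced.
pose Q1 := subst_mx (invmx B) conic; pose G1 := subst_mx (invmx B) G'.
have GE : G = Q1 * G1 by rewrite -substM -eG' subst_mxKV.
have hQ1 : Q1 \is 2.-homog by apply: subst_homog; exact: conic_homog.
have hG1 : G1 \is d'.-homog by apply: subst_homog.
have arcQ := conic_arc_order hQ1 D0 hp0 harc.
have arcG := conic_arc_order hG1 D0 hp0 harc.
have h4E : h4 = pull (Some a2) (pull (Some a1) (dehom Q1 \mPo psi)) *
                pull (Some a2) (pull (Some a1) (dehom G1 \mPo psi)).
  by rewrite h4P GE dehomM rmorphM /= !pullM.
apply: (fifth_point_component d3 kn0 hq4 h4E (t0 := T.[0] / D.[0]) _ _ hS4 hk4 mk4 kS4 hS5 _ hk5 km5 hlow).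
- move=> /arcQ[Hq eHq hHq]; apply/hHq; move: eHq; rewrite /Q1 subst_mxK // restr_conic => /esym/eqP.
  by rewrite mulf_eq0 expf_eq0 /= polyX_eq0 orbF => /eqP ->; rewrite horner0.
- move=> S /arcG[Hg eHg hHg]; rewrite /G1 subst_mxK // in eHg.
  have [b1 b2] := size_restr_order hG' eHg rG'.
  split; first by move: b1; rewrite d'E; clear; lia.
  by move=> /hHg /b2; rewrite d'E; clear; lia.
- by exists i0, j0.
Qed.

End ConicStageGood.

Section ConicStageMain.
Context {K : numClosedFieldType}.
Implicit Types (f g h : {mpoly K[2]}) (F G : {mpoly K[3]}).

Lemma lam_2d1 d (eps lam : rat) n : (3 <= d)%N -> 0 <= eps -> lam = (5 + eps) / (2 * d%:R) ->
  (n <= 2 * d - 1)%N -> lam * n%:R <= 5 + eps - lam.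
Proof.
move=> d3 eps0 lamE h; have lamle := lam_le d3 eps0 lamE.
have : lam * (n + 1)%:R <= 5 + eps.
  have := lamle _ _ _ (_ : 1 * (n + 1) <= 2 * d)%N; rewrite mul1r => e.
  have h2 : (1 * (n + 1) <= 2 * d)%N by move: h d3; clear; lia.
  by have := e h2; clear -K; lra.
by rewrite natrD mulrDr mulr1; clear -K; lra.
Qed.

Lemma lam_2d d (eps lam : rat) n : (3 <= d)%N -> 0 <= eps -> lam = (5 + eps) / (2 * d%:R) ->
  (n <= 2 * d)%N -> lam * n%:R <= 5 + eps.
Proof.
move=> d3 eps0 lamE h; have lamle := lam_le d3 eps0 lamE.
have := lamle _ _ _ (_ : 1 * n <= 2 * d)%N; rewrite mul1n mul1r => /(_ h).
by clear -K; lra.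
Qed.

Lemma small_facts d (eps lam : rat) : (3 <= d)%N -> 0 <= eps ->
  eps * (100 * d ^ 2)%:R <= 1 -> lam = (5 + eps) / (2 * d%:R) -> [/\ eps <= 1 / 900, lam <= 5 / 6 + eps / 6,
  d%:R^-1 <= lam - eps & 0 < (d%:R^-1 : rat) /\ 100 * eps <= d%:R^-1].
Proof.
move=> d3 eps0 epsd lamE.
split; [exact: (eps_small d3 eps0 epsd)|exact: (lam_le1 d3 eps0 lamE)|
  exact: (lam_eps d3 eps0 epsd lamE)|exact: (inv_d d3 eps0 epsd)].
Qed.

(** Free points of the second exceptional curve.  The sums of the first two,
    three and four multiplicities are at most [d], [3 d / 2] and [2 d], with
    equality in the last case only for even Ploski curves; then Bezout's theorem
    takes over. *)
Lemma conic_stage_good d (eps lam : rat) G (psi : plane_map) S2 k2 :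
  (3 <= d)%N -> 0 <= eps -> eps * (100 * d ^ 2)%:R <= 1 -> lam = (5 + eps) / (2 * d%:R) ->
  G \is d.-homog -> reduced G -> conic_arcs psi -> pencil_arcs psi -> tower_chart psi 2 ->
  eps = 0 \/ ~ pencil_product d G ->
  xdvd (dehom G \mPo psi) S2 -> cf (dehom G \mPo psi) S2 k2 != 0 ->
  (2 * k2 <= S2)%N -> (S2 <= d)%N ->
  forall n, good lam n (dehom G \mPo psi) 2 0.
Proof.
move=> d3 eps0 epsd lamE hG rG hconic hpencil htower hPN hS2 hk2 kS2 Sd.
have lam0 : 0 < lam := lam_gt0 d3 eps0 lamE.
have lamle := lam_le d3 eps0 lamE.
have lam2d n := lam_2d (n := n) d3 eps0 lamE.
have lam2d1 n := lam_2d1 (n := n) d3 eps0 lamE.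
set h2 := dehom G \mPo psi in hS2 hk2 *.
have [f1 f2 f3 [f4 f5]] := small_facts d3 eps0 epsd lamE.
have fn0 : dehom G != 0.
  by apply: contraNneq (proj1 rG) => e; rewrite (dehom_eq0 hG e).
have sf : square_free (dehom G) by exact: reduced_square_free hG rG.
have hdeg i j : cf (dehom G) i j != 0 -> (i + j <= d)%N by exact: cf_dehom_deg hG.
have lS2 : lam * S2%:R <= (5 + eps) / 2.
  have := lamle _ _ _ (_ : 1 * S2 <= 1 * d)%N.
  by rewrite !mul1n !mul1r => /(_ Sd).
have lSk2 : lam * (S2 + k2)%:R <= (5 + eps) * 3 / 4.
  have := lamle _ _ _ (_ : 2 * (S2 + k2) <= 3 * d)%N.
  have h : (2 * (S2 + k2) <= 3 * d)%N by move: kS2 Sd; clear; lia.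
  by move=> /(_ h); clear -K; lra.
have lk2 : lam * k2%:R <= 2.
  have := lamle _ _ _ (_ : 2 * k2 <= 1 * d)%N.
  have h : (2 * k2 <= 1 * d)%N by move: kS2 Sd; clear; lia.
  by move=> /(_ h); move: f1; clear -K; lra.
apply: good_step; first by exists S2, k2; split; [exact: hk2|move: lSk2 f1; clear -K; lra].
move=> [a1|] n; rewrite nexty0 /=; last first.
  apply: (@satellite_good _ lam (ltW lam0) n h2 S2 k2 _ _ hS2 hk2 lk2).
  apply: (@newton_box _ lam _ _ _ S2 (S2 + k2)%N).
  - exact: cf_blow_oo_nz.
  - by move: lS2 f1; clear -K; lra.
  - by move: lSk2 f1; clear -K; lra.
have [m2 [k3 [mk2 km2 hb2 _ [hS3 hk3 _]]]] := free_point a1 hS2 hk2.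
set h3 := pull (Some a1) h2 in hS3 hk3 *; set S3 := (S2 + m2)%N in hS3 hk3 hb2.
have lS3 : lam * S3%:R <= (5 + eps) * 3 / 4.
  apply: le_trans lSk2; apply: lam_mono; first exact: ltW.
  by rewrite leq_add2l.
have h3n0 : h3 != 0 by apply: contraNneq hk3 => ->; rewrite /cf mcoeff0.
have [i0 [j0 [h30 h3min]]] := supp_min (fun i j => i + j)%N h3n0.
have [S4 e40] : exists S4, (i0 + j0 = S4)%N by exists (i0 + j0)%N.
rewrite e40 in h3min.
have S4k : (S4 <= S3 + k3)%N := h3min _ _ hk3.
have Sk3 : (S3 + k3 <= 2 * d)%N by move: kS2 Sd mk2 km2; rewrite /S3; clear; lia.
(* A contact of order [2 * d] with all conics of a pencil forces equality. *)
have alt : eps = 0 \/ (S4 <= 2 * d - 1)%N.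
  case: hPN => [e0|hPN]; [by left|right].
  rewrite leqNgt; apply/negP => S4d; apply: hPN.
  have e4 : S4 = (2 * d)%N by move: S4d S4k Sk3; clear; lia.
  have dev : ~~ odd d.
    have e : (d = 2 * k2)%N by move: e4 S4k mk2 km2 kS2 Sd; rewrite /S3; clear; lia.
    by rewrite e mul2n odd_double.
  have [B uB hB] := hpencil a1.
  have hu u : 'X^(2 * d) %| pev (subst_mx B G) 'X 'X^2 (1 + u *: 'X^2).
    have [D [p0 [T [D0 hp0 harc]]]] := hB u.
    apply: (pencil_arc_order hG D0 hp0 harc).
    by apply/xdvd_blow0 => i j hij; rewrite -e4; exact: h3min.
  have [k [rho [kn0 eG]]] := maximal_contact_pencil dev (subst_homog B hG)
    (subst_reduced uB rG) hu.
  by exists B, k, rho; split; [exact: uB|exact: kn0|exact: eG].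
have S4d : (S4 <= 2 * d)%N by exact: leq_trans Sk3.
have lS4 : lam * S4%:R <= 5.
  case: alt => [e0|h]; first by have := lam2d _ S4d; rewrite e0 addr0.
  by have := lam2d1 _ h; move: f3 f4; clear -K; lra.
apply: good_step; first by exists i0, j0; split; [exact: h30|rewrite e40; exact: lS4].
move=> [a2|] {}n; rewrite nexty0 /=; last first.
  apply: (@satellite_good _ lam (ltW lam0) n h3 S3 k3 _ _ hS3 hk3).
    apply: le_trans lk2; apply: lam_mono; first exact: ltW.
    exact: leq_trans km2 mk2.
  have hc1 := cf_blow_oo_nz hk3; have := cf_blow_oo_nz h30; rewrite e40 => hc2.
  have l1 : lam * (S3 + k3)%:R <= 5 + eps := lam2d _ Sk3.
  case: alt => [e0|h].
    apply: (newton_box hc1); first by move: lS3 f1; clear -K; lra.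
    by move: l1; rewrite e0 addr0.
  have l2 : lam * i0%:R <= 5 + eps.
    by apply: lam2d; apply: leq_trans S4d; rewrite -e40 leq_addr.
  (* [S3 + k3 <= 2 * d] exceeds the bound by [eps]; a monomial of degree [S4 < 2 * d]
     makes up for it. *)
  apply: (newton_two hc1 hc2 (e := eps) (d1 := 1 / 5) (d2 := d%:R^-1) (N := 2)).
  - by clear -K; lra.
  - by move: f5 f4; clear -K; lra.
  - by clear -K; lra.
  - by move: lS3 f1; clear -K; lra.
  - by move: l1; clear -K; lra.
  - by move: l2 f1; clear -K; lra.
  - by have := lam2d1 _ h; move: f3; clear -K; lra.
have [m3 [k4 [mk3 km3 hb3 [i3 [j3 [h33 e33]]] [hS4' hk4 _]]]] := free_point a2 hS3 hk3.
have eS4 : S4 = (S3 + m3)%N.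
  apply/eqP; rewrite eqn_leq -{1}e33 (h3min _ _ h33) /=.
  by rewrite -e40; have /xdvd_blow0 h := hb3; apply: h.
rewrite -eS4 in hb3 e33 hS4' hk4.
set h4 := pull (Some a2) h3 in hS4' hk4 *.
have kS4 : (4 * k4 <= S4)%N.
  by move: km3 mk3 km2 mk2 kS2; rewrite eS4 /S3; clear; lia.
have k42 : lam * k4%:R <= 2.
  apply: le_trans lk2; apply: lam_mono; first exact: ltW.
  by move: km3 mk3 km2 mk2; clear; lia.
have fifth c := free_point c hS4' hk4.
have [m4 [k5' [mk4 km4' hb4 hex4 [hS5' hk5' low5']]]] := fifth 0.
have [S5b [i4 [j4 [h44 e44 i4d]]] _ _] :=
  fifth_point d3 hG rG hconic (erefl h4) hS4' hk4 mk4 kS4 hb4 hex4 hk5' km4' low5'.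
have lS5 : lam * (S4 + m4)%:R <= 6 - 1 / 10.
  have : lam * (S4 + m4)%:R <= 5 + eps + lam.
    apply: le_trans (lam_mono (ltW lam0) S5b) _.
    by rewrite -addn1 natrD mulrDr mulr1 lerD2r; exact: lam2d.
  by move: f1 f2; clear -K; lra.
apply: good_step.
  by exists i4, j4; split; [exact: h44|rewrite e44; move: lS5; clear -K; lra].
move=> [c|] {}n; rewrite nexty0 /=; last first.
  apply: (@satellite_good _ lam (ltW lam0) n h4 S4 k4 _ _ hS4' hk4 k42).
  have hc1 := cf_blow_oo_nz hk4; have := cf_blow_oo_nz h44; rewrite e44 => hc2.
  have l1 : lam * i4%:R <= 5 + eps := lam2d _ i4d.
  case: alt => [e0|h].
    apply: (newton_box hc2); first by move: l1; rewrite e0 addr0.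
    by move: lS5; clear -K; lra.
  have l2 : lam * (S4 + k4)%:R <= 7.
    have : lam * k4%:R <= lam * k2%:R.
      by apply: lam_mono; [exact: ltW|move: km3 mk3 km2 mk2; clear; lia].
    have := lamle _ _ _ (_ : 2 * k2 <= 1 * d)%N.
    have hk : (2 * k2 <= 1 * d)%N by move: kS2 Sd; clear; lia.
    by move=> /(_ hk); rewrite natrD mulrDr; move: lS4 f1; clear -K; lra.
  (* Here [i4 <= 2 * d] exceeds the bound by [eps], and again [S4 < 2 * d] makes up
     for it. *)
  apply: (newton_two hc1 hc2 (e := 1) (d1 := d%:R^-1) (d2 := 1 / 10) (N := eps)).
  - exact: f4.
  - by move: f5 f4; clear -K; lra.
  - exact: eps0.
  - by have := lam2d1 _ h; move: f3; clear -K; lra.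
  - by move: l2; clear -K; lra.
  - by move: l1; clear -K; lra.
  - by move: lS5; clear -K; lra.
have [n4 [k5 [nk4 kn4 hb4' hex4' [hS5 hk5 low5]]]] := fifth c.
have [T5b [i5 [j5 [h55 e55 _]]] k5d k5eq] :=
  fifth_point d3 hG rG hconic (erefl h4) hS4' hk4 nk4 kS4 hb4' hex4' hk5 kn4 low5.
have lT5 : lam * (S4 + n4)%:R <= 6 - 1 / 10.
  have : lam * (S4 + n4)%:R <= 5 + eps + lam.
    apply: le_trans (lam_mono (ltW lam0) T5b) _.
    by rewrite -addn1 natrD mulrDr mulr1 lerD2r; exact: lam2d.
  by move: f1 f2; clear -K; lra.
case: (ltngtP (5 * k5)%N (2 * d)%N) => [k5l|k5g|k5e].
- apply: (@free_good _ lam (ltW lam0) n _ _ k5 _ hS5 hk5).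
    by move: lT5; clear -K; lra.
  have h : (5 * k5 <= 2 * d - 1)%N by move: k5l; clear; lia.
  have := lam2d1 _ h; rewrite natrM mulrCA; move: f3 f4; clear -K; lra.
- by move: k5d; rewrite leqNgt k5g.
- have eS5 : (S4 + n4 = 5 * k5)%N by rewrite k5eq // k5e.
  pose phi := comp_map (comp_map (comp_map psi (chart (Some a1))) (chart (Some a2))) (chart (Some c)).
  have eh : dehom G \mPo phi = pull (Some c) h4 by rewrite /phi !comp_comp_map.
  rewrite -eh; apply: (@equimultiple_tower_good K d eps lam d3 eps0 epsd lamE _ k5 fn0 sf hdeg k5e n phi 5 k5).
  + by do 3! apply: tower_chart_next.
  + by rewrite eh -eS5; exact: hS5.
  + by rewrite eh -eS5; exact: hk5.
  + exact: leqnn.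
Qed.

End ConicStageMain.

(** * The two charts of a free second infinitely near point *)

Section ConicCharts.
Context {K : numClosedFieldType}.
Implicit Types (f g h : {mpoly K[2]}) (F G : {mpoly K[3]}).

Local Notation x := ('X_ord0 : {mpoly K[2]}).
Local Notation y := ('X_ord_max : {mpoly K[2]}).
Local Notation X0 := ('X_(inord 0) : {mpoly K[3]}).
Local Notation X1 := ('X_(inord 1) : {mpoly K[3]}).
Local Notation X2 := ('X_(inord 2) : {mpoly K[3]}).

Definition mx3 (l : seq (seq K)) : 'M[K]_3 := \matrix_(i, j) nth 0 (nth [::] l i) j.

Lemma row_app_mx3 l i a b c : (i < 3)%N ->
  row_app (mx3 l) i a b c = nth 0 (nth [::] l i) 0 * a + nth 0 (nth [::] l i) 1 * b
   + nth 0 (nth [::] l i) 2 * c.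
Proof. by move=> hi; rewrite /row_app !mxE !inordK. Qed.

Lemma mx3_unit l l' :
  (forall a b c, let r i := row_app (mx3 l') i a b c in
    [/\ row_app (mx3 l) 0 (r 0%N) (r 1%N) (r 2%N) = a,
        row_app (mx3 l) 1 (r 0%N) (r 1%N) (r 2%N) = b &
        row_app (mx3 l) 2 (r 0%N) (r 1%N) (r 2%N) = c]) ->
  mx3 l \in unitmx.
Proof.
move=> h; suff /mulmx1_unit[] : mx3 l *m mx3 l' = 1%:M by [].
apply/matrixP => i j.
pose e (k : nat) : K := (j == inord k)%:R.
have [h0 h1 h2] := h (e 0%N) (e 1%N) (e 2%N).
have ej k : (k < 3)%N -> row_app (mx3 l') k (e 0%N) (e 1%N) (e 2%N) = mx3 l' (inord k) j.
  move=> hk; rewrite /row_app /e.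
  by case: (ord3P j) => ->; rewrite !inord3_eq //= !(mulr0, mulr1, addr0, add0r).
rewrite !ej // in h0 h1 h2.
have ei k : (k < 3)%N -> (mx3 l *m mx3 l') (inord k) j =
   row_app (mx3 l) k (mx3 l' (inord 0) j) (mx3 l' (inord 1) j) (mx3 l' (inord 2) j).
  by move=> hk; rewrite mxE big_ord3.
by rewrite [RHS]mxE eq_sym; case: (ord3P i) => ->; rewrite ei.
Qed.

(** The point [c] of the second exceptional curve, over the point [0], resp.
    infinity, of the first one. *)
Definition chart_finite c : plane_map := map_pair x (x ^+ 2 * (y + c%:MP)).
Definition chart_infinite c : plane_map := map_pair (x ^+ 2 * (y + c%:MP)) (x * (y + c%:MP)).

Lemma ev2_comp_pair f (p q : {mpoly K[2]}) a b : ev2 (f \mPo map_pair p q) a b = ev2 f (ev2 p a b) (ev2 q a b).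
Proof. exact: ev2_comp. Qed.

Lemma tnth_pair0 (p q : {mpoly K[2]}) : tnth (map_pair p q) ord0 = p.
Proof. by rewrite (tnth_nth 0). Qed.
Lemma tnth_pair1 (p q : {mpoly K[2]}) : tnth (map_pair p q) ord_max = q.
Proof. by rewrite (tnth_nth 0). Qed.

Lemma ev2N f a b : ev2 (- f) a b = - ev2 f a b.
Proof. exact: mevalN. Qed.

(** In these coordinates the conic is parametrized by [(s, s ^+ 2, D)], resp.
    [(s ^+ 2, s, D)], with [D = c + a * s + b * s ^+ 2]. *)
Definition conic_mx_finite (a b c : K) := mx3 [:: [:: 1; 0; 0]; [:: 0; 1; 0]; [:: a; b; c]].
Definition conic_mx_infinite (a b c : K) := mx3 [:: [:: 0; 1; 0]; [:: 1; 0; 0]; [:: a; b; c]].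

Lemma conic_mx_finite_unit a b c : c != 0 -> conic_mx_finite a b c \in unitmx.
Proof.
move=> c0; apply: (@mx3_unit _ [:: [:: 1; 0; 0]; [:: 0; 1; 0]; [:: - a / c; - b / c; c^-1]]).
move=> u v w; rewrite /= !row_app_mx3 //=.
by split; [ring|ring|field].
Qed.

Lemma conic_mx_infinite_unit a b c : c != 0 -> conic_mx_infinite a b c \in unitmx.
Proof.
move=> c0; apply: (@mx3_unit _ [:: [:: 0; 1; 0]; [:: 1; 0; 0]; [:: - b / c; - a / c; c^-1]]).
move=> u v w; rewrite /= !row_app_mx3 //=.
by split; [ring|ring|field].
Qed.

Lemma subst_conic_finite a b c : c != 0 ->
  subst_mx (invmx (conic_mx_finite a b c)) conic =
  c^-1 *: (X1 * (X2 + (- a) *: X0 + (- b) *: X1)) - X0 ^+ 2.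
Proof.
move=> c0; rewrite -[RHS](subst_mxKV _ (conic_mx_finite_unit a b c0)); congr subst_mx.
apply: ev3_ext => u v w; rewrite subst_ev3 ev3_conic !row_app_mx3 //= !ev3E; field.
exact: c0.
Qed.

Lemma subst_conic_infinite a b c : c != 0 ->
  subst_mx (invmx (conic_mx_infinite a b c)) conic =
  c^-1 *: (X0 * (X2 + (- a) *: X1 + (- b) *: X0)) - X1 ^+ 2.
Proof.
move=> c0; rewrite -[RHS](subst_mxKV _ (conic_mx_infinite_unit a b c0)); congr subst_mx.
apply: ev3_ext => u v w; rewrite subst_ev3 ev3_conic !row_app_mx3 //= !ev3E; field.
exact: c0.
Qed.

Definition quad (a b c : K) : {poly K} := c%:P + a *: 'X + b *: 'X^2.

Lemma horner_quad a b c s : (quad a b c).[s] = c + a * s + b * s ^+ 2.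
Proof. by rewrite /quad !(hornerD, hornerZ, hornerC, hornerX, hornerXn). Qed.

Lemma tower_chart_finite c : tower_chart (chart_finite c) 2.
Proof.
exists 1, 1, 1%N; rewrite /chart_finite jacobianE tnth_pair0 tnth_pair1; split.
- by rewrite expr2 !mderivM !mderivD !mderivC !deriv_X /=; ring.
- by rewrite /ev2 meval1 oner_eq0.
- by rewrite expr1 mulr1.
- by rewrite /ev2 meval1 oner_eq0.
- by [].
Qed.

Lemma tower_chart_infinite c : c != 0 -> tower_chart (chart_infinite c) 2.
Proof.
move=> c0; exists (y + c%:MP), (y + c%:MP), 2%N.
rewrite /chart_infinite jacobianE tnth_pair0 tnth_pair1; split.
- by rewrite expr2 !mderivM !mderivD !mderivC !deriv_X /=; ring.
- by rewrite !ev2E add0r.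
- by [].
- by rewrite !ev2E add0r.
- by [].
Qed.

(** In the first chart the conic [(s, s ^+ 2, D)] has the affine equation
    [(s / D, s ^+ 2 / D)], that is [x = s / D] and [y + c = D]. *)
Lemma conic_arcs_finite c : c != 0 -> conic_arcs (chart_finite c).
Proof.
(* The coefficients of [D] for which [y] is [a1 * x + a2 * x ^+ 2] up to order three;
   [T] describes the remainder. *)
move=> c0 a1 a2; pose al := a1 / c; pose be := (a2 - al * a1) / c ^+ 2.
have e1 : a1 = al * c by rewrite /al; field.
have e2 : a2 = be * c ^+ 2 + al * a1 by rewrite /be; field.
clearbody al be.
pose D := quad al be c.
pose T := D ^+ 2 * ((al ^+ 3 + 3%:R * c * al * be)%:P + (3%:R * al ^+ 2 * be + 2%:R * c * be ^+ 2) *: 'X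
   + (3%:R * al * be ^+ 2) *: 'X^2 + be ^+ 3 *: 'X^3).
exists (conic_mx_finite al be c), D, 1, T; split.
- exact: conic_mx_finite_unit.
- by rewrite horner_quad mulr0 expr0n /= mulr0 !addr0.
- by move=> s _; rewrite hornerC oner_eq0.
- move=> s Ds; rewrite /maps_to /chart_finite tnth_pair0 tnth_pair1 !row_app_mx3 //=.
  rewrite /arc_x hornerC mulr1 !ev2E /T !(hornerM, hornerD, hornerZ, horner_exp, hornerC, hornerX, hornerXn).
  rewrite e2 e1; move: Ds; rewrite horner_quad => Ds; split; [|by field|by ring].
  by field.
- exists c^-1, ((- c^-1)%:MP * (al%:MP * (a2%:MP + y) + be%:MP *
     ((c%:MP + a1%:MP * x + (a2%:MP + y) * x ^+ 2) + c%:MP) * (a1%:MP + (a2%:MP + y) * x))).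
  split; first by rewrite invr_eq0.
  rewrite subst_conic_finite //; apply: ev2_ext => u v.
  rewrite !ev2_pull /chart_finite ev2_comp ev2_dehom !ev3E !ev2E e2 e1; field; exact: c0.
Qed.

Lemma pencil_arcs_finite c : c != 0 -> pencil_arcs (chart_finite c).
Proof.
move=> c0 a1; pose al := a1 / c.
have e1 : a1 = al * c by rewrite /al; field.
clearbody al.
exists (conic_mx_finite al 0 c); first exact: conic_mx_finite_unit.
move=> u; pose D := quad al (c * u) c.
exists D, 1, (D ^+ 2 * ((al ^+ 2)%:P + (al * c * u) *: 'X + (c * u) *: D)); split.
- by rewrite horner_quad mulr0 expr0n /= mulr0 !addr0.
- by move=> s _; rewrite hornerC oner_eq0.
move=> s Ds; rewrite /maps_to /chart_finite tnth_pair0 tnth_pair1 !row_app_mx3 //=.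
rewrite /arc_x hornerC mulr1 !ev2E !(hornerM, hornerD, hornerZ, horner_exp, hornerC, hornerX).
rewrite e1; move: Ds; rewrite horner_quad => Ds; split; [|by field|by ring].
by field; exact: Ds.
Qed.

(** In the second chart the conic [(s ^+ 2, s, D)] is [x = s] and
    [y + c = 1 / D]. *)
Lemma conic_arcs_infinite c : c != 0 -> conic_arcs (chart_infinite c).
Proof.
move=> c0 a1 a2; pose al := - a1 / c ^+ 2; pose be := - (al * a1 + a2 / c) / c.
have e1 : a1 = - al * c ^+ 2 by rewrite /al; field.
have e2 : a2 = - be * c ^+ 2 - al * a1 * c by rewrite /be; field.
clearbody al be.
pose D := quad al be c^-1.
pose T := (- (al * a2 + be * a1))%:P - (be * a2) *: 'X.
exists (conic_mx_infinite al be c^-1), D, D, T; split.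
- by apply: conic_mx_infinite_unit; rewrite invr_eq0.
- by rewrite horner_quad mulr0 expr0n /= mulr0 !addr0 invr_eq0.
- by [].
- move=> s Ds; rewrite /maps_to /chart_infinite tnth_pair0 tnth_pair1 !row_app_mx3 //=.
  have -> : arc_x D D s = s by rewrite /arc_x mulfK.
  have TE : T.[s] = - (al * a2 + be * a1) - be * a2 * s.
    by rewrite /T !(hornerN, hornerD, hornerZ, hornerC, hornerX).
  have DE := horner_quad al be c^-1 s; rewrite -/D in DE.
  clearbody D T; rewrite !ev2E TE.
  have eA : a1 * s + a2 * s ^+ 2 + s ^+ 3 * ((- (al * a2 + be * a1) - be * a2 * s) / D.[s]) + c = D.[s]^-1.
    rewrite e2 e1; move: Ds; rewrite DE => Ds; field.
    by rewrite c0 /=; move: Ds; apply: contraNneq => e0; apply/eqP; apply: (mulfI c0); rewrite mulr0 -[RHS]e0; field; exact: c0.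
  rewrite eA; split; [by field|by field|].
  by rewrite DE; ring.
- pose w : {mpoly K[2]} := a2%:MP + y.
  pose A : {mpoly K[2]} := c%:MP + a1%:MP * x + w * x ^+ 2.
  exists (- c), (- (a1%:MP + w * x) * y - A * ((c * al)%:MP * w + (c * be)%:MP * (a1%:MP + w * x))).
  split; first by rewrite oppr_eq0.
  rewrite subst_conic_infinite ?invr_eq0 // invrK; apply: ev2_ext => u v.
  rewrite !ev2_pull /chart_infinite ev2_comp ev2_dehom !ev3E /A /w.
  rewrite !(ev2E, ev2N) e2 e1; ring.
Qed.

Lemma pencil_arcs_infinite c : c != 0 -> pencil_arcs (chart_infinite c).
Proof.
move=> c0 a1; pose al := - a1 / c ^+ 2.
have e1 : a1 = - al * c ^+ 2 by rewrite /al; field.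
clearbody al.
exists (conic_mx_infinite al 0 c^-1); first by apply: conic_mx_infinite_unit; rewrite invr_eq0.
move=> u; pose D := quad al (c^-1 * u) c^-1.
exists D, D, ((- (al * a1 + u))%:P - (c^-1 * u * a1) *: 'X); split.
- by rewrite horner_quad mulr0 expr0n /= mulr0 !addr0 invr_eq0.
- by [].
move=> s Ds; rewrite /maps_to /chart_infinite tnth_pair0 tnth_pair1 !row_app_mx3 //=.
have -> : arc_x D D s = s by rewrite /arc_x mulfK.
have DE := horner_quad al (c^-1 * u) c^-1 s; rewrite -/D in DE.
clearbody D; rewrite !ev2E hornerD hornerN hornerC hornerZ hornerX.
have eA : a1 * s + s ^+ 2 * ((- (al * a1 + u) - c^-1 * u * a1 * s) / D.[s]) + c = D.[s]^-1.
  rewrite e1; move: Ds; rewrite DE => Ds; field.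
  by rewrite c0 /=; move: Ds; apply: contraNneq => e0; apply/eqP; apply: (mulfI c0); rewrite mulr0 -[RHS]e0; field; exact: c0.
rewrite eA; split; [by field|by field|].
by rewrite DE; ring.
Qed.

End ConicCharts.

(** * Log canonicity of numerically semistable curves *)

Section Local.
Context {K : numClosedFieldType}.
Implicit Types (f g h : {mpoly K[2]}) (F G : {mpoly K[3]}).

Local Notation x := ('X_ord0 : {mpoly K[2]}).
Local Notation y := ('X_ord_max : {mpoly K[2]}).

(** The numerical criterion for semistability of Hilbert and Mumford: the
    weights [(2 s - t, 2 t - s, - s - t)] of the coordinates do not give all
    monomials of the form a positive weight. *)
Definition numerically_semistable (d : nat) F : Prop :=
  forall A : 'M[K]_3, A \in unitmx -> forall s t : nat, exists i j,
    cf (dehom (subst_mx A F)) i j != 0 /\ (3 * (s * i + t * j) <= d * (s + t))%N.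

Lemma numerically_semistable_subst d A F : A \in unitmx ->
  numerically_semistable d F -> numerically_semistable d (subst_mx A F).
Proof.
move=> uA h B uB s t; rewrite subst_mxM; apply: h.
by rewrite unitmx_mul uA uB.
Qed.

Lemma pencil_product_subst d A F : A \in unitmx ->
  pencil_product d (subst_mx A F) -> pencil_product d F.
Proof.
move=> uA [B [k [rho [uB k0 e]]]]; exists (A *m B), k, rho; split=> //.
  by rewrite unitmx_mul uA uB.
by rewrite -subst_mxM.
Qed.

Definition weights_ok d f := forall s t : nat, exists i j,
  cf f i j != 0 /\ (3 * (s * i + t * j) <= d * (s + t))%N.

Section Weights.
Variables (d : nat) (lam : rat).
Hypotheses (lam0 : 0 <= lam) (lamd : lam * d%:R <= 3).

Lemma third_le n w : (3 * n <= d * w)%N -> lam * n%:R <= w%:R.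
Proof.
move=> /(lam_mono lam0); rewrite !natrM => h.
have := ler_wpM2r (ler0n rat w) lamd.
have : 3 * (lam * n%:R) <= lam * d%:R * w%:R by rewrite mulrCA -mulrA.
move: (lam * n%:R) (lam * d%:R * w%:R) => a b; move: (w%:R : rat) => c; clear -K lam0 lamd; lra.
Qed.

Lemma weights_newton f : weights_ok d f -> newton_ok lam f 0 0.
Proof.
move=> h s t; have [i [j [h1 h2]]] := h s t; exists i, j; split=> //.
by rewrite !muln1; apply: third_le.
Qed.

Lemma small_mult f a b : (forall i j, cf f i j != 0 -> (a <= i)%N /\ (b <= j)%N) ->
  (exists i j, cf f i j != 0 /\ (3 * (i + j - (a + b)) <= d)%N) -> mult_ok lam f.
Proof.
move=> hab [i [j [h1 h2]]]; exists a, b; split=> //; exists i, j; split=> //.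
have [ha hb] := hab _ _ h1.
rewrite -[(i + j)%N](@subnK (a + b)) ?leq_add // natrD mulrDr lerD2r.
by apply: (@third_le _ 1); rewrite muln1.
Qed.

Lemma small_mult2 f a b : (forall i j, cf f i j != 0 -> (a <= i)%N /\ (b <= j)%N) ->
  (exists i j i' j', [/\ cf f i j != 0, cf f i' j' != 0 &
     (3 * (i + j - (a + b)) <= d)%N \/ (3 * (i' + j' - (a + b)) <= d)%N]) -> mult_ok lam f.
Proof.
move=> hab [i [j [i' [j' [h h' []]]]]] hd; apply: (small_mult hab).
  by exists i, j.
by exists i', j'.
Qed.

(** At the satellite points of order two, monomials of minimal weight for the curves
    through the point give two bounds for the multiplicity, which cannot both
    exceed [d / 3]. *)
Lemma mult_corner0 f : weights_ok d f -> (forall i j, cf f i j != 0 -> (i + j <= d)%N) ->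
  mult_ok lam (blow0 (blow0 f)).
Proof.
move=> hw hd; have [i [j [h _]]] := hw 0%N 0%N.
have fn0 : f != 0 by apply: contraNneq h => ->; rewrite /cf mcoeff0.
have [i2 [j2 [h2 m2]]] := supp_min (fun i j => i + 2 * j)%N fn0.
have [i1 [j1 [h1 m1]]] := supp_min (fun i j => j)%N fn0.
apply: (@small_mult2 _ (i2 + 2 * j2) j1).
  move=> u v /cf_blow0_inv[w -> /cf_blow0_inv[w' -> hf]]; split; last exact: m1 hf.
  by have := m2 _ _ hf; clear; lia.
exists (i2 + j2 + j2)%N, j2, (i1 + j1 + j1)%N, j1.
split; [by do 2 apply: cf_blow0_nz|by do 2 apply: cf_blow0_nz|].
have a1 := hd _ _ h1; have a2 := m2 _ _ h1; have a3 := m1 _ _ h2.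
by move: a1 a2 a3; clear; lia.
Qed.

Lemma mult_corner_oo f : weights_ok d f -> (forall i j, cf f i j != 0 -> (i + j <= d)%N) ->
  mult_ok lam (blow_oo (blow_oo f)).
Proof.
move=> hw hd; have [i [j [h _]]] := hw 0%N 0%N.
have fn0 : f != 0 by apply: contraNneq h => ->; rewrite /cf mcoeff0.
have [i2 [j2 [h2 m2]]] := supp_min (fun i j => 2 * i + j)%N fn0.
have [i1 [j1 [h1 m1]]] := supp_min (fun i j => i)%N fn0.
apply: (@small_mult2 _ i1 (2 * i2 + j2)).
  move=> u v /cf_blow_oo_inv[w -> /cf_blow_oo_inv[w' -> hf]]; split; first exact: m1 hf.
  by have := m2 _ _ hf; clear; lia.
exists i2, (i2 + (i2 + j2))%N, i1, (i1 + (i1 + j1))%N.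
split; [by do 2 apply: cf_blow_oo_nz|by do 2 apply: cf_blow_oo_nz|].
have a1 := hd _ _ h1; have a2 := m2 _ _ h1; have a3 := m1 _ _ h2.
by move: a1 a2 a3; clear; lia.
Qed.

Lemma mult_middle0 f : weights_ok d f -> mult_ok lam (blow_oo (blow0 f)).
Proof.
move=> hw; have [i [j [h hm]]] := hw 1%N 1%N.
have fn0 : f != 0 by apply: contraNneq h => ->; rewrite /cf mcoeff0.
have [i2 [j2 [h2 m2]]] := supp_min (fun i j => i + 2 * j)%N fn0.
have [i1 [j1 [h1 m1]]] := supp_min (fun i j => i + j)%N fn0.
apply: (@small_mult2 _ (i1 + j1) (i2 + 2 * j2)).
  move=> u v /cf_blow_oo_inv[w -> /cf_blow0_inv[w' -> hf]]; split; first exact: m1 hf.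
  by have := m2 _ _ hf; clear; lia.
exists (i2 + j2)%N, (i2 + j2 + j2)%N, (i1 + j1)%N, (i1 + j1 + j1)%N.
split; [by apply: cf_blow_oo_nz; apply: cf_blow0_nz|by apply: cf_blow_oo_nz; apply: cf_blow0_nz|].
have a1 := m1 _ _ h; have a2 := m2 _ _ h1; have a3 := m1 _ _ h2.
by move: hm a1 a2 a3; clear; lia.
Qed.

Lemma mult_middle_oo f : weights_ok d f -> mult_ok lam (blow0 (blow_oo f)).
Proof.
move=> hw; have [i [j [h hm]]] := hw 1%N 1%N.
have fn0 : f != 0 by apply: contraNneq h => ->; rewrite /cf mcoeff0.
have [i2 [j2 [h2 m2]]] := supp_min (fun i j => 2 * i + j)%N fn0.
have [i1 [j1 [h1 m1]]] := supp_min (fun i j => i + j)%N fn0.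
apply: (@small_mult2 _ (2 * i2 + j2) (i1 + j1)).
  move=> u v /cf_blow0_inv[w -> /cf_blow_oo_inv[w' -> hf]]; split; last exact: m1 hf.
  by have := m2 _ _ hf; clear; lia.
exists (i2 + (i2 + j2))%N, (i2 + j2)%N, (i1 + (i1 + j1))%N, (i1 + j1)%N.
split; [by apply: cf_blow0_nz; apply: cf_blow_oo_nz|by apply: cf_blow0_nz; apply: cf_blow_oo_nz|].
have a1 := m1 _ _ h; have a2 := m2 _ _ h1; have a3 := m1 _ _ h2.
by move: hm a1 a2 a3; clear; lia.
Qed.

End Weights.

Definition shear_mx (c : K) : 'M[K]_3 := mx3 [:: [:: 1; 0; 0]; [:: c; 1; 0]; [:: 0; 0; 1]].

Lemma shear_unit c : shear_mx c \in unitmx.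
Proof.
apply: (@mx3_unit _ _ [:: [:: 1; 0; 0]; [:: - c; 1; 0]; [:: 0; 0; 1]]) => u v w.
by rewrite /= !row_app_mx3 //=; split; ring.
Qed.

(** A linear change of coordinates turns an arbitrary free point into the
    point [0] of the exceptional curve. *)
Lemma pull_shear c G : pull (Some c) (dehom G) = blow0 (dehom (subst_mx (shear_mx c) G)).
Proof.
apply: ev2_ext => a b; rewrite ev2_pull ev2_blow0 !ev2_dehom subst_ev3 !row_app_mx3 //=.
by congr ev3; ring.
Qed.

Lemma pull_finite c f : pull (Some c) (blow0 f) = f \mPo chart_finite c.
Proof.
apply: ev2_ext => a b; rewrite ev2_pull ev2_blow0 ev2_comp_pair !ev2E.
by congr ev2; ring.
Qed.

Lemma pull_infinite c f : pull (Some c) (blow_oo f) = f \mPo chart_infinite c.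
Proof.
apply: ev2_ext => a b; rewrite ev2_pull /blow_oo !ev2_comp_pair !ev2E.
by congr ev2; ring.
Qed.

(** The numerical criterion settles the points of order at most one and the satellite
    points of order two; all points over the latter follow.  The free points of
    order two are the subject of [conic_stage_good]. *)
Lemma semistable_good d (eps lam : rat) G :
  (3 <= d)%N -> 0 <= eps -> eps * (100 * d ^ 2)%:R <= 1 -> lam = (5 + eps) / (2 * d%:R) ->
  G \is d.-homog -> reduced G -> numerically_semistable d G ->
  eps = 0 \/ ~ pencil_product d G -> forall n, good lam n (dehom G) 0 0.
Proof.
move=> d3 eps0 epsd lamE hG rG hns hPN n.
have lam0 : 0 <= lam := ltW (lam_gt0 d3 eps0 lamE).
have lamd : lam * d%:R <= 3.
  have := lam_le (a := 1) (b := 1) (n := d) d3 eps0 lamE (leqnn _).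
  have : eps <= 1.
    by apply: le_trans epsd; rewrite ler_peMr // ler1n; move: d3; clear; nia.
  rewrite !mul1r; move: (lam * d%:R) => a; clear -K; lra.
have wG : weights_ok d (dehom G).
  by have := hns 1%:M (unitmx1 _ _); rewrite subst_mx1.
have nG := weights_newton lam0 lamd wG.
case: n => [|n]; first (split; [exact: newton_disc nG|exact: I]).
split; first exact: newton_disc nG.
case=> [c|] /=.
  rewrite pull_shear.
  have hG' := subst_homog (shear_mx c) hG.
  have rG' := subst_reduced (shear_unit c) rG.
  have nsG' := numerically_semistable_subst (shear_unit c) hns.
  have wG' : weights_ok d (dehom (subst_mx (shear_mx c) G)) by apply: hns; exact: shear_unit.
  have pG' : eps = 0 \/ ~ pencil_product d (subst_mx (shear_mx c) G).
    by case: hPN => [->|hp]; [left|right => /(pencil_product_subst (shear_unit c))].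
  move: (subst_mx (shear_mx c) G) hG' rG' nsG' wG' pG' => G' hG' rG' nsG' wG' pG'.
  have nG' := weights_newton lam0 lamd wG'.
  have dG' i j := cf_dehom_deg (i := i) (j := j) hG'.
  rewrite if_same.
  case: n => [|n]; first (split; [apply: newton_disc; exact: (newton_blow0 lam0 nG')|exact: I]).
  split; first (apply: newton_disc; exact: (newton_blow0 lam0 nG')).
  case=> [c'|] /=.
    have [->|c0] := eqVneq c' 0.
      rewrite pull0; apply: (newton_mult_good lam0).
        by exact: (newton_blow0 lam0 (newton_blow0 lam0 nG')).
      exact: (mult_corner0 lam0 lamd wG' dG').
    have G'n0 : dehom G' != 0 by exact: (newton_neq0 nG').
    have [i2 [j2 [h2 m2]]] := supp_min (fun i j => i + 2 * j)%N G'n0.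
    have Sd : (i2 + 2 * j2 <= d)%N.
      by have [i [j [/m2 h w]]] := wG' 1%N 2%N; move: h w; clear; lia.
    have [||k2 k2le [hk _]] := @pull_free _ (blow0 (dehom G')) c' (i2 + 2 * j2) (i2 + j2) j2 0
        ((i2 + 2 * j2)./2) (cf_blow0_nz h2) _ _ (or_introl c0).
    - by clear; lia.
    - by move=> u v /cf_blow0_inv[w -> _]; clear; lia.
    rewrite pull_finite; rewrite pull_finite in hk.
    apply: (conic_stage_good d3 eps0 epsd lamE hG' rG' (conic_arcs_finite c0)
      (pencil_arcs_finite c0) (tower_chart_finite c') pG' _ hk) => //.
      rewrite -pull_finite; apply: xdvd_pull; apply/xdvd_blow0 => u v /cf_blow0_inv[w -> /m2].
      by clear; lia.
    by move: k2le; clear; lia.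
  apply: (newton_mult_good lam0).
    by exact: (newton_blow_oo lam0 (newton_blow0 lam0 nG')).
  exact: (mult_middle0 lam0 lamd wG').
have dG i j := cf_dehom_deg (i := i) (j := j) hG.
case: n => [|n]; first (split; [apply: newton_disc; exact: (newton_blow_oo lam0 nG)|exact: I]).
split; first (apply: newton_disc; exact: (newton_blow_oo lam0 nG)).
case=> [c'|] /=.
  have [->|c0] := eqVneq c' 0.
    rewrite pull0; apply: (newton_mult_good lam0).
      by exact: (newton_blow0 lam0 (newton_blow_oo lam0 nG)).
    exact: (mult_middle_oo lam0 lamd wG).
  have Gn0 : dehom G != 0 by exact: (newton_neq0 nG).
  have [i2 [j2 [h2 m2]]] := supp_min (fun i j => 2 * i + j)%N Gn0.
  have Sd : (2 * i2 + j2 <= d)%N.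
    by have [i [j [/m2 h w]]] := wG 2%N 1%N; move: h w; clear; lia.
  have [||k2 k2le [hk _]] := @pull_free _ (blow_oo (dehom G)) c' (2 * i2 + j2) i2 (i2 + j2)
      (2 * i2 + j2 - (2 * i2 + j2)./2) (2 * i2 + j2) (cf_blow_oo_nz h2) _ _ (or_introl c0).
  - by clear; lia.
  - by move=> u v /cf_blow_oo_inv[w -> _]; clear; lia.
  rewrite pull_infinite; rewrite pull_infinite in hk.
  apply: (conic_stage_good d3 eps0 epsd lamE hG rG (conic_arcs_infinite c0)
    (pencil_arcs_infinite c0) (tower_chart_infinite c0) hPN _ hk) => //.
    rewrite -pull_infinite; apply: xdvd_pull; apply/xdvd_blow0 => u v /cf_blow_oo_inv[w -> /m2].
    by clear; lia.
  by move: k2le; clear; lia.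
apply: (newton_mult_good lam0).
  by exact: (newton_blow_oo lam0 (newton_blow_oo lam0 nG)).
exact: (mult_corner_oo lam0 lamd wG dG).
Qed.

End Local.

(** * Log canonicity in terms of discrepancies *)

Section LogCanonical.
Context {K : numClosedFieldType}.
Implicit Types (f g h u : {mpoly K[2]}) (F G : {mpoly K[3]}).

Local Notation x := ('X_ord0 : {mpoly K[2]}).
Local Notation y := ('X_ord_max : {mpoly K[2]}).

Lemma msupp_cf f (m : 'X_{1..2}) : (m \in msupp f) = (cf f (m ord0) (m ord_max) != 0).
Proof. by rewrite mcoeff_msupp /cf -mn2E. Qed.

Lemma ordE_le f i j : cf f i j != 0 -> (ordE f <= i)%N.
Proof.
move=> h; have hm : mn2 i j \in msupp f by rewrite mcoeff_msupp.
rewrite /ordE; elim: (msupp f) hm => // m s IH; rewrite inE big_cons => /predU1P[<-|/IH h1].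
  by rewrite mn2_0 geq_minl.
by apply: leq_trans h1; exact: geq_minr.
Qed.

Lemma ordE_ge f a : f != 0 -> xdvd f a -> (a <= ordE f)%N.
Proof.
move=> fn0 ha; rewrite /ordE big_seq.
elim/big_ind: _ => [|u v hu hv|m]; last by rewrite msupp_cf; exact: ha.
  have [i [j h]] := cf_supp_ex fn0; apply: leq_trans (ha _ _ h) _.
  by apply: leq_trans (ltnW (cf_bound h)); rewrite leq_addr.
by rewrite leq_min hu hv.
Qed.

Lemma pull_unit o u : ev2 u 0 0 != 0 -> ev2 (pull o u) 0 0 != 0.
Proof. by case: o => [c|]; rewrite /pull /chart !ev2E !(mul0r, mulr0). Qed.

(** The exceptional curves through a point infinitely near to the origin are
    among the coordinate axes; [p] and [q] are the orders of the Jacobian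
    determinant along them. *)
Lemma inf_near_good lam f phi : inf_near_chart phi -> (forall n, good lam n f 0 0) ->
  exists p q u, [/\ jacobian_det phi = x ^+ p * y ^+ q * u, ev2 u 0 0 != 0
    & forall n, good lam n (f \mPo phi) p q].
Proof.
elim=> [|{}phi c _ IH|{}phi _ IH] hf.
- exists 0%N, 0%N, 1; split; last 1 first.
  + by rewrite /idmap2 comp_mpoly_id.
  + by rewrite jacobianE !tnth_mktuple !deriv_X /= !expr0; ring.
  + by rewrite /ev2 meval1 oner_eq0.
- have [p [q [u [hJ u0 hg]]]] := IH hf.
  have cE : comp_map phi (map_pair x (x * (y + c%:MP))) = comp_map phi (chart (Some c)) by [].
  exists (p + q).+1, (nexty (Some c) p q),
    ((if c == 0 then 1 else (y + c%:MP) ^+ q) * pull (Some c) u); rewrite cE; split.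
  + rewrite jacobian_comp jacobian_finite hJ -!/(pull _ _) /=.
    apply: ev2_ext => a b; case: (eqVneq c 0) => [->|c0].
      by rewrite !(ev2M, ev2_pull, ev2Xn, ev2x, ev2y) /ev2 meval1 -!/(ev2 _ _ _) !addr0 exprS exprD exprMn; ring.
    by rewrite !(ev2M, ev2_pull, ev2Xn, ev2x, ev2y, ev2D, ev2C) exprS exprD exprMn; ring.
  + rewrite ev2M mulf_neq0 ?pull_unit //; case: (eqVneq c 0) => [_|c0].
      by rewrite /ev2 meval1 oner_eq0.
    by rewrite ev2Xn expf_neq0 // !ev2E add0r.
  + by move=> n; have [_ /(_ (Some c))] := hg n.+1; rewrite comp_comp_map.
have [p [q [u [hJ u0 hg]]]] := IH hf.
have cE : comp_map phi (map_pair (x * y) y) = comp_map phi (chart None) by [].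
exists p, (p + q).+1, (pull None u); rewrite cE; split.
- rewrite jacobian_comp jacobian_infinity hJ -!/(pull _ _).
  by apply: ev2_ext => a b; rewrite /pull /chart !ev2E exprS exprD exprMn; ring.
- exact: pull_unit.
- by move=> n; have [_ /(_ None)] := hg n.+1; rewrite comp_comp_map.
Qed.

Lemma ev2_unit_neq0 u : ev2 u 0 0 != 0 -> u != 0.
Proof. by apply: contraNneq => ->; rewrite /ev2 meval0. Qed.

Lemma good_log_canonical lam f : lam <= 1 -> 0 <= lam -> square_free f ->
  (forall n, good lam n f 0 0) -> log_canonical_origin f lam.
Proof.
move=> lam1 lam0 sf hf; split=> [phi hphi|g h k g0 fE].
  have [p [q [u [hJ u0 hg]]]] := inf_near_good hphi hf.
  have [[i [j [hij hd]]] _] := hg 0%N.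
  have cE : blowup_chart phi = comp_map phi (map_pair x (x * y)) by [].
  have bE : jacobian_det (map_pair x (x * y)) = x :> {mpoly K[2]}.
    by have := jacobian_finite (0 : K); rewrite /chart mpolyC0 addr0.
  rewrite /discrepancy cE jacobian_comp bE hJ comp_comp_map -!/(blow0 _).
  have h1 : (ordE (blow0 (f \mPo phi)) <= i + j)%N by apply: ordE_le (cf_blow0_nz hij).
  have h2 : ((p + q).+1 <= ordE (blow0 (x ^+ p * y ^+ q * u) * x))%N.
    have -> : blow0 (x ^+ p * y ^+ q * u) * x = x ^+ (p + q).+1 * (y ^+ q * blow0 u).
      by apply: ev2_ext => a b; rewrite !(ev2M, ev2_blow0, ev2Xn, ev2x, ev2y) exprS exprD exprMn; ring.
    apply: ordE_ge; last exact: xdvd_xmul.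
    rewrite !mulf_neq0 ?expf_neq0 //.
    - by apply: contraTneq (oner_neq0 K) => e; rewrite -(ev2x 1 1) e /ev2 meval0 eqxx.
    - by apply: contraTneq (oner_neq0 K) => e; rewrite -(ev2y 1 1) e /ev2 meval0 eqxx.
    - by apply: ev2_unit_neq0; rewrite ev2_blow0 mul0r.
  have h3 : ((p + q).+1)%:R <= (ordE (blow0 (x ^+ p * y ^+ q * u) * x))%:R :> rat.
    by rewrite ler_nat.
  have h4 := lam_mono lam0 h1.
  have hd' : lam * (i + j)%:R <= ((p + q).+1)%:R + 1 by rewrite natr1 -addn2.
  move: h3 h4 hd'; move: (((p + q).+1)%:R : rat) (lam * _) (lam * _) => a b c.
  by move: (_%:R : rat) => e; clear -K; lra.
case: k fE => [|[|k]] fE; [by rewrite mulr0|by rewrite mulr1|].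
have := sf g (g ^+ k * h); rewrite mulrA -exprD => /(_ fE).
move=> /unitrP[g' [_ e]]; have /eqP := mevalM (fun=> 0 : K) g g'.
by rewrite e g0 mul0r meval1 oner_eq0.
Qed.

Lemma row_nz (P : 'rV[K]_3) : P != 0 -> exists i, P 0 i != 0.
Proof.
move=> P0; case: (pickP (fun i => P 0 i != 0)) => [i hi|h]; first by exists i.
by case/eqP: P0; apply/rowP => i; rewrite mxE; have /negbT := h i; rewrite negbK => /eqP.
Qed.

(** The matrix has two coordinate vectors and [P] as columns. *)
Lemma chart_eqE i (P : 'rV[K]_3) : P 0 i != 0 -> exists A : 'M[K]_3,
  [/\ A \in unitmx, forall k, A k (inord 2) = P 0 k
    & forall F, chart_eq i P F = dehom (subst_mx A F)].
Proof.
move=> Pi.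
pose A : 'M[K]_3 := \matrix_(k, l) if l == inord 2 then P 0 k
  else oapp (fun j : 'I_2 => (l == j :> nat)%:R) 0 (unlift i k).
have A2 k : A k (inord 2) = P 0 k by rewrite mxE eqxx.
have AE k a b : row_app A k a b 1 = oapp (fun j : 'I_2 => if j == ord0 then a else b) 0
    (unlift i (inord k)) + P 0 (inord k).
  rewrite /row_app A2 !mxE !inord3_eq //= !inordK //.
  case: (unlift i (inord k)) => [j|] /=; last by rewrite !(mul0r, mulr1, addr0).
  by case: (ord2P j) => -> /=; rewrite !(mul0r, mulr1, mul1r, addr0, add0r).
exists A; split=> [|//|F]; last first.
  apply: ev2_ext => a b; rewrite ev2_dehom subst_ev3 !AE /ev2 /chart_eq comp_mpoly_meval ev3_meval.
  congr ev3; rewrite tnth_mktuple mevalD mevalC addrC; congr (_ + _);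
    by case: unlift => [j|] /=; rewrite ?meval0 ?mevalXU.
rewrite -unitmx_tr -row_free_unit; apply: inj_row_free => v vA.
have vk k : v 0 (inord 0) * A k (inord 0) + v 0 (inord 1) * A k (inord 1) + v 0 (inord 2) * P 0 k = 0.
  by have /rowP/(_ k) := vA; rewrite [in RHS]mxE mxE big_ord3 ![A^T _ _]mxE A2.
have v2 : v 0 (inord 2) = 0.
  have := vk i; rewrite !mxE !inord3_eq //= unlift_none /= !mulr0 !add0r => /eqP.
  by rewrite mulf_eq0 (negbTE Pi) orbF => /eqP.
have vj (j : 'I_2) : v 0 (inord j) = 0.
  have := vk (lift i j); rewrite v2 mul0r addr0 !mxE !inord3_eq //= liftK /= !inordK //.
  by case: (ord2P j) => -> /=; rewrite !(mulr0, mulr1, addr0, add0r).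
by apply/rowP => k; rewrite mxE; case: (ord3P k) => -> //; [exact: (vj ord0)|exact: (vj ord_max)].
Qed.

(** The multiplicities of the components, which the second clause of log canonicity
    bounds, are one. *)
Lemma semistable_log_canonical d (eps lam : rat) F P :
  (3 <= d)%N -> 0 <= eps -> eps * (100 * d ^ 2)%:R <= 1 -> lam = (5 + eps) / (2 * d%:R) ->
  F \is d.-homog -> reduced F -> numerically_semistable d F ->
  eps = 0 \/ ~ pencil_product d F -> log_canonical_at P F lam.
Proof.
move=> d3 eps0 epsd lamE hF rF hns hPN i Pi.
have [A [uA _ ->]] := chart_eqE Pi.
have hG := subst_homog A hF; have rG := subst_reduced uA rF.
apply: good_log_canonical.
- have := lam_le1 d3 eps0 lamE; have := eps_small d3 eps0 epsd; move: lam eps {lamE eps0 epsd hPN} => l e.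
  by clear -K; lra.
- exact: ltW (lam_gt0 d3 eps0 lamE).
- exact: reduced_square_free hG rG.
- apply: (semistable_good d3 eps0 epsd lamE hG rG).
    exact: numerically_semistable_subst.
  by case: hPN => [->|hp]; [left|right => /(pencil_product_subst uA)].
Qed.

End LogCanonical.

(** * One-parameter subgroups and degenerations *)

Section GIT.
Context {K : numClosedFieldType}.
Implicit Types (F G : {mpoly K[3]}).

Local Notation X0 := ('X_(inord 0) : {mpoly K[3]}).
Local Notation X1 := ('X_(inord 1) : {mpoly K[3]}).
Local Notation X2 := ('X_(inord 2) : {mpoly K[3]}).

Lemma horner_mmap n (J : {mpoly K[n]}) (v : 'I_n -> {poly K}) t :
  (mmap polyC v J).[t] = J.@[fun i => (v i).[t]].
Proof.
rewrite /mmap horner_sum mevalE; apply: eq_bigr => m _.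
rewrite hornerCM /mmap1 horner_prod; congr (_ * _); apply: eq_bigr => i _.
by rewrite horner_exp.
Qed.

(** Along an algebraic family the value is a polynomial in [t]. *)
Lemma limit_value d (J : form_poly d) (Fs : K -> {mpoly K[3]}) (p : 'X_{1..3} -> {poly K}) C :
  (forall t m, (Fs t)@_m = (p m).[t]) ->
  (forall t, t != 0 -> J.@[coefs d (Fs t)] = C) -> J.@[coefs d (Fs 0)] = C.
Proof.
move=> hp hC; pose P := mmap polyC (fun k : 'I_#|{: form_monomial d}| => p (val (enum_val k))) J.
have PE t : P.[t] = J.@[coefs d (Fs t)].
  by rewrite horner_mmap; apply: meval_eq => k; rewrite /coefs hp.
have : P - C%:P = 0.
  by apply: poly_vanish_nz => t t0; rewrite hornerD hornerN hornerC PE hC // subrr.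
by move=> /subr0_eq e; rewrite -PE e hornerC.
Qed.

Lemma invariant_scale d n (J : form_poly d) (k : K) F : J \is n.-homog ->
  J.@[coefs d (k *: F)] = k ^+ n * J.@[coefs d F].
Proof.
move=> hJ; rewrite -(homog_scale _ _ hJ); apply: meval_eq => i.
by rewrite /coefs mcoeffZ.
Qed.

Lemma subst_scale d (k : K) (A : 'M[K]_3) F : F \is d.-homog ->
  subst_mx (k *: A) F = k ^+ d *: subst_mx A F.
Proof.
move=> hF; apply: mpoly_ext => v; rewrite mevalZ !subst_eval -(homog_scale _ _ hF).
apply: meval_eq => i; rewrite mulr_sumr; apply: eq_bigr => j _.
by rewrite mxE mulrA.
Qed.

(** A cube root of the determinant reduces the statement to [SL_3] and to scalars,
    which act by homogeneity. *)
Lemma relative_invariance d (J : form_poly d) (A : 'M[K]_3) : SL3_invariant J ->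
  A \in unitmx -> exists2 k, k != 0 & forall F, F \is d.-homog ->
    J.@[coefs d (subst_mx A F)] = k * J.@[coefs d F].
Proof.
move=> [[n n0 hJ] hinv] uA; pose c := 3.-root (\det A).
have c3 : c ^+ 3 = \det A by rewrite rootCK.
have c0 : c != 0.
  apply: contraTneq uA => ce; rewrite unitmxE -c3 ce expr0n /=.
  by rewrite unitr0.
exists (c ^+ (d * n)); first by rewrite expf_neq0.
move=> F hF; have AE : A = c *: (c^-1 *: A) by rewrite scalerA divff // scale1r.
rewrite {1}AE (subst_scale _ _ hF) (invariant_scale _ _ hJ) -exprM hinv //.
by rewrite detZ -c3 exprVn mulVf // expf_neq0.
Qed.

Definition diag3 (a b c : K) : 'M[K]_3 := mx3 [:: [:: a; 0; 0]; [:: 0; b; 0]; [:: 0; 0; c]].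

Lemma det_diag3 a b c : \det (diag3 a b c) = a * b * c.
Proof.
rewrite det_trig ?big_ord3 ?mxE ?inordK //=.
apply/is_trig_mxP => i j; rewrite mxE.
by case: (ord3P i) => ->; case: (ord3P j) => ->; rewrite !inordK.
Qed.

Lemma subst_diag3 a b c F u v w : ev3 (subst_mx (diag3 a b c) F) u v w = ev3 F (a * u) (b * v) (c * w).
Proof. by rewrite subst_ev3 !row_app_mx3 //= !mul0r !addr0 !add0r. Qed.

Lemma mcoeff_diag3 a b c F i j k :
  (subst_mx (diag3 a b c) F)@_(mn3 i j k) = a ^+ i * b ^+ j * c ^+ k * F@_(mn3 i j k).
Proof.
suff -> : subst_mx (diag3 a b c) F = \sum_(m <- msupp F)
    (a ^+ m (inord 0) * b ^+ m (inord 1) * c ^+ m (inord 2) * F@_m) *: 'X_[m].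
  rewrite raddf_sum /=.
  under eq_bigr => m _ do rewrite mcoeffZ mcoeffX.
  have [e0 e1 e2] := mn3_val i j k.
  case: (boolP (mn3 i j k \in msupp F)) => [hm|/memN_msupp_eq0 hm].
    rewrite (bigD1_seq _ hm) ?msupp_uniq //= eqxx mulr1 e0 e1 e2 big1 ?addr0 // => m mn.
    by rewrite (negbTE mn) mulr0.
  rewrite hm mulr0 big1_seq // => m /andP[_ hm']; case: eqP => [e|]; last by rewrite mulr0.
  by rewrite e hm !(mulr0, mul0r).
apply: ev3_ext => u v w; rewrite subst_diag3 /ev3 [in LHS]mevalE raddf_sum /=.
apply: eq_bigr => m _; rewrite mevalZ mevalX !big_ord3 /=.
have [-> -> ->] := vec3_val (a * u) (b * v) (c * w).
by have [-> -> ->] := vec3_val u v w; rewrite !exprMn; ring.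
Qed.

(** The easy half of the Hilbert-Mumford criterion: if all weights were positive, a
    one-parameter subgroup would contract the form to zero, where homogeneous
    invariants vanish. *)
Lemma semistable_numerically d F : F \is d.-homog -> GIT_semistable d F ->
  numerically_semistable d F.
Proof.
move=> hF [J [hJ JF]] A uA s t.
have [k k0 hk] := relative_invariance hJ uA; have hG := subst_homog A hF.
have {k k0 hk JF} : J.@[coefs d (subst_mx A F)] != 0 by rewrite hk // mulf_neq0.
move: (subst_mx A F) hG => G hG; apply: contra_neqP => hns.
have hw i j : cf (dehom G) i j != 0 -> (d * (s + t) < 3 * (s * i + t * j))%N.
  by move=> h; rewrite ltnNge; apply/negP => h'; apply: hns; exists i, j.
have [[n n0 homJ] hinv] := hJ.
pose w (m : 'X_{1..3}) := (3 * (s * m (inord 0) + t * m (inord 1)) - d * (s + t))%N.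
have Gm m : G@_m != 0 -> (mdeg m = d) /\ (d * (s + t) < 3 * (s * m (inord 0) + t * m (inord 1)))%N.
  move=> h; have md : mdeg m = d by apply: (dhomog_mf hG); rewrite mcoeff_msupp.
  split=> //; apply: hw; rewrite (cf_dehom _ _ hG); rewrite (mn3E m) mdeg_mn3 in md.
  by rewrite -{1}md leq_addr -{1}md addnC addnK -mn3E.
pose Fs tau : {mpoly K[3]} := \sum_(m <- msupp G) (tau ^+ w m * G@_m) *: 'X_[m].
have FsE tau m : (Fs tau)@_m = (G@_m *: 'X^(w m)).[tau].
  rewrite /Fs raddf_sum /= hornerZ hornerXn mulrC.
  under eq_bigr => m' _ do rewrite mcoeffZ mcoeffX.
  case: (boolP (m \in msupp G)) => [hm|/memN_msupp_eq0 hm].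
    rewrite (bigD1_seq _ hm) ?msupp_uniq //= eqxx mulr1 big1 ?addr0 // => m' mn.
    by rewrite (negbTE mn) mulr0.
  rewrite hm mulr0 big1_seq // => m' /andP[_ hm']; case: eqP => [e|]; last by rewrite mulr0.
  by rewrite e hm !(mulr0, mul0r).
rewrite -(limit_value (J := J) FsE (C := J.@[coefs d G])); last first.
  move=> tau tau0.
  rewrite -(hinv (diag3 (tau ^+ (2 * s) / tau ^+ t) (tau ^+ (2 * t) / tau ^+ s) (tau ^+ (s + t))^-1) G) //.
    apply: meval_eq => k; rewrite /coefs FsE hornerZ hornerXn; move: (val _) => m.
    rewrite [X in _ = (subst_mx _ _)@_X](mn3E m) mcoeff_diag3 -mn3E mulrC.
    case: (eqVneq G@_m 0) => [->|/Gm[md hm]]; first by rewrite !mulr0.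
    congr (_ * _); rewrite /w; rewrite (mn3E m) mdeg_mn3 in md.
    move: (m (inord 0)) (m (inord 1)) (m (inord 2)) md hm => i j l md hm.
    have eW : (3 * (s * i + t * j) - d * (s + t) + (t * i + s * j + (s + t) * l) =
               2 * s * i + 2 * t * j)%N by move: md hm; clear; nia.
    rewrite !exprMn !exprVn -!exprM.
    have nz k' : tau ^+ k' != 0 by rewrite expf_neq0.
    apply: (mulIf (nz (t * i + s * j + (s + t) * l)%N)); rewrite -exprD eW !exprD.
    by field; rewrite !nz.
  rewrite det_diag3 !mul2n -!addnn !exprD; move: (tau ^+ s) (tau ^+ t) (expf_neq0 s tau0) (expf_neq0 t tau0).
  by move=> a b a0 b0; field; rewrite a0 b0.
have -> : J.@[coefs d (Fs 0)] = J.@[coefs d (0 *: G)].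
  apply: meval_eq => k; rewrite /coefs FsE mcoeffZ mul0r hornerZ hornerXn.
  move: (val _) => m; case: (eqVneq G@_m 0) => [->|/Gm[_ hm]]; first by rewrite mul0r.
  by rewrite expr0n /w subn_eq0 leqNgt hm /= mulr0.
by rewrite (invariant_scale _ _ homJ) expr0n eqn0Ngt n0 mul0r.
Qed.

Lemma reduced_scale (k : K) F : k != 0 -> reduced F -> reduced (k *: F).
Proof.
move=> k0 [Fn0 hF]; split; first by rewrite scaler_eq0 (negbTE k0).
move=> G H e; apply: (hF G (k^-1 *: H)).
by rewrite -scalerAr -e scalerA mulVf // scale1r.
Qed.

Lemma pencil_diag3 rho (t : K) : t != 0 ->
  subst_mx (diag3 1 t t^-1) (pencil rho) = pencil (rho * t ^+ 2).
Proof.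
move=> t0; apply: ev3_ext => a b c; rewrite subst_diag3 !ev3_pencil; field.
exact: t0.
Qed.

Lemma pencil0 : pencil (0 : K) = conic.
Proof. by rewrite /pencil scale0r subr0. Qed.

Lemma power_conic_homog m : (conic : {mpoly K[3]}) ^+ m \is (2 * m).-homog.
Proof. by apply: dhomogMn; exact: conic_homog. Qed.

Lemma pencil_prod_homog m (rho : 'I_m -> K) : \prod_i pencil (rho i) \is (2 * m).-homog.
Proof.
apply: ev3_homog => a b c; rewrite !ev3_prod exprM.
have -> : (2%:R ^+ 2) ^+ m = \prod_(i < m) (2%:R ^+ 2) :> K by rewrite prodr_const card_ord.
rewrite -big_split.
by apply: eq_bigr => i _; rewrite !ev3_pencil /=; ring.
Qed.

Lemma pencil_prod_family m (rho : 'I_m -> K) : exists p : 'X_{1..3} -> {poly K},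
  forall t mon, (\prod_i pencil (rho i * t ^+ 2))@_mon = (p mon).[t].
Proof.
pose q : {mpoly {poly K}[3]} := \prod_i
  ('X_(inord 1) * 'X_(inord 2) - 'X_(inord 0) ^+ 2 - (rho i *: 'X ^+ 2) *: 'X_(inord 1) ^+ 2).
exists (fun mon => q@_mon) => t mon.
have -> : \prod_i pencil (rho i * t ^+ 2) = map_mpoly (horner_eval t) q.
  rewrite rmorph_prod; apply: eq_bigr => i _; rewrite /= !rmorphB rmorphM /= map_mpolyZ !rmorphXn /=.
  by rewrite !map_mpolyX /pencil /conic /= /horner_eval hornerZ hornerXn.
by rewrite mcoeff_map_mpoly.
Qed.

Lemma pencil_degeneration m (rho : 'I_m -> K) t : t != 0 ->
  \prod_i pencil (rho i * t ^+ 2) = subst_mx (diag3 1 t t^-1) (\prod_i pencil (rho i)).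
Proof. by move=> t0; rewrite subst_prod; apply: eq_bigr => i _; rewrite pencil_diag3. Qed.

Lemma pencil_degenerate m (rho : 'I_m -> K) : \prod_i pencil (rho i * 0 ^+ 2) = conic ^+ m.
Proof.
under eq_bigr => i _ do rewrite expr0n mulr0 pencil0.
by rewrite prodr_const card_ord.
Qed.

Lemma det_pencil_diag (t : K) : t != 0 -> \det (diag3 1 t t^-1) = 1.
Proof. by move=> t0; rewrite det_diag3 mul1r divff. Qed.

Lemma pencil_invariant d (J : form_poly d) (rho : 'I_(d./2) -> K) : ~~ odd d -> SL3_invariant J ->
  J.@[coefs d (conic ^+ d./2)] = J.@[coefs d (\prod_i pencil (rho i))].
Proof.
move=> ed [_ hinv]; have [p hp] := pencil_prod_family rho.
have dE : d = (2 * d./2)%N by rewrite mul2n halfK (negbTE ed) subn0.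
have homP : \prod_i pencil (rho i) \is d.-homog by have := pencil_prod_homog rho; rewrite -dE.
rewrite -(pencil_degenerate rho); apply: (limit_value hp) => t t0.
by rewrite pencil_degeneration // hinv ?det_pencil_diag.
Qed.

(** Scaling contracts the conics of the pencil to a multiple conic, which is
    not in the orbit of a reduced curve. *)
Lemma pencil_not_stable d F : F \is d.-homog -> reduced F -> ~~ odd d -> (2 <= d./2)%N ->
  pencil_product d F -> ~ GIT_stable d F.
Proof.
move=> hF rF ed d2 [B [k [rho [uB k0 FE]]]] [_ [J [hJ JF closed]]].
have dE : d = (2 * d./2)%N by rewrite mul2n halfK (negbTE ed) subn0.
have homC : (conic : {mpoly K[3]}) ^+ d./2 \is d.-homog by have := power_conic_homog d./2; rewrite -dE.
have PE : \prod_i pencil (rho i) = k^-1 *: subst_mx B F.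
  by rewrite FE scalerA mulVf // scale1r.
have JC : J.@[coefs d (conic ^+ d./2)] != 0.
  rewrite (pencil_invariant rho ed hJ) PE.
  have [[n n0 homJ] _] := hJ; have [l l0 hl] := relative_invariance hJ uB.
  by rewrite (invariant_scale _ _ homJ) hl // !mulf_neq0 ?expf_neq0 ?invr_eq0.
have cl : in_orbit_closure d F (conic ^+ d./2).
  have [p hp] := pencil_prod_family rho.
  move=> n J' homJ' hJ'; rewrite -(pencil_degenerate rho); apply: (limit_value hp) => t t0; apply: hJ'.
  exists (B *m diag3 1 t t^-1), k^-1; split; [|by rewrite invr_eq0|].
    by rewrite unitmx_mul uB unitmxE det_pencil_diag // unitr1.
  by rewrite pencil_degeneration // PE substZ subst_mxM.
have [A [c [uA c0 e]]] := closed _ _ hF homC JF JC cl.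
have [_ rC] := reduced_scale c0 (subst_reduced uA rF).
have /negP[] := @conic_not_unit K; apply: (rC _ (conic ^+ (d./2 - 2))).
by rewrite -e -exprD subnKC.
Qed.

End GIT.

(** * Local intersection with a conic *)

Section LocalIntersection.
Context {K : numClosedFieldType}.
Implicit Types (f g h : {mpoly K[2]}) (F G H : {mpoly K[3]}) (C : 'M[K]_3).

Local Notation X0 := ('X_(inord 0) : {mpoly K[3]}).
Local Notation X1 := ('X_(inord 1) : {mpoly K[3]}).
Local Notation X2 := ('X_(inord 2) : {mpoly K[3]}).

Lemma ev2_origin h : ev2 h 0 0 = h.@[fun=> 0].
Proof. by apply: meval_eq => i; case: ifP. Qed.

Definition affine C F := dehom (subst_mx C F).

Lemma affineM C F G : affine C (F * G) = affine C F * affine C G.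
Proof. by rewrite /affine substM dehomM. Qed.

Lemma affineD C F G : affine C (F + G) = affine C F + affine C G.
Proof. by rewrite /affine /subst_mx /dehom !comp_mpolyD. Qed.

Lemma affineZ C k F : affine C (k *: F) = k *: affine C F.
Proof. by rewrite /affine /subst_mx /dehom !comp_mpolyZ. Qed.

Lemma affine0 C : affine C 0 = 0.
Proof. by rewrite /affine subst0 /dehom comp_mpoly0. Qed.

Lemma affine_sum C n (E : 'I_n -> {mpoly K[3]}) :
  affine C (\sum_i E i) = \sum_i affine C (E i).
Proof. exact: (big_morph _ (affineD C) (affine0 C)). Qed.

Lemma affine_inj C d F G : C \in unitmx -> F \is d.-homog -> G \is d.-homog ->
  affine C F = affine C G -> F = G.
Proof.
move=> uC hF hG /(dehom_inj (subst_homog C hF) (subst_homog C hG)) e.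
by rewrite -(subst_mxKV F uC) e subst_mxKV.
Qed.

Lemma affine_surj C h e : C \in unitmx -> (msize h <= e.+1)%N ->
  exists2 H, H \is e.-homog & affine C H = h.
Proof.
move=> uC hh; exists (subst_mx (invmx C) (homogenize e h)).
  exact: subst_homog (homogenize_homog hh).
by rewrite /affine subst_mxK // dehom_homogenize.
Qed.

Definition fixes_origin C := exists2 l, l != 0 & forall k, C k (inord 2) = if k == inord 2 then l else 0.

Lemma affine_origin C e F : fixes_origin C -> F \is e.-homog ->
  exists2 l, l != 0 & ev2 (affine C F) 0 0 = l * (restr F).[0].
Proof.
move=> [l l0 hC] hF; exists (l ^+ e); first by rewrite expf_neq0.
rewrite /affine ev2_dehom subst_ev3 /row_app !hC !inord3_eq //= horner_restr.
rewrite expr0n /= -(ev3_scale _ _ _ _ hF); congr ev3; ring.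
Qed.

Lemma restr_homog_size e F r (p : {poly K}) : F \is e.-homog -> restr F = 'X^r * p ->
  (size p <= (2 * e).+1)%N.
Proof.
move=> /size_restr h eF; rewrite eF in h; have [->|p0] := eqVneq p 0; first by rewrite size_poly0.
apply: leq_trans h; rewrite mulrC size_Mmonic ?monicXn // size_polyXn addnS /= leq_addr //.
Qed.

(** On the conic [G] is ['X^r] times a unit of the local ring, so it divides [H]
    there.  Lifted to forms, the quotient leaves a remainder that is divisible by
    the equation of the conic. *)
Lemma local_member C l e G H r (p q : {poly K}) : C \in unitmx -> fixes_origin C ->
  G \is l.-homog -> restr G = 'X^r * p -> p.[0] != 0 ->
  H \is e.-homog -> restr H = 'X^r * q ->
  in_local_ideal (affine C conic) (affine C G) (affine C H).
Proof.
move=> uC fC hG eG p0 hH eH.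
have [U hU eU] := restr_surj (restr_homog_size hG eG).
have [W hW eW] := restr_surj (restr_homog_size hH eH).
have hT : U * H - G * W \is (l + e).-homog by apply: rpredB; apply: dhomogM.
have [s|B eT] := conic_dvd hT.
  by apply: restr_eq0; rewrite restrB !restrM eU eW eG eH; ring.
exists (affine C U), (affine C B), (affine C W); split.
  have [k k0] := affine_origin fC hU; rewrite ev2_origin => ->.
  by rewrite mulf_neq0 // eU.
have e' : U * H = B * conic + W * G by rewrite -[U * H](subrK (G * W)) eT; ring.
have := congr1 (affine C) e'; rewrite affineD !affineM; exact.
Qed.

Definition restr_monomial (i : nat) : {mpoly K[3]} :=
  nth 0 [:: X2 ^+ 2; X0 * X2; X1 * X2; X0 * X1] i.

Lemma restr_monomialE i : (i < 4)%N -> restr (restr_monomial i) = 'X^i.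
Proof.
by case: i => [|[|[|[|]]]] // _; apply: poly_ext => s;
  rewrite horner_restr /restr_monomial /= !ev3E hornerXn; ring.
Qed.

Lemma restr_monomial_homog i : (i < 4)%N -> restr_monomial i \is 2.-homog.
Proof.
by case: i => [|[|[|[|]]]] // _; apply: ev3_homog => a b c; rewrite /restr_monomial /= !ev3E; ring.
Qed.

Lemma restr_sum n (E : 'I_n -> {mpoly K[3]}) : restr (\sum_i E i) = \sum_i restr (E i).
Proof.
apply: (big_morph _ restrD); apply: poly_ext => s.
by rewrite horner_restr horner0 /ev3 meval0.
Qed.

(** [U] is invertible modulo ['X^4]. *)
Lemma truncated_division (P U : {poly K}) : U.[0] != 0 ->
  exists! c : 'rV[K]_4, 'X^4 %| P - U * \sum_(i < 4) c 0 i *: 'X^i.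
Proof.
move=> U0; have cop : coprimep 'X^4 U.
  by apply: coprimep_expl; rewrite coprimep_sym coprimepX.
pose S (c : 'rV[K]_4) : {poly K} := \sum_(i < 4) c 0 i *: 'X^i.
have SE c : S c = \poly_(i < 4) (if insub i is Some j then c 0 j else 0).
  by rewrite poly_def; apply: eq_bigr => i _; rewrite valK.
have [[u v] /= euv] := Bezout_eq1_coprimepP _ _ cop.
pose c : 'rV[K]_4 := \row_i (P * v)`_i.
have Sc : S c = take_poly 4 (P * v).
  by rewrite SE; apply/polyP => i; rewrite coef_poly coef_take_poly; case: ltnP => // i4;
    rewrite insubT mxE.
have hc : 'X^4 %| P - U * S c.
  have e1 : P * v = take_poly 4 (P * v) + drop_poly 4 (P * v) * 'X^4 by rewrite poly_take_drop.
  apply/dvdpP; exists (P * u + U * drop_poly 4 (P * v)).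
  rewrite Sc; move: (take_poly _ _) (drop_poly _ _) e1 => a b e1.
  have -> : a = P * v - b * 'X^4 by rewrite e1 addrK.
  by rewrite -{1}[P]mulr1 -euv; ring.
exists c; split=> // c' hc'.
have : 'X^4 %| U * (S c - S c').
  have -> : U * (S c - S c') = (P - U * S c') - (P - U * S c) by ring.
  by rewrite dvdp_sub.
rewrite Gauss_dvdpr // => /dvdpP[w ew].
have sS : (size (S c - S c')%R <= 4)%N.
  by rewrite (leq_trans (size_polyD _ _)) // geq_max size_polyN !SE !size_poly.
have w0 : w = 0.
  apply/eqP; rewrite -size_poly_eq0; move: sS; have [->|w0] := eqVneq w 0; first by rewrite size_poly0.
  by rewrite ew size_Mmonic ?monicXn // size_polyXn; move: (size w) => k; clear; lia.
move: ew; rewrite w0 mul0r => /subr0_eq e; apply/rowP => i.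
have := congr1 (fun p : {poly K} => p`_i) e.
by rewrite !SE !coef_poly ltn_ord valK.
Qed.

Lemma sum_restr_monomials (c : 'rV[K]_4) : 
  \sum_(i < 4) c 0 i *: restr_monomial i \is 2.-homog /\
  restr (\sum_(i < 4) c 0 i *: restr_monomial i) = \sum_(i < 4) c 0 i *: 'X^i.
Proof.
split; first by apply: rpred_sum => i _; apply: rpredZ; exact: restr_monomial_homog.
by rewrite restr_sum; apply: eq_bigr => i _; rewrite restrZ restr_monomialE.
Qed.

Lemma restr_pencil (sigma : K) : restr (pencil sigma) = 'X^4 * (- sigma)%:P.
Proof.
by apply: poly_ext => s; rewrite horner_restr ev3_pencil hornerM hornerXn hornerC; ring.
Qed.

Lemma pencil_homog (sigma : K) : pencil sigma \is 2.-homog.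
Proof. by apply: ev3_homog => a b c; rewrite !ev3_pencil; ring. Qed.

(** The other conic restricts to a multiple of ['X^4] on the first one, so the powers
    of the parameter up to the third form a basis of the local ring. *)
Lemma pencil_intersection C sigma : C \in unitmx -> fixes_origin C -> sigma != 0 ->
  local_intersection (affine C conic) (affine C (pencil sigma)) 4.
Proof.
move=> uC fC s0; exists (fun i => affine C (restr_monomial i)) => h u u0.
pose e := (msize h + msize u)%N.
have [H hH eH] : exists2 H, H \is (e + 2).-homog & affine C H = h.
  by apply: affine_surj => //; rewrite /e; move: (msize h) (msize u); clear; lia.
have [U hU eU] : exists2 U, U \is e.-homog & affine C U = u.
  by apply: affine_surj => //; rewrite /e; move: (msize h) (msize u); clear; lia.
have U0 : (restr U).[0] != 0.
  have [l l0] := affine_origin fC hU; rewrite eU ev2_origin => eu.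
  by move: u0; rewrite eu mulf_eq0 negb_or => /andP[].
clearbody e.
pose T (c : 'rV[K]_4) := H - U * \sum_(i < 4) c 0 i *: restr_monomial i.
have hT c : T c \is (e + 2).-homog.
  by apply: rpredB => //; apply: dhomogM => //; case: (sum_restr_monomials c).
have rT c : restr (T c) = restr H - restr U * \sum_(i < 4) c 0 i *: 'X^i.
  by rewrite restrB restrM; case: (sum_restr_monomials c) => _ ->.
have aT c : affine C (T c) = h - u * \sum_(i < 4) c 0 i *: affine C (restr_monomial i).
  rewrite /T affineD -scaleN1r affineZ affineM eU eH affine_sum scaleN1r.
  by congr (_ - _ * _); apply: eq_bigr => i _; rewrite affineZ.
have mem c : in_local_ideal (affine C conic) (affine C (pencil sigma)) (affine C (T c)) <->
    'X^4 %| restr (T c).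
  split=> [[v [a [b [v0 ev]]]]|/dvdpP[q eq]]; last first.
    apply: (local_member uC fC (pencil_homog sigma) (restr_pencil sigma) _ (hT c)).
      by rewrite hornerC oppr_eq0.
    by rewrite eq mulrC.
  pose N := (msize v + msize a + msize b)%N.
  have [V hV eV] : exists2 V, V \is N.-homog & affine C V = v.
    by apply: affine_surj => //; rewrite /N; move: (msize v) (msize a) (msize b); clear; lia.
  have [A hA eA] : exists2 A, A \is (N + e).-homog & affine C A = a.
    by apply: affine_surj => //; rewrite /N; move: (msize v) (msize a) (msize b); clear; lia.
  have [B hB eB] : exists2 B, B \is (N + e).-homog & affine C B = b.
    by apply: affine_surj => //; rewrite /N; move: (msize v) (msize a) (msize b); clear; lia.
  have E : V * T c = A * conic + B * pencil sigma.
    apply: (affine_inj uC (d := (N + (e + 2))%N)).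
    - exact: dhomogM.
    - by rewrite addnA; apply: rpredD; apply: dhomogM => //; [exact: conic_homog|exact: pencil_homog].
    - by rewrite affineD !affineM eV eA eB.
  have V0 : (restr V).[0] != 0.
    have [l l0] := affine_origin fC hV; rewrite eV ev2_origin => eu.
    by move: v0; rewrite eu mulf_eq0 negb_or => /andP[].
  have cop : coprimep 'X^4 (restr V).
    by apply: coprimep_expl; rewrite coprimep_sym coprimepX.
  rewrite -(Gauss_dvdpr _ cop) -restrM E restrD !restrM restr_conic mulr0 add0r restr_pencil.
  by apply/dvdpP; exists (restr B * (- sigma)%:P); ring.
have [c [hc uc]] := truncated_division (restr H) U0.
exists c; split=> [|c' hc'].
  by rewrite -aT; apply/mem; rewrite rT.
by apply: uc; rewrite -rT; apply/mem; rewrite aT.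
Qed.

(** If the contact order [r] were at most three, then [r] linear conditions would
    suffice for a combination of the four basis elements to lie in the ideal. *)
Lemma contact_order C G l : C \in unitmx -> fixes_origin C -> G \is l.-homog ->
  local_intersection (affine C conic) (affine C G) 4 -> restr G != 0 -> 'X^4 %| restr G.
Proof.
move=> uC fC hG [b hb] G0; have [r [p]] := multiplicity_XsubC (restr G) 0.
rewrite G0 subr0 /= => p0 eG; case: (leqP 4 r) => r4.
  by rewrite eG dvdp_mull // dvdp_exp2l.
exfalso; pose e := \sum_(i < 4) msize (b i).
have hB i : exists2 B, B \is e.-homog & affine C B = b i.
  by apply: affine_surj => //; rewrite /e (bigD1 i) //= ltnW // ltnS leq_addr.
pose B i := s2val (cid2 (hB i)).
have BE i : B i \is e.-homog /\ affine C (B i) = b i.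
  by split; [exact: (s2valP (cid2 (hB i)))|exact: (s2valP' (cid2 (hB i)))].
pose M : 'M[K]_(4, 3) := \matrix_(i, j) (restr (B i))`_j.
have [c c0 cM] : exists2 c : 'rV_4, c != 0 & c *m M = 0.
  have /rowV0Pn[c /sub_kermxP hc c0] : kermx M != 0; last by exists c.
  rewrite -mxrank_eq0 mxrank_ker subn_eq0 -ltnNge.
  by apply: leq_ltn_trans (rank_leq_col _) _.
pose T := \sum_(i < 4) c 0 i *: B i.
have hT : T \is e.-homog by apply: rpred_sum => i _; apply: rpredZ; case: (BE i).
have rT : 'X^r %| restr T.
  have e1 : take_poly r (restr T) = 0.
    apply/polyP => j; rewrite coef_take_poly coef0; case: ltnP => // jr.
    rewrite restr_sum coef_sum; have j3 : (j < 3)%N by apply: leq_trans jr _.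
    have e0 := congr1 (fun A : 'rV_3 => A 0 (Ordinal j3)) cM; rewrite /= [RHS]mxE mxE in e0.
    rewrite -[RHS]e0; apply: eq_bigr => i _; by rewrite restrZ coefZ mxE.
  by rewrite -(poly_take_drop r (restr T)) e1 add0r dvdp_mull.
have /dvdpP[q eq] := rT.
have mem : in_local_ideal (affine C conic) (affine C G) (affine C T).
  apply: (local_member uC fC hG (r := r) (p := p) (q := q) _ _ hT).
  - by rewrite eG mulrC.
  - by rewrite -rootE.
  - by rewrite eq mulrC.
have [|c1 [hc1 uc1]] := hb 0 1; first by rewrite meval1 oner_eq0.
have z1 : c1 = 0.
  apply: uc1; exists 1, 0, 0; split; first by rewrite meval1 oner_eq0.
  by rewrite !mul0r addr0 big1 ?mulr0 ?subr0 ?mulr0 // => i _; rewrite mxE scale0r.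
have z2 : c1 = - c.
  apply: uc1; have -> : 0 - 1 * \sum_(i < 4) (- c) 0 i *: b i = affine C T; last exact: mem.
  rewrite mul1r sub0r affine_sum -sumrN; apply: eq_bigr => i _.
  by rewrite mxE scaleNr opprK affineZ; case: (BE i) => _ ->.
by move: c0; rewrite -oppr_eq0 -z2 z1 eqxx.
Qed.

End LocalIntersection.

(** * Smooth curves and quadratic forms *)

Section EvenPloski.
Context {K : numClosedFieldType}.
Implicit Types (F G H Q : {mpoly K[3]}) (A B C : 'M[K]_3) (P : 'rV[K]_3).

Local Notation X0 := ('X_(inord 0) : {mpoly K[3]}).
Local Notation X1 := ('X_(inord 1) : {mpoly K[3]}).
Local Notation X2 := ('X_(inord 2) : {mpoly K[3]}).

Lemma smooth_subst A Q : A \in unitmx -> smooth_curve Q -> smooth_curve (subst_mx A Q).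
Proof.
move=> uA sQ P P0; rewrite subst_eval => QP.
pose P' : 'rV[K]_3 := P *m A^T.
have P'E i : P' 0 i = \sum_j A i j * P 0 j.
  by rewrite mxE; apply: eq_bigr => j _; rewrite mxE mulrC.
have P'0 : P' != 0.
  apply: contraNneq P0 => e; rewrite -(mulmxK (_ : A^T \in unitmx) P) ?unitmx_tr //.
  by rewrite -/P' e mul0mx.
have [|i hi] := sQ P' P'0; first by rewrite -[RHS]QP; apply: meval_eq => i; rewrite P'E.
case: (pickP (fun j : 'I_3 => ((subst_mx A Q)^`M(j)).@[P 0] != 0)) => [j hj|h]; first by exists j.
have w0 : (\row_i (Q^`M(i)).@[P' 0]) *m A = 0.
  apply/rowP => j; rewrite [in RHS]mxE; have /negbT := h j; rewrite negbK => /eqP e.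
  rewrite -[RHS]e /subst_mx chain_rule raddf_sum mxE; apply: eq_bigr => l _ /=.
  rewrite mevalM mxE; congr (_ * _).
    by rewrite -/(subst_mx A _) subst_eval; apply: meval_eq => i'; rewrite P'E.
  have -> : (tnth [tuple \sum_(j0 < 3) A i0 j0 *: 'X_j0 | i0 < 3] l)^`M(j) = (A l j)%:MP.
    rewrite tnth_mktuple (big_morph _ (mderivD j) (mderiv0 _ j)) (bigD1 j) //= big1 => [|k kj].
      by rewrite mderivZ deriv_X eqxx addr0 -mul_mpolyC mulr1.
    by rewrite mderivZ deriv_X (negbTE kj) scaler0.
  by rewrite mevalC.
have := mulmxK uA (\row_i (Q^`M(i)).@[P' 0]); rewrite w0 mul0mx => /rowP/(_ i).
by rewrite !mxE => e; rewrite -e eqxx in hi.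
Qed.

Definition quadform (q : seq K) : {mpoly K[3]} :=
  q`_0 *: (X0 * X0) + q`_1 *: (X0 * X1) + q`_2 *: (X1 * X1) + q`_3 *: (X0 * X2)
  + q`_4 *: (X1 * X2) + q`_5 *: (X2 * X2).

Lemma ev3_quadform q a b c : ev3 (quadform q) a b c =
  q`_0 * (a * a) + q`_1 * (a * b) + q`_2 * (b * b) + q`_3 * (a * c) + q`_4 * (b * c) + q`_5 * (c * c).
Proof. by rewrite /quadform !ev3E. Qed.

Lemma quadform_homog q : quadform q \is 2.-homog.
Proof. by apply: ev3_homog => a b c; rewrite !ev3_quadform; ring. Qed.

Lemma ev3_nat (n : nat) (a b c : K) : ev3 n%:R a b c = n%:R.
Proof. by rewrite /ev3 rmorph_nat. Qed.

Lemma gradient_quadform q (a b c : K) :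
  [/\ ev3 ((quadform q)^`M(inord 0)) a b c = 2%:R * q`_0 * a + q`_1 * b + q`_3 * c,
      ev3 ((quadform q)^`M(inord 1)) a b c = q`_1 * a + 2%:R * q`_2 * b + q`_4 * c
    & ev3 ((quadform q)^`M(inord 2)) a b c = q`_3 * a + q`_4 * b + 2%:R * q`_5 * c].
Proof.
by rewrite /quadform !mderivD !mderivZ !mderivM !deriv_X !inord3_eq //= !(ev3E, ev3_nat);
  split; ring.
Qed.

Lemma quadform_ex F : F \is 2.-homog -> exists q, F = quadform q.
Proof.
move=> hF; pose f := dehom F; pose c i j := cf f i j.
exists [:: c 2 0; c 1 1; c 0 2; c 1 0; c 0 1; c 0 0]%N.
apply: (dehom_inj hF (quadform_homog _)); apply: ev2_ext => a b.
rewrite [RHS]ev2_dehom ev3_quadform /=.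
have cf0 i j : (2 < i + j)%N -> cf f i j = 0.
  by move=> h; apply/eqP; apply: contraTT h => /(cf_dehom_deg hF); rewrite -leqNgt.
have E i : ev2 (ypoly (xcoef f i)) a b = c i 0%N + c i 1%N * b + c i 2%N * b ^+ 2.
  have sx : (size (xcoef f i) <= 3)%N.
    by apply: size_xcoef => j; rewrite ltnNge; apply: contra => h; rewrite cf0 // (leq_trans h) ?leq_addl.
  rewrite ev2_ypoly (horner_coef_wide _ sx) !big_ord_recl big_ord0 !coef_xcoef /=.
  by rewrite expr0 expr1 mulr1 addr0 addrA.
rewrite -/f [f in LHS](xcoef_expand (msize_dehom hF)) !big_ord_recl big_ord0 /=.
rewrite !(ev2D, ev2M, ev2Xn, ev2x, E) /ev2 meval0 /c.
rewrite (cf0 1 2 isT)%N (cf0 2 1 isT)%N (cf0 2 2 isT)%N.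
by move: (cf f) => g; clear; ring.
Qed.

Lemma smooth_gradient Q a b c : smooth_curve Q -> ev3 Q a b c = 0 ->
  (a != 0) || (b != 0) || (c != 0) ->
  ev3 (Q^`M(inord 0)) a b c = 0 -> ev3 (Q^`M(inord 1)) a b c = 0 ->
  ev3 (Q^`M(inord 2)) a b c = 0 -> False.
Proof.
move=> sQ Q0 nz d0 d1 d2; pose P : 'rV[K]_3 := \row_i vec3 a b c i.
have PE i : P 0 i = vec3 a b c i by rewrite mxE.
have [v0 v1 v2] := vec3_val a b c.
have mE G : G.@[P 0] = ev3 G a b c by apply: meval_eq => i; rewrite PE.
have P0 : P != 0.
  apply: contraTneq nz => e; have z i : vec3 a b c i = 0 by rewrite -PE e mxE.
  by move: v0 v1 v2; rewrite !z => <- <- <-; rewrite eqxx.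
have [|i] := sQ P P0; first by rewrite mE.
by rewrite mE; case: (ord3P i) => ->; rewrite ?d0 ?d1 ?d2 eqxx.
Qed.

Lemma pencil_quadform (rho : K) : pencil rho = quadform [:: -1; 0; - rho; 0; 1; 0].
Proof. by apply: ev3_ext => a b c; rewrite ev3_pencil ev3_quadform /=; ring. Qed.

Lemma pencil_smooth (rho : K) : smooth_curve (pencil rho).
Proof.
move=> P P0 _; rewrite pencil_quadform.
case: (pickP (fun j : 'I_3 => ((quadform [:: -1; 0; - rho; 0; 1; 0])^`M(j)).@[P 0] != 0)) => [j hj|h]; first by exists j.
have [d0 d1 d2] := gradient_quadform [:: -1; 0; - rho; 0; 1; 0] (P 0 (inord 0)) (P 0 (inord 1)) (P 0 (inord 2)).
have {}h j : ((quadform [:: -1; 0; - rho; 0; 1; 0])^`M(j)).@[P 0] = 0.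
  by have /negbT := h j; rewrite negbK => /eqP.
rewrite -!ev3_meval !h /= in d0 d1 d2.
have b0 : P 0 (inord 1) = 0 by rewrite d2; ring.
have a0 : P 0 (inord 0) = 0.
  apply: (mulfI (_ : - 2%:R != 0 :> K)); first by rewrite oppr_eq0 pnatr_eq0.
  by rewrite mulr0 d0; ring.
have c0 : P 0 (inord 2) = 0 by move: d1; rewrite b0 => d1; rewrite d1; ring.
by case/eqP: P0; apply/rowP => j; rewrite mxE; case: (ord3P j) => ->.
Qed.

End EvenPloski.

(** * Normal form of a smooth conic *)

Section NormalForm.
Context {K : numClosedFieldType}.
Implicit Types (F G H Q : {mpoly K[3]}) (A B C : 'M[K]_3) (P : 'rV[K]_3).

Local Notation X0 := ('X_(inord 0) : {mpoly K[3]}).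
Local Notation X1 := ('X_(inord 1) : {mpoly K[3]}).
Local Notation X2 := ('X_(inord 2) : {mpoly K[3]}).

(** The third unit vector, which represents the point [(0 : 0 : 1)]. *)
Definition e2 (k : 'I_3) : K := if k == inord 2 then 1 else 0.

Lemma mul_column A C : (forall k, C k (inord 2) = e2 k) ->
  forall k, (A *m C) k (inord 2) = A k (inord 2).
Proof.
move=> hC k; rewrite mxE (bigD1 (inord 2)) //= hC /e2 eqxx mulr1 big1 ?addr0 // => j j2.
by rewrite hC /e2 (negbTE j2) mulr0.
Qed.

Lemma mx3_column l : nth 0 (nth [::] l 0) 2 = 0 -> nth 0 (nth [::] l 1) 2 = 0 ->
  nth 0 (nth [::] l 2) 2 = 1 -> forall k, mx3 l k (inord 2) = e2 k.
Proof.
move=> h0 h1 h2 k; rewrite /mx3 mxE /e2 [X in nth 0 _ X]inordK //.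
by case: (ord3P k) => ->; rewrite !inordK // !inord3_eq.
Qed.

(** Step by step: the tangent line at the point becomes [X1 = 0], a change of
    [X2] removes the remaining terms, and [X0] is rescaled. *)
Lemma conic_normal_form P Q : P != 0 -> Q \is 2.-homog -> smooth_curve Q -> Q.@[P 0] = 0 ->
  exists B, [/\ B \in unitmx, forall k, B k (inord 2) = P 0 k & subst_mx B Q = conic].
Proof.
move=> P0 hQ sQ QP.
have [i Pi] := row_nz P0.
have [A [uA A2 _]] := chart_eqE Pi.
have QA : ev3 (subst_mx A Q) 0 0 1 = 0.
  rewrite subst_ev3 -[RHS]QP [in RHS]ev3_meval -!A2 /row_app; congr ev3; ring.
have [q qE] := quadform_ex (subst_homog A hQ).
suff [C [uC C2 CE]] : exists C, [/\ C \in unitmx, forall k, C k (inord 2) = e2 k &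
    subst_mx C (quadform q) = conic].
  exists (A *m C); split; first by rewrite unitmx_mul uA uC.
    by move=> k; rewrite mul_column.
  by rewrite -subst_mxM qE.
have sQ' := smooth_subst uA sQ; rewrite qE in QA sQ'.
move: (q) sQ' QA => {qE A uA A2 QP Pi i P0 hQ sQ Q P}{}q sq q5.
have q50 : q`_5 = 0 by have e := q5; rewrite ev3_quadform in e; rewrite -[RHS]e; ring.
have [C1 [uC1 C12 [q' q'E]]] : exists C, [/\ C \in unitmx, forall k, C k (inord 2) = e2 k &
    exists q', subst_mx C (quadform q) = quadform [:: q'`_0; q'`_1; q'`_2; 0; 1; 0]].
  have [q40|q40] := eqVneq q`_4 0; last first.
    exists (mx3 [:: [:: 1; 0; 0]; [:: - q`_3 / q`_4; (q`_4)^-1; 0]; [:: 0; 0; 1]]); split.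
    - apply: (@mx3_unit _ _ [:: [:: 1; 0; 0]; [:: q`_3; q`_4; 0]; [:: 0; 0; 1]]) => u v w.
      by rewrite /= !row_app_mx3 //=; split; field.
    - exact: mx3_column.
    exists [:: q`_0 - q`_1 * q`_3 / q`_4 + q`_2 * (q`_3 / q`_4) ^+ 2;
      q`_1 / q`_4 - 2%:R * q`_2 * q`_3 / (q`_4) ^+ 2; q`_2 / (q`_4) ^+ 2].
    apply: ev3_ext => a b c; rewrite subst_ev3 !row_app_mx3 // !ev3_quadform /= q50.
    by field.
  have q30 : q`_3 != 0.
    apply: contraTneq isT => q30.
    have [d0 d1 d2] := gradient_quadform q 0 0 1.
    case: (smooth_gradient sq q5); rewrite ?d0 ?d1 ?d2 ?q30 ?q40 ?q50 ?oner_eq0 ?orbT //; ring.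
  exists (mx3 [:: [:: 0; (q`_3)^-1; 0]; [:: 1; 0; 0]; [:: 0; 0; 1]]); split.
  - apply: (@mx3_unit _ _ [:: [:: 0; 1; 0]; [:: q`_3; 0; 0]; [:: 0; 0; 1]]) => u v w.
    by rewrite /= !row_app_mx3 //=; split; field.
  - exact: mx3_column.
  exists [:: q`_2; q`_1 / q`_3; q`_0 / (q`_3) ^+ 2].
  apply: ev3_ext => a b c; rewrite subst_ev3 !row_app_mx3 // !ev3_quadform /= q50 q40.
  by field.
have := smooth_subst uC1 sq; rewrite q'E.
move: (q'`_0) (q'`_1) (q'`_2) q'E => al be ga q'E sq'.
have al0 : al != 0.
  apply: contraTneq isT => al0; pose q1 : seq K := [:: al; be; ga; 0; 1; 0].
  have [d0 d1 d2] := gradient_quadform q1 1 0 (- be).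
  case: (smooth_gradient sq' (a := 1) (b := 0) (c := - be)).
  - by rewrite ev3_quadform /= al0; ring.
  - by rewrite oner_eq0.
  - by rewrite d0 /= al0; ring.
  - by rewrite d1 /=; ring.
  - by rewrite d2 /=; ring.
pose r := sqrtC (- al^-1); have r2 : r ^+ 2 = - al^-1 by rewrite sqrtCK.
have r0 : r != 0 by rewrite -sqrf_eq0 r2 oppr_eq0 invr_eq0.
pose C2 := mx3 [:: [:: r; 0; 0]; [:: 0; 1; 0]; [:: - be * r; - ga; 1]].
exists (C1 *m C2); split.
- rewrite unitmx_mul uC1; apply: (@mx3_unit _ _ [:: [:: r^-1; 0; 0]; [:: 0; 1; 0]; [:: be; ga; 1]]) => u v w.
  by rewrite /= !row_app_mx3 //=; split; field.
- by move=> k; rewrite mul_column ?C12 //; exact: mx3_column.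
rewrite -subst_mxM q'E; apply: ev3_ext => a b c.
rewrite subst_ev3 !row_app_mx3 // ev3_quadform ev3_conic /=.
have r2' : al * (r * r) = -1 by rewrite -expr2 r2 mulrN divff.
ring: r2'.
Qed.

End NormalForm.

(** * Even Ploski curves are the products of conics of a pencil *)

Section Equivalence.
Context {K : numClosedFieldType}.
Implicit Types (F G H Q : {mpoly K[3]}) (A B C : 'M[K]_3) (P : 'rV[K]_3).

Local Notation X0 := ('X_(inord 0) : {mpoly K[3]}).
Local Notation X1 := ('X_(inord 1) : {mpoly K[3]}).
Local Notation X2 := ('X_(inord 2) : {mpoly K[3]}).

Lemma affine_subst A C F : affine A (subst_mx C F) = affine (C *m A) F.
Proof. by rewrite /affine subst_mxM. Qed.

Lemma e2_fixes_origin C : (forall k, C k (inord 2) = e2 k) -> fixes_origin C.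
Proof. by move=> h; exists 1; [exact: oner_neq0|exact: h]. Qed.

Lemma inverse_column A B P : B \in unitmx -> (forall k, A k (inord 2) = P 0 k) ->
  (forall k, B k (inord 2) = P 0 k) -> forall k, (invmx B *m A) k (inord 2) = e2 k.
Proof.
move=> uB hA hB k; transitivity ((invmx B *m B) k (inord 2)).
  by rewrite !mxE; apply: eq_bigr => j _; rewrite hA hB.
by rewrite mulVmx // mxE /e2; case: eqP.
Qed.

Definition pencil_shift (rho : K) := mx3 [:: [:: 1; 0; 0]; [:: 0; 1; 0]; [:: 0; - rho; 1]].

Lemma subst_pencil_shift rho sigma : subst_mx (pencil_shift rho) (pencil sigma) = pencil (sigma + rho).
Proof.
by apply: ev3_ext => a b c; rewrite subst_ev3 !row_app_mx3 // !ev3_pencil /=; ring.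
Qed.

Lemma pencil_shift_unit rho : pencil_shift rho \in unitmx.
Proof.
apply: (@mx3_unit _ _ [:: [:: 1; 0; 0]; [:: 0; 1; 0]; [:: 0; rho; 1]]) => u v w.
by rewrite /= !row_app_mx3 //=; split; ring.
Qed.

(** The automorphisms [pencil_shift] reduce the intersection of two members of the
    pencil to [pencil_intersection]. *)
Lemma pencil_even_Ploski d F : ~~ odd d -> (2 <= d./2)%N -> reduced F ->
  pencil_product d F -> even_Ploski d F.
Proof.
move=> ed d2 rF [B [k [rho [uB k0 FE]]]]; split=> //; split=> //.
have rinj : injective rho.
  by apply: (@reduced_pencil_inj _ _ k); rewrite -FE; exact: subst_reduced.
have uB' : invmx B \in unitmx by rewrite unitmx_inv.
pose P : 'rV[K]_3 := \row_i B i (inord 2).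
have PE i : B i (inord 2) = P 0 i by rewrite mxE.
pose Q i := subst_mx (invmx B) (pencil (rho i)).
have P0 : P != 0.
  apply/negP => /eqP e; pose w : 'cV[K]_3 := delta_mx (inord 2) 0.
  have e3 : B *m w = 0 by apply/colP => l; rewrite -colE !mxE PE e mxE.
  have := mulKmx uB w; rewrite e3 mulmx0 => /colP/(_ (inord 2)); rewrite !mxE !eqxx.
  by move=> /eqP; rewrite eq_sym oner_eq0.
exists P, Q, k; split=> //.
- move=> i; split.
  + exact: subst_homog (pencil_homog _).
  + rewrite /Q; apply: (smooth_subst uB'); exact: pencil_smooth.
  + have hC := inverse_column uB PE PE; rewrite /Q subst_eval.
    have E l : \sum_j invmx B l j * P 0 j = e2 l.
      by rewrite -hC mxE; apply: eq_bigr => j _; rewrite PE.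
    by rewrite ev3_meval !E /e2 !inord3_eq //= ev3_pencil; ring.
- split=> //; rewrite -[LHS](subst_mxKV F uB) FE substZ subst_prod; congr (_ *: _).
- move=> i j ij l Pl; have [A [uA hA cE]] := chart_eqE Pl.
  have hC := inverse_column uB hA PE; pose C := invmx B *m A; rewrite -/C in hC.
  rewrite !cE -!/(affine _ _) /Q !affine_subst -/C.
  have e1 : pencil (rho i) = subst_mx (pencil_shift (rho i)) conic.
    by rewrite -pencil0 subst_pencil_shift add0r.
  have e2 : pencil (rho j) = subst_mx (pencil_shift (rho i)) (pencil (rho j - rho i)).
    by rewrite subst_pencil_shift subrK.
  rewrite e1 e2 !affine_subst; apply: pencil_intersection.
  - by rewrite unitmx_mul pencil_shift_unit unitmx_mul uB' uA.
  - apply: e2_fixes_origin => k'; rewrite mul_column //; exact: mx3_column.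
  - by rewrite subr_eq0; apply: contraNneq ij => /rinj ->.
Qed.

(** A form of degree two restricts to degree at most four in the parameter, hence
    to a multiple of the restriction of [X1 ^+ 2].  Smoothness excludes the double
    line [X1 ^+ 2] itself. *)
Lemma contact_pencil G : G \is 2.-homog -> smooth_curve G -> 
  restr G = 0 \/ 'X^4 %| restr G -> exists rm : K * K, rm.2 != 0 /\ G = rm.2 *: pencil rm.1.
Proof.
move=> hG sG hr.
have [a ra] : exists a, restr G = a *: 'X^4.
  have [->|r0] := eqVneq (restr G) 0; first by exists 0; rewrite scale0r.
  case: hr => [e|/dvdpP[q e]]; first by rewrite e eqxx in r0.
  have q0 : q != 0 by apply: contraNneq r0 => q0; rewrite e q0 mul0r.
  have := size_restr hG; rewrite e size_Mmonic ?monicXn // size_polyXn => sq.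
  have /size_poly1P[a _ ->] : size q == 1%N.
    by move: sq; rewrite -size_poly_gt0 in q0; move: q0; move: (size q) => n; clear; lia.
  by exists a; rewrite mul_polyC.
have hT : G - a *: X1 ^+ 2 \is 2.-homog.
  by apply: ev3_homog => u v w; rewrite !(ev3B, ev3E) (ev3_scale _ _ _ _ hG); ring.
have [s|L hL eT] := @conic_dvd_homog _ 0 _ hT.
  by apply: restr_eq0; rewrite restrB restrZ ra; apply: poly_ext => t;
    rewrite hornerD hornerN !hornerZ horner_restr !ev3E hornerXn horner0; ring.
have [mu muE] : exists mu, L = mu%:MP.
  exists L@_0%MM; apply/mpolyP => m; rewrite mcoeffC eq_sym; case: eqP => [->|m0]; first by rewrite mulr1.
  rewrite mulr0; apply/memN_msupp_eq0/negP => /(dhomog_mf hL) /eqP; rewrite mdeg_eq0 => /eqP.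
  by move=> e0; apply: m0; rewrite e0.
have GE : G = mu *: conic + a *: X1 ^+ 2.
  by rewrite -[LHS](subrK (a *: X1 ^+ 2)) eT muE mulrC mul_mpolyC.
have mu0 : mu != 0.
  apply: contraTneq isT => mu0.
  have GE' : G = quadform [:: 0; 0; a; 0; 0; 0].
    by apply: ev3_ext => u v w; rewrite GE mu0 scale0r add0r ev3_quadform !ev3E /=; ring.
  have [d0 d1 d2] := gradient_quadform [:: 0; 0; a; 0; 0; 0] 1 0 0.
  rewrite GE' in sG; case: (smooth_gradient sG (a := 1) (b := 0) (c := 0)).
  - by rewrite ev3_quadform /=; ring.
  - by rewrite oner_eq0.
  - by rewrite d0 /=; ring.
  - by rewrite d1 /=; ring.
  - by rewrite d2 /=; ring.
exists (- a / mu, mu); split=> //=; apply: ev3_ext => u v w.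
by rewrite GE ev3D !ev3Z ev3_conic ev3_pencil ev3Xn ev3_1; field.
Qed.

(** In the coordinates where the first conic is [conic], the others belong to the
    pencil by [contact_pencil]. *)
Lemma even_Ploski_pencil d F : even_Ploski d F -> pencil_product d F.
Proof.
move=> [_ [d2 [P [Q [c [P0 hQ [c0 FE] hI]]]]]].
have o0 : (0 < d./2)%N by apply: leq_trans d2.
pose o := Ordinal o0; have [hQo sQo PQo] := hQ o.
have [B [uB hB QoE]] := conic_normal_form P0 hQo sQo PQo.
have ex i : exists rm : K * K, rm.2 != 0 /\ subst_mx B (Q i) = rm.2 *: pencil rm.1.
  have [->|io] := eqVneq i o.
    by exists (0, 1); split; [exact: oner_neq0|rewrite QoE pencil0 scale1r].
  have [hQi sQi PQi] := hQ i.
  apply: contact_pencil; [exact: subst_homog|exact: smooth_subst|].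
  have [r0|r0] := eqVneq (restr (subst_mx B (Q i))) 0; [by left|right].
  have [l Pl] := row_nz P0.
  have [A [uA hA cE]] := chart_eqE Pl.
  have := hI o i; rewrite eq_sym => /(_ io l Pl); rewrite !cE -!/(affine _ _) => hl.
  have hC := inverse_column uB hA hB.
  apply: (@contact_order _ (invmx B *m A) _ 2 _ _ _ _ r0).
  - by rewrite unitmx_mul unitmx_inv uB uA.
  - exact: e2_fixes_origin.
  - exact: subst_homog.
  - rewrite -QoE -!affine_subst !subst_mxKV //.
have [rm hrm] := choice ex.
exists B, (c * \prod_i (rm i).2), (fun i => (rm i).1); split=> //.
  by rewrite mulf_neq0 //; apply/prodf_neq0 => i _; case: (hrm i).
rewrite FE substZ subst_prod -scalerA -scaler_prod; congr (_ *: _).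
by apply: eq_bigr => i _; case: (hrm i).
Qed.

End Equivalence.

(** * Constant coefficient differential operators *)

Section DiffOp.
Context {K : numClosedFieldType}.
Implicit Types (n : nat).

(** The operator [p(d/dX)] applied to [h]. *)
Definition dop n (p h : {mpoly K[n]}) : {mpoly K[n]} :=
  \sum_(m <- msupp p) p@_m *: h^`M[m].

Lemma dop_supp n (p h : {mpoly K[n]}) s : uniq s -> {subset msupp p <= s} ->
  dop p h = \sum_(m <- s) p@_m *: h^`M[m].
Proof.
move=> us sub; rewrite (bigID (mem (msupp p))) /= [X in _ + X]big1 ?addr0; last first.
  by move=> m /memN_msupp_eq0 ->; rewrite scale0r.
rewrite -big_filter; apply: perm_big; apply: uniq_perm; rewrite ?msupp_uniq ?filter_uniq //.
move=> m; rewrite mem_filter; by apply/idP/andP => [hm|[]//]; split=> //; exact: sub.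
Qed.

Lemma dopDl n (p q h : {mpoly K[n]}) : dop (p + q) h = dop p h + dop q h.
Proof.
pose s := undup (msupp p ++ msupp q).
have sub r : {subset msupp r <= msupp p ++ msupp q} -> {subset msupp r <= s}.
  by move=> hr m /hr; rewrite mem_undup.
have sp : {subset msupp p <= s} by apply: sub => m hm; rewrite mem_cat hm.
have sq : {subset msupp q <= s} by apply: sub => m hm; rewrite mem_cat hm orbT.
rewrite !(@dop_supp _ _ _ s) ?undup_uniq //; last by apply: sub => m /msuppD_le.
by rewrite -big_split; apply: eq_bigr => m _ /=; rewrite mcoeffD scalerDl.
Qed.

Lemma dopZl n c (p h : {mpoly K[n]}) : dop (c *: p) h = c *: dop p h.
Proof.
rewrite (@dop_supp _ _ _ (msupp p)) ?msupp_uniq //; last exact: msuppZ_le.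
by rewrite scaler_sumr; apply: eq_bigr => m _; rewrite mcoeffZ scalerA.
Qed.

Lemma dop0l n (h : {mpoly K[n]}) : dop 0 h = 0.
Proof. by rewrite /dop msupp0 big_nil. Qed.

Lemma dopX n m (h : {mpoly K[n]}) : dop 'X_[m] h = h^`M[m].
Proof. by rewrite /dop msuppX big_seq1 mcoeffX eqxx scale1r. Qed.

Lemma dopXU n i (h : {mpoly K[n]}) : dop 'X_i h = h^`M(i).
Proof. by rewrite dopX mderivmU1m. Qed.

Lemma dopDr n (p g h : {mpoly K[n]}) : dop p (g + h) = dop p g + dop p h.
Proof. by rewrite /dop -big_split; apply: eq_bigr => m _ /=; rewrite mderivmD scalerDr. Qed.

Lemma dopZr n c (p h : {mpoly K[n]}) : dop p (c *: h) = c *: dop p h.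
Proof. by rewrite /dop scaler_sumr; apply: eq_bigr => m _; rewrite mderivmZ !scalerA mulrC. Qed.

Lemma dop0r n (p : {mpoly K[n]}) : dop p 0 = 0.
Proof. by have := dopZr 0 p 0; rewrite !scale0r. Qed.

Lemma dopC n c (h : {mpoly K[n]}) : dop c%:MP h = c *: h.
Proof. by rewrite -[c%:MP]mulr1 mul_mpolyC dopZl -(mpolyX0 _ K) dopX mderivm0m. Qed.

Lemma dopM n (p q h : {mpoly K[n]}) : dop (p * q) h = dop p (dop q h).
Proof.
elim/mpolyind: p => [|c m p _ _ IH]; first by rewrite mul0r !dop0l.
rewrite mulrDl dopDl IH [in RHS]dopDl -scalerAl !dopZl dopX; congr (c *: _ + _).
elim/mpolyind: q {IH} => [|c' m' q _ _ IH]; first by rewrite mulr0 !dop0l raddf0.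
rewrite mulrDr !dopDl IH mderivmD -scalerAr !dopZl -mpolyXD !dopX mderivmZ.
by rewrite addmC mderivmDm.
Qed.

Definition lin_subst n (M : 'M[K]_n) (h : {mpoly K[n]}) : {mpoly K[n]} :=
  h \mPo [tuple \sum_j M i j *: 'X_j | i < n].

Lemma meval_lin_subst n (M : 'M[K]_n) h v :
  (lin_subst M h).@[v] = h.@[fun i => \sum_j M i j * v j].
Proof.
rewrite /lin_subst comp_mpoly_meval; apply: meval_eq => i.
rewrite tnth_mktuple raddf_sum; apply: eq_bigr => j _ /=.
by rewrite mevalZ mevalXU.
Qed.

(** By the chain rule, derivatives transform by the transposed matrix. *)
Lemma dop_lin_subst n (M : 'M[K]_n) (p h : {mpoly K[n]}) :
  dop p (lin_subst M h) = lin_subst M (dop (lin_subst M^T p) h).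
Proof.
have lD (A : 'M[K]_n) f g : lin_subst A (f + g) = lin_subst A f + lin_subst A g by exact: comp_mpolyD.
have lZ (A : 'M[K]_n) c f : lin_subst A (c *: f) = c *: lin_subst A f by exact: comp_mpolyZ.
move: p h; apply: (@mpoly_alg_ind K n (fun p => forall h,
  dop p (lin_subst M h) = lin_subst M (dop (lin_subst M^T p) h))) => [c|i|p q hp hq|p q hp hq] h.
- by rewrite dopC [lin_subst M^T _]comp_mpolyC dopC lZ.
- rewrite dopXU chain_rule [lin_subst M^T _]comp_mpolyXU -tnth_nth tnth_mktuple.
  have dS (E : 'I_n -> {mpoly K[n]}) : dop (\sum_j E j) h = \sum_j dop (E j) h.
    by apply: (big_morph (fun p => dop p h)) => [p q|]; rewrite ?dopDl ?dop0l.
  have lS (E : 'I_n -> {mpoly K[n]}) : lin_subst M (\sum_j E j) = \sum_j lin_subst M (E j).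
    by apply: (big_morph _ (lD M)); exact: comp_mpoly0.
  rewrite dS lS; apply: eq_bigr => j _; rewrite dopZl dopXU lZ mxE tnth_mktuple.
  have -> : (\sum_(l < n) M j l *: 'X_l)^`M(i) = (M j i)%:MP.
    rewrite (big_morph _ (mderivD i) (mderiv0 _ i)) (bigD1 i) //= big1 => [|k ki].
      by rewrite mderivZ deriv_X eqxx addr0 -mul_mpolyC mulr1.
    by rewrite mderivZ deriv_X (negbTE ki) scaler0.
  by rewrite mulrC mul_mpolyC.
- by rewrite dopDl hp hq [lin_subst M^T (p + q)]lD dopDl lD.
- by rewrite dopM hq hp [lin_subst M^T (_ * _)]rmorphM dopM.
Qed.

Lemma lin_subst_origin n (M : 'M[K]_n) h : (lin_subst M h).@[fun=> 0] = h.@[fun=> 0].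
Proof.
by rewrite meval_lin_subst; apply: meval_eq => i; rewrite big1 // => j _; rewrite mulr0.
Qed.

(** The apolar pairing. *)
Definition apolar n (p h : {mpoly K[n]}) : K := (dop p h).@[fun=> 0].

Lemma apolar_lin_subst n (M : 'M[K]_n) p h :
  apolar (lin_subst M^T p) h = apolar p (lin_subst M h).
Proof. by rewrite /apolar dop_lin_subst lin_subst_origin. Qed.

Lemma apolarDl n (p q h : {mpoly K[n]}) : apolar (p + q) h = apolar p h + apolar q h.
Proof. by rewrite /apolar dopDl mevalD. Qed.
Lemma apolarDr n (p g h : {mpoly K[n]}) : apolar p (g + h) = apolar p g + apolar p h.
Proof. by rewrite /apolar dopDr mevalD. Qed.
Lemma apolarZl n c (p h : {mpoly K[n]}) : apolar (c *: p) h = c * apolar p h.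
Proof. by rewrite /apolar dopZl mevalZ. Qed.
Lemma apolarZr n c (p h : {mpoly K[n]}) : apolar p (c *: h) = c * apolar p h.
Proof. by rewrite /apolar dopZr mevalZ. Qed.
Lemma apolar0l n (h : {mpoly K[n]}) : apolar 0 h = 0.
Proof. by rewrite /apolar dop0l meval0. Qed.
Lemma apolar0r n (p : {mpoly K[n]}) : apolar p 0 = 0.
Proof. by rewrite /apolar dop0r meval0. Qed.

Section Laplacian.
Variables (n : nat) (I : finType) (e : I -> 'I_n).

Definition laplacian (h : {mpoly K[n]}) : {mpoly K[n]} := \sum_i h^`M(e i)^`M(e i).

Definition grad2 (f : {mpoly K[n]}) : {mpoly K[n]} := \sum_i f^`M(e i) ^+ 2.

Lemma dop_squares h : dop (\sum_i 'X_(e i) ^+ 2) h = laplacian h.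
Proof.
rewrite (big_morph (fun p => dop p h) (fun p q => dopDl p q h) (dop0l h)).
by apply: eq_bigr => i _; rewrite expr2 dopM !dopXU.
Qed.

Lemma deriv_exp (f : {mpoly K[n]}) k i : (f ^+ k.+1)^`M(i) = f ^+ k * f^`M(i) *+ k.+1.
Proof.
elim: k => [|k IH]; first by rewrite expr1 expr0 mul1r.
by rewrite exprS mderivM IH exprS -mulrnAr mulrA mulrSr -mulrnAr; ring.
Qed.

Lemma laplacian_exp (g f r : {mpoly K[n]}) k : (forall i, g^`M(e i) = 0) -> grad2 f = f * r ->
  laplacian (g * f ^+ k.+1) = g * f ^+ k * (r *+ (k * k.+1) + laplacian f *+ k.+1).
Proof.
move=> hg hr; rewrite /laplacian.
have d1 i : (g * f ^+ k.+1)^`M(e i) = g * (f ^+ k * f^`M(e i) *+ k.+1).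
  by rewrite mderivM hg mul0r add0r deriv_exp.
case: k d1 => [|k] d1.
  under eq_bigr => i _ do rewrite d1 expr0 mul1r mulr1n mderivM hg mul0r add0r.
  by rewrite -mulr_sumr expr0 mulr1 mul0n mulr0n add0r mulr1n.
have d2 i : (g * f ^+ k.+2)^`M(e i)^`M(e i) =
    g * f ^+ k * (f^`M(e i) ^+ 2 *+ (k.+1 * k.+2)) + g * f ^+ k.+1 * (f^`M(e i)^`M(e i) *+ k.+2).
  rewrite d1 mderivM hg mul0r add0r mderivMn mderivM deriv_exp.
  by rewrite mulrnAl mulrnDl -mulrnA mulrDr !mulrnAr expr2 -!mulrA.
under eq_bigr => i _ do rewrite d2.
rewrite big_split /=.
have -> : \sum_i g * f ^+ k * (f^`M(e i) ^+ 2 *+ (k.+1 * k.+2)) = g * f ^+ k * (f * r *+ (k.+1 * k.+2)).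
  by rewrite -hr /grad2 -sumrMnl mulr_sumr.
rewrite -mulr_sumr sumrMnl.
move: (k.+1 * k.+2)%N (k.+2) (\sum_i _) => N M L.
by rewrite mulrDr exprSr !mulrnAr !mulrA.
Qed.

End Laplacian.

End DiffOp.

(** * A cubic invariant *)

Section CubicInvariant.
Context {K : numClosedFieldType}.
Implicit Types (F G H : {mpoly K[3]}).

Local Notation lx := (lshift 3).
Local Notation ly := (rshift 3).
Local Notation x k := ('X_(lx (inord k)) : {mpoly K[3 + 3]}).
Local Notation y k := ('X_(ly (inord k)) : {mpoly K[3 + 3]}).

Lemma det3 (A : 'M[K]_3) (a := fun i j => A (inord i) (inord j)) :
  \det A = a 0 0 * (a 1 1 * a 2 2 - a 1 2 * a 2 1) - a 0 1 * (a 1 0 * a 2 2 - a 1 2 * a 2 0)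
  + a 0 2 * (a 1 0 * a 2 1 - a 1 1 * a 2 0).
Proof.
have E (i j : 'I_3) : A i j = a (val i) (val j) by rewrite /a !inord_val.
rewrite (expand_det_row _ ord0) !big_ord_recl big_ord0 /cofactor /=.
rewrite !(expand_det_row _ ord0) !big_ord_recl !big_ord0 /cofactor /=.
by rewrite !det_mx11 !mxE !E /= /bump /=; ring.
Qed.

Definition cross (i : nat) : {mpoly K[3 + 3]} :=
  nth 0 [:: x 1 * y 2 - x 2 * y 1; x 2 * y 0 - x 0 * y 2; x 0 * y 1 - x 1 * y 0] i.

Definition form_x F := F \mPo [tuple 'X_(lx i) : {mpoly K[3 + 3]} | i < 3].
Definition form_y F := F \mPo [tuple 'X_(ly i) : {mpoly K[3 + 3]} | i < 3].
Definition form_cross F := F \mPo [tuple cross i | i < 3].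

Lemma meval_form_x F v : (form_x F).@[v] = F.@[fun i => v (lx i)].
Proof. by rewrite /form_x comp_mpoly_meval; apply: meval_eq => i; rewrite tnth_mktuple mevalXU. Qed.

Lemma meval_form_y F v : (form_y F).@[v] = F.@[fun i => v (ly i)].
Proof. by rewrite /form_y comp_mpoly_meval; apply: meval_eq => i; rewrite tnth_mktuple mevalXU. Qed.

Lemma meval_form_cross F v (a := fun k => v (lx (inord k))) (b := fun k => v (ly (inord k))) :
  (form_cross F).@[v] = ev3 F (a 1 * b 2 - a 2 * b 1) (a 2 * b 0 - a 0 * b 2) (a 0 * b 1 - a 1 * b 0).
Proof.
rewrite /form_cross comp_mpoly_meval ev3_meval !tnth_mktuple !inordK // /cross /=.
by rewrite !mevalB !mevalM !mevalXU.
Qed.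

Lemma block_diag_action (A : 'M[K]_3) h v :
  (lin_subst (block_mx A 0 0 A) h).@[v] =
  h.@[fun i => match split i with inl k => \sum_j A k j * v (lx j) | inr k => \sum_j A k j * v (ly j) end].
Proof.
rewrite meval_lin_subst; apply: meval_eq => i; rewrite big_split_ord /=.
case: split_ordP => k ->.
  rewrite [X in _ + X]big1 ?addr0 => [|j _]; last by rewrite block_mxEur mxE mul0r.
  by apply: eq_bigr => j _; rewrite block_mxEul.
rewrite big1 ?add0r => [|j _]; last by rewrite block_mxEdl mxE mul0r.
by apply: eq_bigr => j _; rewrite block_mxEdr.
Qed.

Lemma split_lx (k : 'I_3) : split (lx k : 'I_(3 + 3)) = inl k.
Proof. exact: (unsplitK (inl k)). Qed.
Lemma split_ly (k : 'I_3) : split (ly k : 'I_(3 + 3)) = inr k.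
Proof. exact: (unsplitK (inr k)). Qed.

Lemma form_x_subst (A : 'M[K]_3) F : form_x (subst_mx A F) = lin_subst (block_mx A 0 0 A) (form_x F).
Proof.
apply: mpoly_ext => v; rewrite meval_form_x subst_eval block_diag_action meval_form_x.
by apply: meval_eq => i; rewrite split_lx.
Qed.

Lemma form_y_subst (A : 'M[K]_3) F : form_y (subst_mx A F) = lin_subst (block_mx A 0 0 A) (form_y F).
Proof.
apply: mpoly_ext => v; rewrite meval_form_y subst_eval block_diag_action meval_form_y.
by apply: meval_eq => i; rewrite split_ly.
Qed.

(** The cross product transforms by the cofactor matrix, the inverse of the
    transposed matrix in [SL_3]. *)
Lemma form_cross_subst (A : 'M[K]_3) F : \det A = 1 ->
  lin_subst (block_mx A^T 0 0 A^T) (form_cross (subst_mx A F)) = form_cross F.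
Proof.
rewrite det3 => dA; apply: mpoly_ext => v; rewrite block_diag_action !meval_form_cross subst_ev3.
rewrite !split_lx !split_ly !big_ord3 !(mxE _ _ (inord _)) /row_app /=.
congr ev3; rewrite -[RHS]mul1r -dA; ring.
Qed.

Definition cubic F G H := apolar (form_x F * form_y G) (form_cross H).

(** [F(x) F(y)] and [F(x cross y)] transform by contragredient representations, and
    the apolar pairing is invariant. *)
Lemma cubic_invariant (A : 'M[K]_3) F (G := subst_mx A F) : \det A = 1 -> cubic G G G = cubic F F F.
Proof.
move=> dA; rewrite /cubic /G form_x_subst form_y_subst.
pose N := block_mx A^T 0 0 A^T.
have NT : block_mx A 0 0 A = N^T by rewrite /N tr_block_mx !trmxK !trmx0.
rewrite NT -(rmorphM (comp_mpoly _)) -/(lin_subst _ _) apolar_lin_subst.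
by rewrite form_cross_subst.
Qed.

Section Coefficients.
Variable d : nat.

Definition mon (k : 'I_#|{: form_monomial d}|) : 'X_{1..3} := val (enum_val k).

Lemma form_expand F : F \is d.-homog -> F = \sum_k coefs d F k *: 'X_[mon k].
Proof.
move=> hF; apply/mpolyP => m; rewrite raddf_sum /=.
under eq_bigr => k _ do rewrite mcoeffZ mcoeffX.
have mon_deg k : mdeg (mon k) = d by apply/eqP; exact: (valP (enum_val k)).
case: (eqVneq (mdeg m) d) => md; last first.
  rewrite big1 => [|k _]; last by case: eqP => [e|]; [rewrite -e mon_deg eqxx in md|rewrite mulr0].
  by apply/memN_msupp_eq0; apply: contra md => hm; apply/eqP/(dhomog_mf hF).
have md' : (mdeg m < d.+1)%N by rewrite md.
have hm : mdeg (BMultinom md') == d by rewrite /= md.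
pose k0 := enum_rank (exist _ (BMultinom md') hm : form_monomial d).
have k0E : mon k0 = m by rewrite /mon enum_rankK.
rewrite (bigD1 k0) //= k0E eqxx mulr1 big1 ?addr0; last first.
  move=> k kk; case: eqP => [e|]; last by rewrite mulr0.
  by case/eqP: kk; apply: enum_val_inj; apply: val_inj; apply: val_inj; rewrite /= -/(mon k) e -k0E.
by rewrite /coefs -/(mon k0) k0E.
Qed.

Definition cubic_form : form_poly d :=
  \sum_k1 \sum_k2 \sum_k3 cubic 'X_[mon k1] 'X_[mon k2] 'X_[mon k3] *: ('X_k1 * 'X_k2 * 'X_k3).

Lemma cubic_form_homog : cubic_form \is 3.-homog.
Proof.
do 3 (apply: rpred_sum => ? _); apply: rpredZ.
have hX k : ('X_k : {mpoly K[#|{: form_monomial d}|]}) \is 1.-homog by rewrite dhomogX /= mdeg1.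
exact: (dhomogM (dhomogM (hX _) (hX _)) (hX _)).
Qed.

Lemma cubic_suml n (c : 'I_n -> K) (E : 'I_n -> {mpoly K[3]}) G H :
  cubic (\sum_i c i *: E i) G H = \sum_i c i * cubic (E i) G H.
Proof.
pose f p := cubic p G H; rewrite -/(f _).
have fD p q : f (p + q) = f p + f q.
  by rewrite /f /cubic /form_x comp_mpolyD mulrDl apolarDl.
have f0 : f 0 = 0 by rewrite /f /cubic /form_x comp_mpoly0 mul0r apolar0l.
rewrite (big_morph f fD f0); apply: eq_bigr => i _.
by rewrite /f /cubic /form_x comp_mpolyZ -scalerAl apolarZl.
Qed.

Lemma cubic_summ n (c : 'I_n -> K) (E : 'I_n -> {mpoly K[3]}) F H :
  cubic F (\sum_i c i *: E i) H = \sum_i c i * cubic F (E i) H.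
Proof.
pose f p := cubic F p H; rewrite -/(f _).
have fD p q : f (p + q) = f p + f q.
  by rewrite /f /cubic /form_y comp_mpolyD mulrDr apolarDl.
have f0 : f 0 = 0 by rewrite /f /cubic /form_y comp_mpoly0 mulr0 apolar0l.
rewrite (big_morph f fD f0); apply: eq_bigr => i _.
by rewrite /f /cubic /form_y comp_mpolyZ -scalerAr apolarZl.
Qed.

Lemma cubic_sumr n (c : 'I_n -> K) (E : 'I_n -> {mpoly K[3]}) F G :
  cubic F G (\sum_i c i *: E i) = \sum_i c i * cubic F G (E i).
Proof.
pose f p := cubic F G p; rewrite -/(f _).
have fD p q : f (p + q) = f p + f q.
  by rewrite /f /cubic /form_cross comp_mpolyD apolarDr.
have f0 : f 0 = 0 by rewrite /f /cubic /form_cross comp_mpoly0 apolar0r.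
rewrite (big_morph f fD f0); apply: eq_bigr => i _.
by rewrite /f /cubic /form_cross comp_mpolyZ apolarZr.
Qed.

Lemma cubic_formE F : F \is d.-homog -> cubic_form.@[coefs d F] = cubic F F F.
Proof.
move=> /form_expand e; rewrite [in RHS]e.
have mS n (E : 'I_n -> form_poly d) : (\sum_i E i).@[coefs d F] = \sum_i (E i).@[coefs d F].
  exact: raddf_sum.
rewrite cubic_suml /cubic_form mS; apply: eq_bigr => k1 _.
rewrite mS cubic_summ mulr_sumr; apply: eq_bigr => k2 _.
rewrite mS cubic_sumr !mulr_sumr; apply: eq_bigr => k3 _.
by rewrite mevalZ !mevalM !mevalXU; ring.
Qed.

Lemma cubic_form_invariant : SL3_invariant cubic_form.
Proof.
split; first by exists 3%N => //; exact: cubic_form_homog.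
move=> A F dA hF; rewrite (cubic_formE hF) (cubic_formE (subst_homog A hF)).
exact: cubic_invariant.
Qed.

End Coefficients.

End CubicInvariant.

(** * Semistability of multiple conics *)

Section MultipleConic.
Context {K : numClosedFieldType}.
Implicit Types (F G H : {mpoly K[3]}).

Local Notation lx := (@lshift 3 3).
Local Notation ly := (@rshift 3 3).
Local Notation x k := ('X_(lx (inord k)) : {mpoly K[3 + 3]}).
Local Notation y k := ('X_(ly (inord k)) : {mpoly K[3 + 3]}).

Definition sphere : {mpoly K[3]} := \sum_i 'X_i ^+ 2.

Definition norm_x : {mpoly K[3 + 3]} := \sum_i 'X_(lx i) ^+ 2.
Definition norm_y : {mpoly K[3 + 3]} := \sum_i 'X_(ly i) ^+ 2.
Definition norm_cross : {mpoly K[3 + 3]} := form_cross sphere.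

Lemma norm_crossE : norm_cross = cross 0 * cross 0 + cross 1 * cross 1 + cross 2 * cross 2.
Proof.
rewrite /norm_cross /form_cross /sphere big_ord3 !comp_mpolyD !rmorphXn /= !comp_mpolyXU.
by rewrite -!tnth_nth !tnth_mktuple !inordK // !expr2.
Qed.

Lemma norm_yE : norm_y = y 0 * y 0 + y 1 * y 1 + y 2 * y 2.
Proof. by rewrite /norm_y big_ord3 !expr2. Qed.

Lemma deriv_x_x k l : (k < 3)%N -> (l < 3)%N -> (x k)^`M(lx (inord l)) = (k == l)%:R.
Proof. by move=> hk hl; rewrite deriv_X eq_lshift inord3_eq. Qed.

Lemma deriv_y_x k l : (y k)^`M(lx (inord l)) = 0.
Proof. by rewrite deriv_X eq_rlshift. Qed.

Lemma deriv_y_y k l : (k < 3)%N -> (l < 3)%N -> (y k)^`M(ly (inord l)) = (k == l)%:R.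
Proof. by move=> hk hl; rewrite deriv_X eq_rshift inord3_eq. Qed.

Lemma deriv_norm_y i : norm_y^`M(lx i) = 0.
Proof.
case: (ord3P i) => ->; rewrite norm_yE !mderivD !mderivM !deriv_y_x; ring.
Qed.

Lemma deriv_norm_cross :
  [/\ norm_cross^`M(lx (inord 0)) = 2%:R * (y 1 * cross 2 - y 2 * cross 1),
      norm_cross^`M(lx (inord 1)) = 2%:R * (y 2 * cross 0 - y 0 * cross 2)
    & norm_cross^`M(lx (inord 2)) = 2%:R * (y 0 * cross 1 - y 1 * cross 0)].
Proof.
by rewrite norm_crossE /cross /=; split;
  rewrite !(mderivD, mderivN, mderivM) !deriv_y_x !deriv_x_x //=; ring.
Qed.

Lemma grad_norm_cross : grad2 lx norm_cross = norm_cross * (4%:R * norm_y).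
Proof.
have [d0 d1 d2] := deriv_norm_cross.
by rewrite /grad2 big_ord3 /= d0 d1 d2 norm_crossE norm_yE /cross /=; ring.
Qed.

Lemma laplacian_norm_cross : laplacian lx norm_cross = 4%:R * norm_y.
Proof.
have [d0 d1 d2] := deriv_norm_cross; rewrite /laplacian big_ord3 /= d0 d1 d2 norm_yE /cross /=.
rewrite !mulr_natl !mderivMn !(mderivD, mderivN, mderivM) !deriv_y_x !deriv_x_x //=; ring.
Qed.

Lemma grad_norm_y : grad2 ly norm_y = norm_y * 4%:R.
Proof.
rewrite /grad2 big_ord3 /= norm_yE !mderivD !mderivM !deriv_y_y //=; ring.
Qed.

Lemma laplacian_norm_y : laplacian ly norm_y = 6%:R.
Proof.
rewrite /laplacian big_ord3 /= norm_yE !mderivD !mderivM !deriv_y_y //=.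
by rewrite !(mderivD, mderivM, deriv_y_y, mderivC) //=; ring.
Qed.

Lemma dopMn n (p h : {mpoly K[n]}) c : dop p (h *+ c) = dop p h *+ c.
Proof. by rewrite -scaler_nat dopZr scaler_nat. Qed.

(** With [v] the squared norm of [y] and [w] that of the cross product, the squared
    gradient of [w] with respect to [x] is [4 v w], and its Laplacian is [4 v]. *)
Lemma laplacian_x_power j k :
  dop norm_x (norm_y ^+ j * norm_cross ^+ k.+1) = norm_y ^+ j.+1 * norm_cross ^+ k *+ (4 * k.+1 * k.+1).
Proof.
have gj i : (norm_y ^+ j)^`M(lx i) = 0.
  by case: j => [|j]; [exact: mderivC|rewrite deriv_exp deriv_norm_y mulr0 mul0rn].
rewrite /norm_x dop_squares (laplacian_exp _ gj grad_norm_cross).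
rewrite laplacian_norm_cross; move: norm_y norm_cross => v w.
rewrite mulr_natl -mulrnDr -mulrnA (_ : (4 * (k * k.+1 + k.+1) = 4 * k.+1 * k.+1)%N); last by clear; lia.
by rewrite mulrnAr exprSr mulrAC.
Qed.

Lemma laplacian_y_power k : dop norm_y (norm_y ^+ k.+1) = norm_y ^+ k *+ (4 * (k * k.+1) + 6 * k.+1).
Proof.
have g1 i : (1 : {mpoly K[3 + 3]})^`M(ly i) = 0 by exact: mderivC.
rewrite -[_ ^+ k.+1]mul1r {1}/norm_y dop_squares (laplacian_exp _ g1 grad_norm_y).
rewrite laplacian_norm_y; move: norm_y => v.
by rewrite -!mulrnA -mulrnDr mul1r mulr_natr.
Qed.

Lemma dop_norm_x_power k j : exists2 c : nat, (0 < c)%N &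
  dop (norm_x ^+ k) (norm_y ^+ j * norm_cross ^+ k) = norm_y ^+ (j + k) *+ c.
Proof.
elim: k j => [|k IH] j; first by exists 1%N; rewrite // !expr0 mulr1 addn0 mulr1n dopC scale1r.
have [c c0 e] := IH j.+1; exists (c * (4 * k.+1 * k.+1))%N; first by rewrite muln_gt0 c0.
by rewrite exprSr dopM laplacian_x_power dopMn e -mulrnA (addSnnS j k).
Qed.

Lemma dop_norm_y_power k : exists2 c : nat, (0 < c)%N & dop (norm_y ^+ k) (norm_y ^+ k) = c%:R.
Proof.
elim: k => [|k [c c0 e]]; first by exists 1%N; rewrite // !expr0 dopC scale1r.
exists (c * (4 * (k * k.+1) + 6 * k.+1))%N; first by rewrite muln_gt0 c0 addn_gt0 orbT.
by rewrite [X in dop X]exprSr dopM laplacian_y_power dopMn e -mulrnA.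
Qed.

Lemma form_x_sphere m : form_x (sphere ^+ m) = norm_x ^+ m.
Proof.
rewrite /form_x rmorphXn /= /sphere raddf_sum /=; congr (_ ^+ _); apply: eq_bigr => i _.
by rewrite rmorphXn /= comp_mpolyXU -tnth_nth tnth_mktuple.
Qed.

Lemma form_y_sphere m : form_y (sphere ^+ m) = norm_y ^+ m.
Proof.
rewrite /form_y rmorphXn /= /sphere raddf_sum /=; congr (_ ^+ _); apply: eq_bigr => i _.
by rewrite rmorphXn /= comp_mpolyXU -tnth_nth tnth_mktuple.
Qed.

(** All Laplacians of powers that occur are positive multiples of powers. *)
Lemma cubic_sphere m : cubic (sphere ^+ m) (sphere ^+ m) (sphere ^+ m) != 0.
Proof.
rewrite /cubic form_x_sphere form_y_sphere mulrC /apolar dopM.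
have -> : form_cross (sphere ^+ m) = norm_cross ^+ m by rewrite /norm_cross /form_cross rmorphXn.
have [c c0 e] := dop_norm_x_power m 0; rewrite expr0 mul1r add0n in e.
have [c' c0' e'] := dop_norm_y_power m.
by rewrite e dopMn e' -mulrnA rmorph_nat pnatr_eq0 -lt0n muln_gt0 c0 c0'.
Qed.

Definition sphere_mx : 'M[K]_3 :=
  mx3 [:: [:: 'i; 0; 0]; [:: 0; 2%:R^-1; 2%:R^-1]; [:: 0; 'i / 2%:R; - 'i / 2%:R]].

Lemma sphere_mx_unit : sphere_mx \in unitmx.
Proof.
have i2 : 'i * 'i = -1 :> K by rewrite -expr2 sqrCi.
apply: (@mx3_unit _ _ [:: [:: - 'i; 0; 0]; [:: 0; 1; - 'i]; [:: 0; 1; 'i]]) => u v w.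
rewrite /= !row_app_mx3 //=; split.
- by ring: i2.
- by field.
- transitivity (- ('i * 'i) * w); [by field|by rewrite i2; ring].
Qed.

Lemma subst_sphere : subst_mx sphere_mx sphere = conic.
Proof.
have i2 : 'i * 'i = -1 :> K by rewrite -expr2 sqrCi.
apply: ev3_ext => a b c; rewrite subst_ev3 !row_app_mx3 // ev3_conic /sphere big_ord3 !ev3E /=.
transitivity ('i * 'i * a ^+ 2 + ((b + c) / 2%:R) ^+ 2 + 'i * 'i * ((b - c) / 2%:R) ^+ 2); first by field.
by rewrite i2; field.
Qed.

Lemma sphere_homog m : sphere ^+ m \is (2 * m).-homog.
Proof.
apply: dhomogMn; apply: ev3_homog => a b c.
by rewrite /sphere big_ord3 !ev3E /=; ring.
Qed.

Lemma multiple_conic_semistable m : 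
  exists2 J : form_poly (2 * m), SL3_invariant J & J.@[coefs (2 * m) (conic ^+ m)] != 0 :> K.
Proof.
exists (cubic_form (2 * m)); first exact: cubic_form_invariant.
rewrite -subst_sphere -substXn.
have [k k0 ->] := relative_invariance (cubic_form_invariant (2 * m)) sphere_mx_unit.
  by rewrite mulf_neq0 // cubic_formE ?cubic_sphere //; exact: sphere_homog.
exact: sphere_homog.
Qed.

(** An invariant has the same value at the product of conics and at the multiple
    conic, which is a limit of its orbit. *)
Lemma pencil_semistable d F : F \is d.-homog -> ~~ odd d -> pencil_product d F -> GIT_semistable d F.
Proof.
move=> hF ed [B [k [rho [uB k0 FE]]]].
have dE : d = (2 * d./2)%N by rewrite mul2n halfK (negbTE ed) subn0.
have [J hJ J0] : exists2 J : form_poly d, SL3_invariant J & J.@[coefs d (conic ^+ d./2)] != 0 :> K.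
  by rewrite dE; have := multiple_conic_semistable d./2; rewrite -dE.
exists J; split=> //; move: J0; rewrite (pencil_invariant rho ed hJ); apply: contraNneq => JF.
have -> : \prod_i pencil (rho i) = k^-1 *: subst_mx B F by rewrite FE scalerA mulVf // scale1r.
have [[n n0 homJ] _] := hJ; rewrite (invariant_scale _ _ homJ).
have [l l0 ->] := relative_invariance hJ uB; last exact: hF.
by rewrite JF !mulr0.
Qed.

End MultipleConic.

(** * The log canonical threshold *)

Section Points.
Context {K : numClosedFieldType}.
Implicit Types (F G : {mpoly K[3]}).

(** If [F(1, s, 0)] is a constant [c], then [F(t, 1, 0)] is [c * t ^+ d], which
    vanishes at [t = 0]. *)
Lemma curve_has_point d F : (0 < d)%N -> F \is d.-homog -> exists P : 'rV[K]_3, P != 0 /\ F.@[P 0] = 0.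
Proof.
move=> d0 hF.
suff [a [b [ab e]]] : exists a b, (a != 0) || (b != 0) /\ ev3 F a b 0 = 0.
  exists (\row_i vec3 a b 0 i); split.
    have [v0 v1 _] := vec3_val a b 0; apply: contraTneq ab => e0.
    have z i : vec3 a b 0 i = 0 by have := congr1 (fun A : 'rV_3 => A 0 i) e0; rewrite !mxE.
    by move: v0 v1; rewrite !z => <- <-; rewrite eqxx.
  by rewrite -[RHS]e; apply: meval_eq => i; rewrite mxE.
pose p := pev F 1 'X 0.
case: (boolP (size p == 1%N)) => [/size_poly1P[c _ pc]|/closed_rootP[s /rootP ps]]; last first.
  by exists 1, s; rewrite oner_eq0; split=> //; move: ps; rewrite horner_pev hornerC hornerX horner0.
exists 0, 1; rewrite oner_eq0 orbT; split=> //.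
pose r := pev F 'X 1 0 - c *: 'X^d.
have r0 : r = 0.
  apply: poly_vanish_nz => t t0; rewrite hornerD hornerN hornerZ hornerXn horner_pev hornerX hornerC horner0.
  have := ev3_scale t 1 t^-1 0 hF; rewrite mulr1 divff // mulr0 => ->.
  have : p.[t^-1] = c by rewrite pc hornerC.
  by rewrite horner_pev hornerC hornerX horner0 => ->; ring.
have : r.[0] = 0 by rewrite r0 horner0.
rewrite hornerD hornerN hornerZ hornerXn horner_pev hornerX hornerC horner0 expr0n.
by rewrite eqn0Ngt d0 mulr0 subr0.
Qed.

(** The curve itself has coefficient [lam]. *)
Lemma log_canonical_le1 (P : 'rV[K]_3) F lam : P != 0 -> F.@[P 0] = 0 ->
  log_canonical_at P F lam -> lam <= 1.
Proof.
move=> /row_nz[i Pi] FP /(_ i Pi)[_ h]; have [A [_ hA cE]] := chart_eqE Pi.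
have h1 := h (chart_eq i P F) 1 1%N; rewrite -[lam]mulr1; apply: h1; last by rewrite expr1 mulr1.
rewrite cE -ev2_origin ev2_dehom subst_ev3 -[RHS]FP [in RHS]ev3_meval -!hA /row_app.
by congr ev3; ring.
Qed.

Lemma pencil_product_even d F : (3 <= d)%N -> F != 0 -> F \is d.-homog -> pencil_product d F ->
  ~~ odd d /\ (2 <= d./2)%N.
Proof.
move=> d3 F0 hF [B [k [rho [uB k0 FE]]]].
have h1 := subst_homog B hF.
have h2 : subst_mx B F \is (2 * d./2).-homog.
  by rewrite FE; apply: rpredZ; exact: pencil_prod_homog.
have G0 : subst_mx B F != 0.
  by apply: contraNneq F0 => e; rewrite -(subst_mxKV F uB) e subst0.
have dE : d = (2 * d./2)%N.
  by have := dhomog_uniq G0 h1 h2.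
by move: d3 dE; clear; lia.
Qed.

End Points.

Section Threshold.
Context {R : realType}.
Local Open Scope classical_set_scope.
Implicit Types (F : {mpoly R[i][3]}).

Lemma lct_ge d F lam : (0 < d)%N -> F \is d.-homog ->
  (forall P, log_canonical_at P F lam) -> ratr lam <= lct F.
Proof.
move=> d0 hF hlc; apply: lb_le_inf.
  by have [P hP] := curve_has_point d0 hF; exists (lct_at P F), P.
move=> _ [P [P0 FP] <-]; apply: ub_le_sup; last by exists lam => //; exact: hlc.
exists 1 => _ [l /= hl <-]; rewrite -[1](rmorph1 (@ratr R)) ler_rat.
exact: log_canonical_le1 hl.
Qed.

Lemma semistable_lct d (eps : rat) F : (3 <= d)%N -> F \is d.-homog -> reduced F ->
  0 <= eps -> eps * (100 * d ^ 2)%:R <= 1 -> GIT_semistable d F ->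
  eps = 0 \/ ~ pencil_product d F -> (5 + ratr eps) / (2 * d%:R) <= lct F.
Proof.
move=> d3 hF rF eps0 epsd ss hPN.
have -> : (5 + ratr eps) / (2 * d%:R) = ratr ((5 + eps) / (2 * d%:R)) :> R.
  by rewrite fmorph_div rmorphD rmorphM !rmorph_nat.
apply: (@lct_ge d) => // [|P]; first by apply: leq_trans d3.
exact: (semistable_log_canonical (eps := eps) d3 eps0 epsd erefl hF rF
  (semistable_numerically hF ss) hPN).
Qed.

(** Outside the pencils a positive [eps] is allowed. *)
Lemma semistable_lct_gt d F : (3 <= d)%N -> F \is d.-homog -> reduced F ->
  GIT_semistable d F -> ~ pencil_product d F -> 5 / (2 * d%:R) < lct F.
Proof.
move=> d3 hF rF ss hPN; have d0 : (0 < d)%N by apply: leq_trans d3.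
pose eps : rat := (100 * d ^ 2)%:R^-1.
have N0 : 0 < (100 * d ^ 2)%:R :> rat by rewrite ltr0n muln_gt0 expn_gt0 d0.
have e0 : 0 < eps by rewrite invr_gt0.
have := semistable_lct d3 hF rF (ltW e0) _ ss (or_intror hPN).
rewrite /eps mulVf ?gt_eqF // => /(_ (lexx _)); apply: lt_le_trans.
by rewrite ltr_pM2r ?invr_gt0 ?mulr_gt0 ?ltr0n // ltrDl ltr0q.
Qed.

End Threshold.

Theorem theorem1p15 (R : realType) (d : nat) (F : {mpoly R[i][3]}) :
  (3 <= d)%N -> F \is d.-homog -> reduced F ->
  [/\ lct F < 5 / (2 * d%:R) -> GIT_unstable d F,
      lct F <= 5 / (2 * d%:R) -> ~ GIT_stable d F
    & lct F = 5 / (2 * d%:R) -> (GIT_semistable d F <-> even_Ploski d F)].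
Proof.
move=> d3 hF rF; have F0 : F != 0 by case: rF.
have even_pencil := pencil_product_even d3 F0 hF.
split.
- move=> hlt ss; have h0 : (0 : rat) * (100 * d ^ 2)%:R <= 1 by rewrite mul0r.
  have := semistable_lct d3 hF rF (lexx 0) h0 ss (or_introl erefl).
  by rewrite rmorph0 addr0 leNgt hlt.
- move=> hle st; have ss : GIT_semistable d F by case: st => _ [I [hI I0 _]]; exists I.
  have [hP|hP] := pselect (pencil_product d F).
    by have [ed d2] := even_pencil hP; exact: (pencil_not_stable hF rF ed d2 hP st).
  by have := semistable_lct_gt d3 hF rF ss hP; rewrite ltNge hle.
- move=> heq; split=> [ss|hP]; last first.
    have [ed _] := hP; exact: (pencil_semistable hF ed (even_Ploski_pencil hP)).
  have [hP|hP] := pselect (pencil_product d F).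
    by have [ed d2] := even_pencil hP; exact: pencil_even_Ploski.
  by have := semistable_lct_gt d3 hF rF ss hP; rewrite heq ltxx.
Qed.
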